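(* Let $f\colon M\to M$ be a $C^{1+\eta}$ diffeomorphism and let $K\subset M$ be a partially hyperbolic set for $f$ with a Young structure $\Lambda\subset K$. Let $T\colon\Delta\to\Delta$ be the associated tower map and $\nu$ its SRB measure. (a) Suppose there exist $\alpha>1$ and $C_0>0$ such that $\mathrm{Cor}_\nu(\varphi,\psi\circ T^n)\leqslant C_0\|\varphi\|_\beta\|\psi\|_\beta\, n^{-\alpha}$ for every $\varphi,\psi\in\mathcal{F}_\beta(\Delta)$ and every $n\geqslant1$. Then $f$ admits a Young structure, with family of unstable disks $\Gamma^u$ and recurrence time $R$ (not necessarily those of $\Lambda$), for which there is $C_1>0$ with $\mathrm{Leb}_\gamma\{R>n\}\leqslant C_1 n^{-\alpha}$ for every $\gamma\in\Gamma^u$ and every $n\geqslant1$. (b) Suppose there exist $\tau,\theta>0$ and $C_0>0$ such that $\mathrm{Cor}_\nu(\varphi,\psi\circ T^n)\leqslant C_0\|\varphi\|_\beta\|\psi\|_\beta\, e^{-\tau n^\theta}$ for every $\varphi,\psi\in\mathcal{F}_\beta(\Delta)$ and every $n\geqslant1$. Then $f$ admits a Young structure, with family of unstable disks $\Gamma^u$ and recurrence time $R$ (not necessarily those of $\Lambda$), for which there are $\tau'>0$ and $C_1>0$ with $\mathrm{Leb}_\gamma\{R>n\}\leqslant C_1 e^{-\tau' n^{\theta'}}$ for every $\gamma\in\Gamma^u$ and every $n\geqslant1$, where $\theta'=\theta/(\theta+1)$.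
   Context: **Setting.** $M$ is a finite-dimensional compact Riemannian manifold with distance $d$. For a submanifold $\gamma\subset M$, $\mathrm{Leb}_\gamma$ is the Lebesgue measure on $\gamma$ induced by the restricted Riemannian metric. $C^{1+\eta}$ means $C^1$ with $\eta$-Hölder derivative, $0<\eta\leqslant1$. **Partially hyperbolic set.** A compact set $K\subset M$ that is forward invariant under $f$ and for which there are a $Df$-invariant splitting $T_KM=E^{ss}\oplus E^{cu}$ and a constant $0<\lambda<1$ such that, for some choice of Riemannian metric on $M$: (1) $\|Df|_{E^{ss}_x}\|<\lambda$ for all $x\in K$; (2) $\|Df|_{E^{ss}_x}\|\cdot\|Df^{-1}|_{E^{cu}_{f(x)}}\|<\lambda$ for all $x\in K$. **Continuous families and product structure.** A family $\Gamma$ is a continuous family of $C^1$ disks in $M$ if there are a compact metric space $X$, a unit disk $D$ in some $\mathbb{R}^k$ and an injective continuous $\Phi\colon X\times D\to M$ such that $\Gamma=\{\Phi(\{x\}\times D):x\in X\}$, $\Phi$ maps $X\times D$ homeomorphically onto its image, and $x\mapsto\Phi|_{\{x\}\times D}$ is a continuous map from $X$ into the space $\mathrm{Emb}^1(D,M)$ of $C^1$ embeddings of $D$ into $M$; put $\dim\Gamma=\dim D$. A compact set $\Lambda\subset M$ has a product structure if there are continuous families of $C^1$ disks $\Gamma^s,\Gamma^u$ with $\Lambda=(\bigcup_{\gamma\in\Gamma^s}\gamma)\cap(\bigcup_{\gamma\in\Gamma^u}\gamma)$, $\dim\Gamma^s+\dim\Gamma^u=\dim M$, and each $\gamma\in\Gamma^s$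 meeting each $\gamma'\in\Gamma^u$ in exactly one point. A set $\Lambda_0\subset\Lambda$ is an s-subset if it has a product structure with respect to families $\Gamma^s_0\subset\Gamma^s$ and $\Gamma^u_0=\Gamma^u$; it is a u-subset if it has a product structure with respect to $\Gamma^s_0=\Gamma^s$ and $\Gamma^u_0\subset\Gamma^u$. For $x\in\Lambda$ and $*=s,u$, $\gamma^*(x)$ is the disk of $\Gamma^*$ containing $x$. For $\gamma,\gamma'\in\Gamma^u$, the holonomy map $\Theta_{\gamma,\gamma'}\colon\gamma\cap\Lambda\to\gamma'\cap\Lambda$ is $\Theta_{\gamma,\gamma'}(x)=\gamma^s(x)\cap\gamma'$. **Young structure.** A compact set $\Lambda$ has a Young structure (with respect to $f$) if it has a product structure given by $\Gamma^s,\Gamma^u$, with $\mathrm{Leb}_\gamma(\Lambda\cap\gamma)>0$ for all $\gamma\in\Gamma^u$, and the following hold for some constants $C>0$ and $0<\beta<1$. (Y1) Markov: there are pairwise disjoint s-subsets $\Lambda_1,\Lambda_2,\dots\subset\Lambda$ with $\mathrm{Leb}_\gamma((\Lambda\setminus\bigcup_i\Lambda_i)\cap\gamma)=0$ for all $\gamma\in\Gamma^u$; for each $i\geqslant1$ there is $R_i\in\mathbb{N}$ such that $f^{R_i}(\Lambda_i)$ is a u-subset and, for all $x\in\Lambda_i$, $f^{R_i}(\gamma^s(x))\subset\gamma^s(f^{R_i}(x))$ and $f^{R_i}(\gamma^u(x))\supset\gamma^u(f^{R_i}(x))$. The recurrence time $R$ and return map $f^R$ are defined by $R|_{\Lambda_i}=R_i$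 and $f^R|_{\Lambda_i}=f^{R_i}|_{\Lambda_i}$. Let $\Lambda'\subset\Lambda$ be the set of points $x$ such that $(f^R)^n(x)$ lies in some $\Lambda_i$ for all $n\geqslant0$ (it meets each $\gamma\in\Gamma^u$ in a full $\mathrm{Leb}_\gamma$-measure subset of $\Lambda\cap\gamma$). For $x,y\in\Lambda'$ the separation time is $s(x,y)=\min\{n\geqslant0:(f^R)^n(x)\text{ and }(f^R)^n(y)\text{ lie in distinct }\Lambda_i\text{'s}\}$, with $\min\emptyset=\infty$; $s=0$ for all other points. (Y2) Contraction on stable disks: for all $i\geqslant1$, $\gamma\in\Gamma^s$ and $x,y\in\gamma\cap\Lambda_i$: $d((f^R)^n(x),(f^R)^n(y))\leqslant C\beta^n$ for all $n\geqslant0$, and $d(f^j(x),f^j(y))\leqslant Cd(x,y)$ for all $1\leqslant j\leqslant R_i$. (Y3) Expansion on unstable disks: for all $i\geqslant1$, $\gamma\in\Gamma^u$ and $x,y\in\gamma\cap\Lambda_i$: $d((f^R)^n(x),(f^R)^n(y))\leqslant C\beta^{s(x,y)-n}$ for all $n\geqslant0$, and $d(f^j(x),f^j(y))\leqslant Cd(f^R(x),f^R(y))$ for all $1\leqslant j\leqslant R_i$. (Y4) Gibbs: for all $i\geqslant1$, $\gamma\in\Gamma^u$ and $x,y\in\gamma\cap\Lambda_i$: $\log\frac{\det Df^R|_{T_x\gamma}}{\det Df^R|_{T_y\gamma}}\leqslant C\beta^{s(f^R(x),f^R(y))}$. (Y5) Regularity of the stable holonomy: for all $\gamma,\gamma'\in\Gamma^u$,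 $(\Theta_{\gamma,\gamma'})_*\mathrm{Leb}_\gamma$ is absolutely continuous with respect to $\mathrm{Leb}_{\gamma'}$ and its density $\rho_{\gamma,\gamma'}$ satisfies $\frac1C\leqslant\int_{\gamma'\cap\Lambda}\rho_{\gamma,\gamma'}\,d\mathrm{Leb}_{\gamma'}\leqslant C$ and $\log\frac{\rho_{\gamma,\gamma'}(x)}{\rho_{\gamma,\gamma'}(y)}\leqslant C\beta^{s(x,y)}$ for all $x,y\in\gamma'\cap\Lambda$. **Tail.** $\{R>n\}=\{x\in\Lambda:R(x)>n\}$, and $\mathrm{Leb}_\gamma\{R>n\}$ means $\mathrm{Leb}_\gamma(\{R>n\}\cap\gamma)$. **Young tower.** Given a set $\Lambda$ with a Young structure for $f$, with recurrence time $R$ and return map $f^R$, the tower is $\Delta=\{(x,\ell):x\in\Lambda,\ 0\leqslant\ell<R(x)\}$ (with $x$ restricted to the full-measure set $\Lambda'$, so that all iterates below are defined), and the tower map $T\colon\Delta\to\Delta$ is $T(x,\ell)=(x,\ell+1)$ if $\ell<R(x)-1$ and $T(x,\ell)=(f^R(x),0)$ if $\ell=R(x)-1$. Level $\ell$ is identified with $\{R>\ell\}\subset\Lambda$. An SRB measure for $T$ is a $T$-invariant probability measure whose conditionals on the unstable disks of $\Gamma^u$ (on each level) are absolutely continuous with respect to the Lebesgue measures on those disks; $\nu$ denotes the unique (ergodic) SRB measure of $T$. **Function spaces.** The separation time is extended to $\Delta$ by $s((x,\ell),(x',\ell'))=s(x,x')$ if $\ell=\ell'$ and $0$ otherwise.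 Fix $\beta\in(0,1)$ for which (Y2)–(Y5) hold for the given Young structure $\Lambda$. $\mathcal{F}_\beta(\Delta)$ is the space of $\varphi\colon\Delta\to\mathbb{R}$ for which there is $C>0$ with $|\varphi(y)-\varphi(z)|\leqslant C\beta^{s(y,z)}$ for all $y,z\in\Delta$ (with $\beta^\infty=0$), with norm $\|\varphi\|_\beta=|\varphi|_\beta+\|\varphi\|_\infty$, where $|\varphi|_\beta=\sup_{z\neq y}\frac{|\varphi(y)-\varphi(z)|}{\beta^{s(y,z)}}$ (with $0/0=0$). **Correlations.** $\mathrm{Cor}_\nu(\varphi,\psi\circ T^n)=\left|\int\varphi\,(\psi\circ T^n)\,d\nu-\int\varphi\,d\nu\int\psi\,d\nu\right|$. *)

(* Defs.v *)
From HB Require Import structures.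
From mathcomp Require Import all_boot all_order all_algebra.
From mathcomp Require Import all_classical all_reals all_analysis.

Set Implicit Arguments.
Unset Strict Implicit.
Unset Printing Implicit Defensive.

Import Order.TTheory GRing.Theory Num.Theory.
Import numFieldNormedType.Exports.

Local Open Scope classical_set_scope.
Local Open Scope ring_scope.

Notation borel T := (g_sigma_algebraType (@open T)).

(* [U] is meant to be open. In finite dimension this is the usual C^k: all
   directional derivatives up to order k exist and are continuous on [U]. *)
Fixpoint Ck {R : realType} {V W : normedModType R} (k : nat) (U : set V)
    (h : V -> W) : Prop :=
  match k with
  | 0%N => forall x, U x -> {for x, continuous h}
  | k'.+1 => (forall x, U x -> differentiable h x) /\
             (forall v : V, Ck k' U ('D_v h))
  end.

Definition smooth {R : realType} {V W : normedModType R} (U : set V)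
    (h : V -> W) : Prop := forall k, Ck k U h.

(* Boundaryless. [chart_at x] is a preferred chart around [x]; the tangent space
   at [x] is 'rV[R]_m, a vector being given by its coordinates in that chart.
   Second countability follows from compactness. *)
Record manifold (R : realType) (m : nat) := Manifold {
  mpoint :> ptopologicalType ;
  mpoint_hausdorff : hausdorff_space mpoint ;
  mpoint_compact : compact [set: mpoint] ;
  chart_index : Type ;
  chart_dom : chart_index -> set mpoint ;
  chart : chart_index -> mpoint -> 'rV[R]_m ;
  chart_inv : chart_index -> 'rV[R]_m -> mpoint ;
  chart_at : mpoint -> chart_index ;
  chart_at_dom : forall x, chart_dom (chart_at x) x ;
  chart_dom_open : forall i, open (chart_dom i) ;
  chart_img_open : forall i, open (chart i @` chart_dom i) ;
  chartK : forall i x, chart_dom i x -> chart_inv i (chart i x) = x ;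
  chart_cont : forall i x, chart_dom i x -> {for x, continuous (chart i)} ;
  chart_inv_cont : forall i p, (chart i @` chart_dom i) p ->
    {for p, continuous (chart_inv i)} ;
  chart_smooth : forall i j,
    smooth (chart i @` (chart_dom i `&` chart_dom j))
           (chart j \o chart_inv i)
}.

Section Manifold.
Context {R : realType} {m : nat} (M : manifold R m).

Definition C1_into (V : normedModType R) (U : set V) (F : V -> M) : Prop :=
  (forall x, U x -> {for x, continuous F}) /\
  (forall i, Ck 1 (U `&` F @^-1` chart_dom i) (@chart R m M i \o F)).

(* Vectors are rows: Df_x v is [v *m tangent_map f x]. *)
Definition tangent_map (f : M -> M) (x : M) : 'M[R]_m :=
  'J (chart (chart_at (f x)) \o f \o chart_inv (chart_at x))
     (chart (chart_at x) x).

Definition C1_holder (eta : R) (f : M -> M) : Prop :=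
  continuous f /\
  forall i j : chart_index M,
    let W := chart i @` (chart_dom i `&` f @^-1` chart_dom j) in
    let h := chart j \o f \o chart_inv i in
    Ck 1 W h /\
    (forall p, W p -> exists H : R, exists2 U, nbhs p U &
       forall q q', U q -> U q' -> `|'J h q - 'J h q'| <= H * `|q - q'| `^ eta).

Definition C1_holder_diffeo (eta : R) (f finv : M -> M) : Prop :=
  [/\ cancel f finv, cancel finv f, C1_holder eta f & C1_holder eta finv].

Definition qform (G : 'M[R]_m) (v : 'rV[R]_m) : R := (v *m G *m v^T) ord0 ord0.

(* [metric_mx x] is the inner product in the coordinates of [chart_at x];
   smoothness is required of its expression in every chart. *)
Record riemannian_metric := RiemannianMetric {
  metric_mx : M -> 'M[R]_m ;
  metric_sym : forall x, (metric_mx x)^T = metric_mx x ;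
  metric_pos : forall x v, v != 0 -> 0 < qform (metric_mx x) v ;
  metric_smooth : forall i : chart_index M,
    smooth (chart i @` chart_dom i)
      (fun p => let x := chart_inv i p in
                let A := 'J (chart (chart_at x) \o chart_inv i) p in
                A *m metric_mx x *m A^T)
}.

Definition tnorm (g : riemannian_metric) (x : M) (v : 'rV[R]_m) : R :=
  Num.sqrt (qform (metric_mx g x) v).

(* k-dimensional volume of the parallelepiped spanned by the rows of [E]. *)
Definition tvolume (g : riemannian_metric) (x : M) (k : nat)
    (E : 'M[R]_(k, m)) : R :=
  Num.sqrt (\det (E *m metric_mx g x *m E^T)).

Definition curve_length (g : riemannian_metric) (c : R -> M) : \bar R :=
  (\int[@lebesgue_measure R]_(t in `[0%R, 1%R])
     (tnorm g (c t) ('D_(1 : R^o) (chart (chart_at (c t)) \o c : R^o -> _) t))%:E)%E.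

(* +oo between distinct connected components. *)
Definition rdist (g : riemannian_metric) (x y : M) : \bar R :=
  ereal_inf [set curve_length g c | c in
    [set c : R -> M | [/\ C1_into (V := R^o) setT c, c 0 = x & c 1 = y]]].

Definition opnorm_on (g : riemannian_metric) (x y : M) (E : {vspace 'rV[R]_m})
    (A : 'M[R]_m) : R :=
  sup [set tnorm g y (v *m A) | v in [set v | v \in E /\ tnorm g x v <= 1]].

Definition partially_hyperbolic (f finv : M -> M) (K : set M) : Prop :=
  [/\ compact K, f @` K `<=` K &
   exists (Ess Ecu : M -> {vspace 'rV[R]_m}) (lam : R) (g : riemannian_metric),
   [/\ 0 < lam < 1,
       forall x, K x -> directv (Ess x + Ecu x)%VS /\ (Ess x + Ecu x)%VS = fullv,
       forall x, K x -> forall v,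
         (v \in Ess x) = (v *m tangent_map f x \in Ess (f x)) /\
         (v \in Ecu x) = (v *m tangent_map f x \in Ecu (f x)),
       forall x, K x -> opnorm_on g x (f x) (Ess x) (tangent_map f x) < lam &
       forall x, K x ->
         opnorm_on g x (f x) (Ess x) (tangent_map f x) *
         opnorm_on g (f x) x (Ecu (f x)) (tangent_map finv (f x)) < lam]].

Definition unit_disk (k : nat) : set 'rV[R]_k :=
  [set t | \sum_(i < k) t ord0 i ^+ 2 <= 1].
Arguments unit_disk : clear implicits.

(* The parameter space is a nonempty (pointed) compact metric space, and disks
   have positive dimension. [disk_map x] is a total map, of which only the
   restriction to the closed unit disk matters; as usual for a closed domain,
   C^1 means C^1 on some open neighbourhood. Being a homeomorphism onto the image
   is automatic for an injective continuous map from a compact to a Hausdorff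
   space. [disk_C1_cont] is continuity at [x0] in the C^1 topology, expressed
   with its usual subbasic neighbourhoods. *)
Record disk_family := DiskFamily {
  disk_param : pseudoPMetricType R ;
  disk_param_hausdorff : hausdorff_space disk_param ;
  disk_param_compact : compact [set: disk_param] ;
  disk_dim : nat ;
  disk_dim_gt0 : (0 < disk_dim)%N ;
  disk_map : disk_param -> 'rV[R]_disk_dim -> M ;
  disk_map_cont : {within [set: disk_param] `*` unit_disk disk_dim,
    continuous (fun p : disk_param * 'rV[R]_disk_dim => disk_map p.1 p.2)} ;
  disk_map_inj : forall x y t u, unit_disk disk_dim t -> unit_disk disk_dim u ->
    disk_map x t = disk_map y u -> x = y /\ t = u ;
  disk_C1 : forall x, exists U : set 'rV[R]_disk_dim,
    [/\ open U, unit_disk disk_dim `<=` U & C1_into U (disk_map x)] ;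
  disk_immersion : forall x t, unit_disk disk_dim t ->
    row_free ('J (chart (chart_at (disk_map x t)) \o disk_map x) t) ;
  disk_C1_cont : forall x0 (i : chart_index M) (K : set 'rV[R]_disk_dim) (e : R),
    compact K -> K `<=` unit_disk disk_dim ->
    (forall t, K t -> chart_dom i (disk_map x0 t)) -> 0 < e ->
    \forall x \near x0, forall t, K t ->
      [/\ chart_dom i (disk_map x t),
          `|chart i (disk_map x t) - chart i (disk_map x0 t)| < e &
          `|'J (chart i \o disk_map x) t - 'J (chart i \o disk_map x0) t| < e]
}.

(* The disks of a family are pairwise disjoint, by [disk_map_inj]. *)
Definition disk (F : disk_family) (w : disk_param F) : set M :=
  @disk_map F w @` unit_disk (disk_dim F).

(* The disk of the family that contains [x]. *)
Definition leaf (F : disk_family) (x : M) : set M :=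
  [set y | exists w : disk_param F, disk w x /\ disk w y].

Definition disk_tangent (F : disk_family) (w : disk_param F)
    (t : 'rV[R]_(disk_dim F)) : 'M[R]_(disk_dim F, m) :=
  'J (chart (chart_at (disk_map w t)) \o disk_map w) t.

Definition subfamily (F0 F : disk_family) : Prop :=
  forall w0 : disk_param F0, exists w : disk_param F, disk w0 = disk w.

Definition product_structure (L : set M) (Fs Fu : disk_family) : Prop :=
  [/\ compact L,
      L = (\bigcup_(w : disk_param Fs) disk w) `&`
          (\bigcup_(w : disk_param Fu) disk w),
      (disk_dim Fs + disk_dim Fu)%N = m &
      forall (a : disk_param Fs) (b : disk_param Fu),
        exists! z, disk a z /\ disk b z].

Definition s_subset (L : set M) (Fs Fu : disk_family) (L0 : set M) : Prop :=
  L0 `<=` L /\ exists2 F0, subfamily F0 Fs & product_structure L0 F0 Fu.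

Definition u_subset (L : set M) (Fs Fu : disk_family) (L0 : set M) : Prop :=
  L0 `<=` L /\ exists2 F0, subfamily F0 Fu & product_structure L0 Fs F0.

(* Iterated Lebesgue integral over R^k, which by Tonelli is the integral against
   k-dimensional Lebesgue measure for nonnegative Borel functions. *)
Fixpoint iterated_integral (k : nat) : ('rV[R]_k -> \bar R) -> \bar R :=
  match k with
  | 0%N => fun h => h 0
  | k'.+1 => fun h => (\int[@lebesgue_measure R]_t
      iterated_integral (fun v : 'rV[R]_k' => h (row_mx (t%:M : 'M[R]_1) v)))%E
  end.

(* Integral of a nonnegative Borel function against the Riemannian volume
   induced on the disk [w]. *)
Definition disk_integral (g : riemannian_metric) (F : disk_family)
    (w : disk_param F) (h : M -> \bar R) : \bar R :=
  iterated_integral (fun t : 'rV[R]_(disk_dim F) =>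
    ((\1_(unit_disk (disk_dim F)) t *
      tvolume g (disk_map w t) (disk_tangent w t))%:E * h (disk_map w t))%E).

(* Leb_gamma (A `&` gamma), for [A] Borel and gamma the disk [w]. *)
Definition disk_leb (g : riemannian_metric) (F : disk_family)
    (w : disk_param F) (A : set M) : \bar R :=
  disk_integral g w (fun x => (\1_A x)%:E).

(* The s-subsets are the [piece i] for [i] in [piece_index], a finite or infinite set
   of naturals, with return times [ret_time i]. *)
Record young_data := YoungData {
  base : set M ;
  sdisks : disk_family ;
  udisks : disk_family ;
  piece_index : set nat ;
  piece : nat -> set M ;
  ret_time : nat -> nat
}.

Section YoungData.
Variables (f : M -> M) (Y : young_data).

Definition pieces : set M := \bigcup_(i in piece_index Y) piece Y i.

(* [recurrence] and [return_map] are meaningful on [pieces] only. *)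
Definition recurrence (x : M) : nat :=
  ret_time Y (xget 0%N [set i | piece_index Y i /\ piece Y i x]).

Definition return_map (x : M) : M := iter (recurrence x) f x.

Definition returns (n : nat) (x : M) : Prop :=
  forall k, (k < n)%N -> pieces (iter k return_map x).

Definition base_inf : set M := [set x | forall n, returns n x].

Definition tail (n : nat) : set M := [set x | pieces x /\ (n < recurrence x)%N].

Definition separated (n : nat) (x y : M) : Prop :=
  exists i j, [/\ piece_index Y i, piece_index Y j, i <> j,
    piece Y i (iter n return_map x) & piece Y j (iter n return_map y)].

(* [None] stands for an infinite separation time. *)
Definition sep_time (x y : M) : option nat :=
  if `[< base_inf x /\ base_inf y >] then
    match pselect (exists n, `[< separated n x y >]) with
    | left h => Some (ex_minn h)
    | right _ => None
    end
  else Some 0%N.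

Definition sep_pow (b : R) (s : option nat) : R :=
  if s is Some n then b ^+ n else 0.

(* Riemannian |det Df^n restricted to T_x gamma|, gamma the disk [w] and
   x = disk_map w t. *)
Definition disk_det (g : riemannian_metric) (w : disk_param (udisks Y))
    (t : 'rV[R]_(disk_dim (udisks Y))) (n : nat) : R :=
  let x := disk_map w t in
  let E := disk_tangent w t in
  tvolume g (iter n f x) (E *m tangent_map (iter n f) x) / tvolume g x E.

Definition Y1_markov (g : riemannian_metric) : Prop :=
  [/\ trivIset (piece_index Y) (piece Y),
      forall i, piece_index Y i -> s_subset (base Y) (sdisks Y) (udisks Y) (piece Y i),
      forall w : disk_param (udisks Y), disk_leb g w (base Y `\` pieces) = 0%E &
      forall i, piece_index Y i ->
        [/\ (0 < ret_time Y i)%N,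
            u_subset (base Y) (sdisks Y) (udisks Y)
                     (iter (ret_time Y i) f @` piece Y i) &
            forall x, piece Y i x ->
              let F := iter (ret_time Y i) f in
              F @` leaf (sdisks Y) x `<=` leaf (sdisks Y) (F x) /\
              leaf (udisks Y) (F x) `<=` F @` leaf (udisks Y) x]].

(* The bounds on iterates of the return map are required when these are defined. *)
Definition Y2_contraction (g : riemannian_metric) (C b : R) : Prop :=
  forall i (w : disk_param (sdisks Y)) x y, piece_index Y i ->
    (disk w `&` piece Y i) x -> (disk w `&` piece Y i) y ->
    (forall n, returns n x -> returns n y ->
       (rdist g (iter n return_map x) (iter n return_map y) <= (C * b ^+ n)%:E)%E) /\
    (forall j, (1 <= j <= ret_time Y i)%N ->
       (rdist g (iter j f x) (iter j f y) <= C%:E * rdist g x y)%E).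

Definition Y3_expansion (g : riemannian_metric) (C b : R) : Prop :=
  forall i (w : disk_param (udisks Y)) x y, piece_index Y i ->
    (disk w `&` piece Y i) x -> (disk w `&` piece Y i) y ->
    (forall n, returns n x -> returns n y ->
       (rdist g (iter n return_map x) (iter n return_map y)
          <= (C * (sep_pow b (sep_time x y) / b ^+ n))%:E)%E) /\
    (forall j, (1 <= j <= ret_time Y i)%N ->
       (rdist g (iter j f x) (iter j f y)
          <= C%:E * rdist g (return_map x) (return_map y))%E).

Definition Y4_gibbs (g : riemannian_metric) (C b : R) : Prop :=
  forall i (w : disk_param (udisks Y)) (t u : 'rV[R]_(disk_dim (udisks Y))),
    piece_index Y i -> unit_disk _ t -> unit_disk _ u ->
    piece Y i (disk_map w t) -> piece Y i (disk_map w u) ->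
    ln (disk_det g w t (ret_time Y i) / disk_det g w u (ret_time Y i))
      <= C * sep_pow b (sep_time (return_map (disk_map w t))
                                 (return_map (disk_map w u))).

(* Preimage of [A] under the stable holonomy from the disk [a] to the disk [b]. *)
Definition holonomy_preimage (a b : disk_param (udisks Y)) (A : set M) : set M :=
  [set x | [/\ disk a x, base Y x &
            exists y, [/\ leaf (sdisks Y) x y, disk b y & A y]]].

(* [rho] is the density of the push-forward by the holonomy of Leb on the disk
   [a] with respect to Leb on the disk [a']. *)
Definition Y5_holonomy (g : riemannian_metric) (C b : R) : Prop :=
  forall a a' : disk_param (udisks Y), exists rho : M -> R,
  [/\ measurable_fun [set: borel M] (rho : borel M -> R),
      forall x, disk a' x -> base Y x -> 0 < rho x,
      forall A : set (borel M), measurable A ->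
        disk_leb g a (holonomy_preimage a a' A) =
        disk_integral g a' (fun x => (\1_(A `&` base Y) x * rho x)%:E),
      ((C^-1)%:E <= disk_integral g a' (fun x => (\1_(base Y) x * rho x)%:E)
         <= C%:E)%E &
      forall x y, (disk a' `&` base Y) x -> (disk a' `&` base Y) y ->
        ln (rho x / rho y) <= C * sep_pow b (sep_time x y)].

Definition young_structure (g : riemannian_metric) (C b : R) : Prop :=
  [/\ 0 < C, 0 < b < 1, product_structure (base Y) (sdisks Y) (udisks Y) &
      forall w : disk_param (udisks Y), (0 < disk_leb g w (base Y))%E] /\
  [/\ Y1_markov g, Y2_contraction g C b, Y3_expansion g C b, Y4_gibbs g C b
    & Y5_holonomy g C b].

Definition tower : set (M * nat) :=
  [set z | base_inf z.1 /\ (z.2 < recurrence z.1)%N].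

Definition tower_map (z : M * nat) : M * nat :=
  if (z.2.+1 < recurrence z.1)%N then (z.1, z.2.+1) else (return_map z.1, 0%N).

Definition tower_sep (y z : M * nat) : option nat :=
  if y.2 == z.2 then sep_time y.1 z.1 else Some 0%N.

(* [q l] is the quotient measure on the space of unstable disks of the
   restriction of [nu] to level [l], and [k l] gives its conditionals. *)
Definition srb_measure (g : riemannian_metric)
    (nu : probability (borel M * nat)%type R) : Prop :=
  [/\ nu tower = 1%E,
      forall A : set (borel M * nat)%type, measurable A -> A `<=` tower ->
        nu (tower `&` tower_map @^-1` A) = nu A &
      exists (q : nat -> {measure set (borel (disk_param (udisks Y))) -> \bar R})
             (k : nat -> R.-pker (borel (disk_param (udisks Y))) ~> (borel M)),
      forall l,
        (forall A : set (borel M), measurable A ->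
           nu (A `*` [set l]) = (\int[q l]_w k l w A)%E) /\
        {ae q l, forall w, k l w (disk w) = 1%E /\
           forall A : set (borel M), measurable A ->
             disk_leb g w A = 0%E -> k l w A = 0%E}].

(* Functions on the tower are total functions on M * nat of which only the
   restriction to [tower] is used. *)
Definition F_space (b : R) (phi : M * nat -> R) : Prop :=
  exists2 C : R, 0 < C & forall y z, tower y -> tower z ->
    `|phi y - phi z| <= C * sep_pow b (tower_sep y z).

Definition F_seminorm (b : R) (phi : M * nat -> R) : R :=
  sup [set r | exists y z, [/\ tower y, tower z &
    r = `|phi y - phi z| / sep_pow b (tower_sep y z)]].

Definition sup_norm (phi : M * nat -> R) : R :=
  sup [set `|phi z| | z in tower].

Definition F_norm (b : R) (phi : M * nat -> R) : R :=
  F_seminorm b phi + sup_norm phi.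

Definition correlation (nu : probability (borel M * nat)%type R)
    (phi psi : M * nat -> R) (n : nat) : R :=
  `| \int[nu]_(z in tower) (phi z * psi (iter n tower_map z))
     - (\int[nu]_(z in tower) phi z) * (\int[nu]_(z in tower) psi z) |.

(* Correlations of observables in F_b decay at the rate [a]. *)
Definition decay_rate (b : R) (nu : probability (borel M * nat)%type R)
    (C0 : R) (a : nat -> R) : Prop :=
  forall phi psi, F_space b phi -> F_space b psi -> forall n, (1 <= n)%N ->
    correlation nu phi psi n <= C0 * F_norm b phi * F_norm b psi * a n.

End YoungData.

End Manifold.

Arguments unit_disk {R} k.

(* Main.v *)
(* The given Young structure itself has the required tails.  On the tower, the
   observables 1_{R > l + n} and 1_{l = 0} lie in F_beta with norm at most 2,
   and the product of the first with the second composed with T^n vanishes; so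
   correlations decaying at rate a_n give nu_0{R > n} = O(a_n), where nu_0 is
   the restriction of nu to level 0.  In (b) this is even better than needed,
   since theta >= theta / (theta + 1).

   It remains to bound nu_0 from below by Lebesgue measure on unions of the
   pieces Lambda_i.  By invariance, nu_0(Lambda_i) = nu_0((f^R)^-n Lambda_i) for
   every n.  A Hahn decomposition on the sigma-algebra generated by the
   cylinders gives a set H with nu_0 >= delta Leb on all subsets of H in that
   sigma-algebra; H has positive Lebesgue measure by absolute continuity of the
   conditionals of nu and of the holonomies.  Now H is approximated by unions of
   n-cylinders, and by bounded distortion the proportion of each n-cylinder that
   returns to Lambda_i at time n is at least a fixed multiple of Leb(Lambda_i).

   Distortion is stated for Jacobians, so it is turned into a statement about
   Lebesgue measure by a change of variables; an inequality in both directions,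
   up to the factor e^2 4^k, is enough. *)
Require Import Defs.
From HB Require Import structures.
From mathcomp Require Import all_boot all_order all_fingroup all_algebra.
From mathcomp Require Import all_classical all_reals all_analysis.
From mathcomp Require Import measurable_realfun ring lra zify.

Set Implicit Arguments.
Unset Strict Implicit.
Unset Printing Implicit Defensive.

Import Order.TTheory GRing.Theory Num.Theory.
Import numFieldNormedType.Exports.

Local Open Scope classical_set_scope.
Local Open Scope ring_scope.

(** * Limits of matrices *)

(** The lower bound is the delicate direction: absolute continuity of the conditionals only says
    that [nu] ignores Lebesgue null sets, and bounds no density from below. The Hahn set supplies
    such a bound somewhere, and invariance carries it to every piece. Sets generated by cylinders,
    cut down to the base, consist of whole traces of stable disks; (Y5) then compares their measures
    on any two unstable disks, so a single reference disk suffices.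

    The obstacle to bounded distortion is that points of one cylinder on one unstable disk may
    return to different unstable disks. (Y4) is therefore iterated along branches with a fixed
    terminal disk, and the estimates are summed over the branches, finitely many because the mass of
    each is bounded below.

    Lebesgue measure on a disk is a weighted iterated integral in its parametrization, while an
    iterate of [f] and a disk of the family parametrize the same set without an explicit transition
    map. Their Jacobians are compared pointwise. The factor 4 is the side of the parallelepiped that
    receives a unit cell, and e^2 comes from rounding two densities to powers of e. *)

Section MatrixLimits.
Context {R : realType} {T : Type} (F : set_system T) {FF : Filter F}.

Lemma cvg_sumr (I : finType) (f : I -> T -> R) (a : I -> R) :
  (forall i, f i t @[t --> F] --> a i) ->
  \sum_i f i t @[t --> F] --> \sum_i a i.
Proof.
move=> fa; apply: cvg_big => //; exact: add_continuous.
Qed.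

Lemma cvg_prodr (I : finType) (f : I -> T -> R) (a : I -> R) :
  (forall i, f i t @[t --> F] --> a i) ->
  \prod_i f i t @[t --> F] --> \prod_i a i.
Proof.
move=> fa; apply: cvg_big => //; exact: mul_continuous.
Qed.

Lemma cvg_mx (m n : nat) (f : T -> 'M[R]_(m, n)) (A : 'M[R]_(m, n)) :
  (forall i j, f t i j @[t --> F] --> A i j) -> f t @[t --> F] --> A.
Proof.
move=> fA; move=> B [P PA sPB].
apply: (filterS (P := [set t | forall ij : 'I_m * 'I_n, P ij.1 ij.2 (f t ij.1 ij.2)])).
  by move=> t H; apply: sPB => i j; exact: (H (i, j)).
by apply: filter_forall => -[i j]; apply: fA; exact: PA.
Qed.

Lemma cvg_mx_coord (m n : nat) (f : T -> 'M[R]_(m, n)) (A : 'M[R]_(m, n)) i j :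
  f t @[t --> F] --> A -> f t i j @[t --> F] --> A i j.
Proof. by move=> fA; apply: cvg_comp fA (@coord_continuous _ _ _ i j A). Qed.

Lemma cvg_mulmx (m n p : nat) (f : T -> 'M[R]_(m, n)) (g : T -> 'M[R]_(n, p))
    (A : 'M[R]_(m, n)) (B : 'M[R]_(n, p)) :
  f t @[t --> F] --> A -> g t @[t --> F] --> B ->
  f t *m g t @[t --> F] --> A *m B.
Proof.
move=> fA gB; apply: cvg_mx => i j; rewrite mxE.
under eq_cvg do rewrite mxE.
by apply: cvg_sumr => l; apply: cvgM; exact: cvg_mx_coord.
Qed.

Lemma cvg_trmx (m n : nat) (f : T -> 'M[R]_(m, n)) (A : 'M[R]_(m, n)) :
  f t @[t --> F] --> A -> (f t)^T @[t --> F] --> A^T.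
Proof.
move=> fA; apply: cvg_mx => i j; rewrite mxE.
under eq_cvg do rewrite mxE.
exact: cvg_mx_coord.
Qed.

Lemma cvg_det (n : nat) (f : T -> 'M[R]_n) (A : 'M[R]_n) :
  f t @[t --> F] --> A -> \det (f t) @[t --> F] --> \det A.
Proof.
move=> fA; rewrite /determinant; apply: cvg_sumr => s.
apply: cvgM; first exact: cvg_cst.
by apply: cvg_prodr => i; exact: cvg_mx_coord.
Qed.

End MatrixLimits.

Section MatrixNorm.
Context {R : realType}.

Lemma mulmx_norm_le (m n : nat) (A : 'M[R]_(m, n)) :
  exists2 b, 0 <= b & forall v : 'rV[R]_m, `|v *m A| <= b * `|v|.
Proof.
exists (\sum_i `|row i A|); first exact: sumr_ge0.
move=> v; rewrite mulmx_sum_row (le_trans (ler_norm_sum _ _ _))// mulr_suml.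
apply: ler_sum => i _; rewrite normrZ mulrC ler_wpM2l//.
rewrite -[leRHS]/(mx_norm v) mx_normrE.
by apply/bigmax_geP; right => /=; exists (ord0, i).
Qed.

Lemma continuous_mulmxr (m n : nat) (A : 'M[R]_(m, n)) :
  continuous (fun v : 'rV[R]_m => v *m A).
Proof.
by move=> v; apply: (@cvg_mulmx R _ (nbhs v) _ _ _ _ (fun u => u) (fun=> A));
  [exact: cvg_id|exact: cvg_cst].
Qed.

End MatrixNorm.

(** * Lebesgue measure on row vectors *)

Lemma measurable_borel_open (T : ptopologicalType) (O : set T) :
  open O -> measurable (O : set (borel T)).
Proof. exact: (@sub_sigma_algebra _ setT (@open T)). Qed.

Lemma measurable_borel_closed (T : ptopologicalType) (F : set T) :
  closed F -> measurable (F : set (borel T)).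
Proof.
move=> cF; rewrite -(setCK F); apply: measurableC.
by apply: measurable_borel_open; apply: closed_openC.
Qed.

Lemma measurable_fun_open d (S : measurableType d) (T : ptopologicalType)
    (h : S -> borel T) :
  (forall O : set T, open O -> measurable (h @^-1` O)) ->
  measurable_fun setT h.
Proof.
move=> hO; apply: (@measurability _ _ S (borel T) setT h (@open T)) => //.
by move=> _ [B oB <-]; rewrite setTI; exact: hO.
Qed.

Lemma measurable_fun_borel (T U : ptopologicalType) (h : T -> U) :
  continuous h -> measurable_fun [set: borel T] (h : borel T -> borel U).
Proof.
move=> ch; apply: measurable_fun_open => O oO; apply: measurable_borel_open.
by move/continuousP: ch; apply.
Qed.

Section RealBorel.
Context {R : realType}.

Lemma measurable_fun_openR d (S : measurableType d) (h : S -> R) :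
  (forall O : set R, open O -> measurable (h @^-1` O)) ->
  measurable_fun setT h.
Proof.
move=> hO; apply: (measurability (@RGenOpens.G R)); first exact: RGenOpens.measurableE.
move=> _ [_ [a [b ->]] <-]; rewrite setTI; apply: hO.
exact: interval_open.
Qed.

Lemma measurable_fun_borelR (T : ptopologicalType) (h : T -> R) :
  continuous h -> measurable_fun [set: borel T] (h : borel T -> R).
Proof.
move=> ch; apply: measurable_fun_openR => O oO; apply: measurable_borel_open.
by move/continuousP: ch; apply.
Qed.

End RealBorel.

Section SigmaFinitePack.
Context d (T : measurableType d) (R : realType).
Variable nu : {measure set T -> \bar R}.

(** A synonym of [nu] that takes the finiteness proof as an argument, so that a sigma-finite
    structure can be attached to it. *)
Definition sigma_finite_copy & sigma_finite setT nu : set T -> \bar R := nu.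

Variable sf : sigma_finite setT nu.

HB.instance Definition _ := Measure.copy (sigma_finite_copy sf) nu.
HB.instance Definition _ :=
  Measure_isSigmaFinite.Build _ _ _ (sigma_finite_copy sf) sf.

Lemma sigma_finite_pack :
  exists mu : {sigma_finite_measure set T -> \bar R},
    (mu : set T -> \bar R) = nu.
Proof. by exists (sigma_finite_copy sf). Qed.

End SigmaFinitePack.

Section RowMeasure.
Context {R : realType}.

Lemma row_mx_norm (k : nat) (p : 'rV[R]_k) (r : R) : 0 <= r ->
  (forall i, `|p ord0 i| <= r) -> `|p| <= r.
Proof.
move=> r0 H; rewrite -[leLHS]/(mx_norm p) mx_normrE.
by apply/bigmax_leP; split => // -[i j] _ /=; rewrite (ord1 i).
Qed.

Lemma row_coord_norm (k : nat) (p : 'rV[R]_k) i : `|p ord0 i| <= `|p|.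
Proof.
rewrite -[leRHS]/(mx_norm p) mx_normrE.
by apply/bigmax_geP; right => /=; exists (ord0, i).
Qed.

Lemma row_mx_norm_lt (k : nat) (p : 'rV[R]_k) (r : R) : 0 < r ->
  (forall i, `|p ord0 i| < r) -> `|p| < r.
Proof.
move=> r0 H; rewrite -[ltLHS]/(mx_norm p) mx_normrE.
by apply/bigmax_ltP; split => // -[i j] _ /=; rewrite (ord1 i).
Qed.

Lemma continuous_coord (k : nat) i : continuous (fun v : 'rV[R]_k => v ord0 i).
Proof. exact: coord_continuous. Qed.

Definition box (k : nat) (A : 'I_k -> set R) : set 'rV[R]_k :=
  [set v | forall i, A i (v ord0 i)].

Lemma measurable_box (k : nat) (A : 'I_k -> set R) :
  (forall i, measurable (A i)) -> measurable (box A : set (borel 'rV[R]_k)).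
Proof.
move=> mA.
rewrite (_ : box A = \bigcap_(i in [set: 'I_k]) [set v | A i (v ord0 i)]); last first.
  by apply/seteqP; split => v /= H i; [move=> _|]; apply: H.
apply: fin_bigcap_measurable => // i _.
rewrite -[X in measurable X]setTI.
exact: (measurable_fun_borelR (@continuous_coord k i)).
Qed.

Lemma row_consE (k : nat) (t : R) (v : 'rV[R]_k) (A : 'I_k.+1 -> set R) :
  box A (row_mx (t%:M : 'M[R]_1) v) <->
  A ord0 t /\ box (fun i => A (lift ord0 i)) v.
Proof.
have E0 : (row_mx (t%:M : 'M[R]_1) v : 'rV[R]_k.+1) ord0 ord0 = t.
  by rewrite mxE; case: splitP => j //=; rewrite (ord1 j) mxE eqxx.
have E1 i : (row_mx (t%:M : 'M[R]_1) v : 'rV[R]_k.+1) ord0 (lift ord0 i) = v ord0 i.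
  rewrite mxE; case: splitP => j /=; first by rewrite (ord1 j).
  by rewrite /bump leq0n !add1n => -[] /val_inj ->.
split => [H|[H0 H1] i].
  by split=> [|i]; [move: (H ord0); rewrite E0|move: (H (lift ord0 i)); rewrite E1].
by case: (unliftP ord0 i) => [j ->|->]; rewrite ?E0// E1; exact: H1.
Qed.

(** A countable base of the topology of R^k: with rational centres and radii inverse to integers,
    every open set is a countable union of boxes. *)
Definition ratcube (k : nat) (q : 'rV[rat]_k * nat) : set 'rV[R]_k :=
  box (fun i => `]ratr (q.1 ord0 i) - q.2.+1%:R^-1,
                  ratr (q.1 ord0 i) + q.2.+1%:R^-1[%classic).

Lemma open_bigcup_ratcube (k : nat) (O : set 'rV[R]_k) : open O ->
  O = \bigcup_(q in [set q | ratcube q `<=` O]) ratcube q.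
Proof.
move=> oO; apply/seteqP; split => v; last by case=> q; apply.
move=> Ov; have /nbhs_ballP [e e0 eO] : nbhs v O by exact: open_nbhs_nbhs.
have [n ne] : exists n : nat, n.+1%:R^-1 < e / 2.
  have e20 : 0 < e / 2 by rewrite divr_gt0.
  have [n _ /(_ n (leqnn n)) H] := near_infty_natSinv_lt (PosNum e20).
  by exists n.
have in0 : 0 < n.+1%:R^-1 :> R by rewrite invr_gt0.
have [r rE] : exists r : R, r = n.+1%:R^-1 by exists n.+1%:R^-1.
rewrite -rE in ne in0.
have /choice [c cP] : forall i : 'I_k, exists c : rat,
    ratr c \in `]v ord0 i - r, v ord0 i + r[.
  move=> i; apply: rat_in_itvoo; lra.
exists ((\row_i c i), n); last first.
  move=> i; rewrite /= mxE in_itv/= -rE; have := cP i; rewrite in_itv /=; lra.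
move=> u ucube; apply: eO; rewrite -ball_normE /=.
apply: row_mx_norm_lt => // i; rewrite !mxE.
have := ucube i; rewrite /= mxE in_itv/= -rE; have := cP i; rewrite in_itv /=.
move=> /andP[h1 h2] /andP[h3 h4]; rewrite ltr_norml; apply/andP; split; lra.
Qed.

(** Links the product sigma-algebra on R x R^k to the Borel sets of R^(k+1): the preimage of a
    rational cube is a product, and open sets are countable unions of such cubes. *)
Lemma measurable_row_cons (k : nat) :
  measurable_fun [set: R * borel 'rV[R]_k]
    (fun p => row_mx (p.1%:M : 'M[R]_1) p.2 : borel 'rV[R]_k.+1).
Proof.
apply: measurable_fun_open => O oO.
rewrite (open_bigcup_ratcube oO) preimage_bigcup bigcup_mkcond.
apply: countable_bigcupT_measurable => [|q]; first exact: countableP.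
case: ifP => _; last by [].
rewrite (_ : _ @^-1` _ = [set p | (`]ratr (q.1 ord0 ord0) - q.2.+1%:R^-1, 
   ratr (q.1 ord0 ord0) + q.2.+1%:R^-1[%classic : set R) p.1] `&`
   [set p | box (fun i => `]ratr (q.1 ord0 (lift ord0 i)) - q.2.+1%:R^-1, 
   ratr (q.1 ord0 (lift ord0 i)) + q.2.+1%:R^-1[%classic) p.2]); last first.
  apply/seteqP; split => -[t v] /=.
    by move/row_consE => [].
  by move=> [h1 h2]; apply/row_consE.
apply: measurableI.
  by rewrite -[X in measurable X]setTI; apply: measurable_fst => //; exact: measurable_itv.
rewrite -[X in measurable X]setTI; apply: measurable_snd => //.
apply: measurable_box => i; exact: measurable_itv.
Qed.

Lemma box0E (A : 'I_0 -> set R) : box A = setT.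
Proof. by apply/seteqP; split => // v _ []. Qed.

Lemma finite_box_cover (k : nat) :
  [set: 'rV[R]_k] = \bigcup_n box (fun=> `[- n%:R, n%:R]%classic).
Proof.
apply/seteqP; split => // v _; exists (Num.trunc `|v|).+1 => // i /=.
rewrite in_itv /= -ler_norml (le_trans (row_coord_norm v i))//.
by rewrite ltW// Num.Theory.truncnS_gt.
Qed.

(** By induction, the product measure is pushed forward under concatenation, and Tonelli unfolds one
    step of [iterated_integral]. The box formula travels along because it yields sigma-finiteness of
    the new measure. *)
Lemma lebesgue_row_exists (k : nat) :
  exists mu : {sigma_finite_measure set (borel 'rV[R]_k) -> \bar R},
    (forall h : borel 'rV[R]_k -> \bar R, measurable_fun setT h ->
       (forall v, 0 <= h v)%E -> iterated_integral h = (\int[mu]_v h v)%E) /\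
    (forall A : 'I_k -> set R, (forall i, measurable (A i)) ->
       mu (box A) = (\prod_i lebesgue_measure (A i))%E).
Proof.
elim: k => [|k [mu [muE mubox]]].
  exists (\d_(0 : borel 'rV[R]_0)); split.
    move=> h mh h0; rewrite integral_dirac// diracT mul1e /=.
    by congr h; apply/rowP; case.
  by move=> A mA; rewrite box0E big_ord0 /= diracE mem_set.
pose c : measurableTypeR R * borel 'rV[R]_k -> borel 'rV[R]_k.+1 :=
  fun p => row_mx ((p.1 : R)%:M : 'M[R]_1) p.2.
have mc : measurable_fun [set: measurableTypeR R * borel 'rV[R]_k] c := @measurable_row_cons k.
pose nu0 : {measure set (borel 'rV[R]_k.+1) -> \bar R} :=
  pushforward (lebesgue_measure \x mu)%E c.
pose nu := nu0 mc.
have nubox A : (forall i, measurable (A i)) ->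
    nu (box A) = (\prod_i lebesgue_measure (A i))%E.
  move=> mA.
  rewrite -[LHS]/((lebesgue_measure \x mu)%E (c @^-1` box A)).
  rewrite (_ : _ @^-1` _ = A ord0 `*` box (fun i => A (lift ord0 i))); last first.
    apply/seteqP; split => -[t v] /=.
      by move/row_consE => [].
    by move=> [h1 h2]; apply/row_consE.
  rewrite product_measure1E ?big_ord_recl ?mubox//.
    exact: mA.
  by apply: measurable_box => i; exact: mA.
have sf : sigma_finite setT nu.
  exists (fun n => box (fun=> `[- n%:R, n%:R]%classic)); first exact: finite_box_cover.
  move=> n; split; first by apply: measurable_box => i; exact: measurable_itv.
  rewrite nubox; last by move=> i; exact: measurable_itv.
  rewrite (eq_bigr (fun=>
    (fine (lebesgue_measure (`[- n%:R, n%:R]%classic : set R)))%:E)).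
    by rewrite prodEFin ltry.
  move=> i _; rewrite fineK// lebesgue_measure_itv /=.
  by case: ifP.
have [m mE] := sigma_finite_pack sf; exists m; rewrite mE; split => //.
move=> h mh h0 /=.
pose pm : {measure set (measurableTypeR R * borel 'rV[R]_k) -> \bar R} :=
  (lebesgue_measure \x mu)%E.
have mhc : measurable_fun [set: measurableTypeR R * borel 'rV[R]_k] (h \o c).
  move=> _ A mA; rewrite setTI comp_preimage -[X in measurable X]setTI.
  have mhA := mh measurableT A mA; rewrite setTI in mhA.
  exact: (mc measurableT _ mhA).
have E := @ge0_integral_pushforward _ _ _ _ R c mc pm setT h measurableT mh (fun y _ => h0 y).
transitivity (\int[(lebesgue_measure \x mu)%E]_p (h \o c) p)%E; last by rewrite -E.
rewrite (fubini_tonelli1 (h \o c)); [|exact: mhc|by move=> x; exact: h0].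
apply: eq_integral => t _; rewrite muE//.
exact: (measurableT_comp mhc (pair1_measurable (t : measurableTypeR R))).
Qed.

End RowMeasure.

(** * Affine substitutions on the line *)

Section Affine1.
Context {R : realType}.
Local Notation leb := (@lebesgue_measure R).

Lemma measurable_affine (c a : R) :
  measurable_fun [set: measurableTypeR R] (fun t : R => (c * t + a) : measurableTypeR R).
Proof.
by apply: measurable_funD => //; apply: measurable_funM.
Qed.

Lemma lebesgue_affine (c a : R) (A : set R) : c != 0 -> measurable A ->
  leb A = (`|c|%:E * leb ((fun t => (c * t + a)%R) @^-1` A))%E.
Proof.
move=> c0 mA.
pose nu0 : {measure set (measurableTypeR R) -> \bar R} :=
  pushforward leb (fun t : measurableTypeR R => (c * t + a : measurableTypeR R)).
pose nu : {measure set (measurableTypeR R) -> \bar R} :=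
   mscale (NngNum (normr_ge0 c)) (nu0 (measurable_affine c a)).
rewrite (@lebesgue_measure_unique R nu)// => X [[x y]] _ <- /=.
rewrite /nu /mscale /= /pushforward.
have [cp|cn|c0'] := ltgtP c 0; last by rewrite c0' eqxx in c0.
(* For negative [c] the preimage of []x, y]] is closed on the left and open on the right. *)
- rewrite (_ : _ @^-1` _ = `[((y - a) / c), ((x - a) / c)[%classic); last first.
    apply/seteqP; split => t /=; rewrite !in_itv /= ler_ndivrMr// ltr_ndivlMr//;
      rewrite !(mulrC t); lra.
  rewrite !lebesgue_measure_itv /= !lte_fin ltr_ndivrMr// divfK// ltrD2r.
  case: ifP; rewrite ?mule0// => xy; rewrite -!EFinB -EFinM ltr0_norm//.
  by congr (_%:E); field.
- rewrite (_ : _ @^-1` _ = `]((x - a) / c), ((y - a) / c)]%classic); last first.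
    apply/seteqP; split => t /=; rewrite !in_itv /= ler_pdivlMr// ltr_pdivrMr//;
      rewrite !(mulrC t); lra.
  rewrite !lebesgue_measure_itv /= !lte_fin ltr_pdivrMr// divfK// ltrD2r.
  case: ifP; rewrite ?mule0// => xy; rewrite -!EFinB -EFinM gtr0_norm//.
  by congr (_%:E); field.
Qed.

Lemma ge0_integral_affine (c a : R) (h : measurableTypeR R -> \bar R) :
  c != 0 -> measurable_fun setT h -> (forall t, 0 <= h t)%E ->
  (`|c|%:E * \int[leb]_t h (c * t + a)%R = \int[leb]_t h t)%E.
Proof.
move=> c0 mh h0.
pose nu0 : {measure set (measurableTypeR R) -> \bar R} :=
  pushforward leb (fun t : measurableTypeR R => (c * t + a : measurableTypeR R)).
pose nu1 := nu0 (measurable_affine c a).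
pose nu : {measure set (measurableTypeR R) -> \bar R} :=
   mscale (NngNum (normr_ge0 c)) nu1.
rewrite [RHS](@eq_measure_integral _ _ _ _ nu leb)//; last first.
  by move=> A mA _; rewrite [LHS](lebesgue_affine a c0 mA).
rewrite ge0_integral_mscale//=.
have E := @ge0_integral_pushforward _ _ _ _ R _ (measurable_affine c a) leb setT h
  measurableT mh (fun y _ => h0 y).
by congr (_ * _)%E; rewrite -E.
Qed.

End Affine1.

(** * Lebesgue measure on R^k under invertible affine maps *)

Section LebRow.
Context {R : realType}.


Definition obox (k : nat) (a b : 'I_k -> R) : set 'rV[R]_k :=
  box (fun i => `]a i, b i[%classic).

Lemma measurable_obox (k : nat) (a b : 'I_k -> R) :
  measurable (obox a b : set (borel 'rV[R]_k)).
Proof. by apply: measurable_box => i; exact: measurable_itv. Qed.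

(** Open boxes are stable under intersection and generate the Borel sets through the rational cubes,
    so uniqueness of measures applies along the exhausting cubes []-n, n[^k]. *)
Lemma borel_row_unique (k : nat)
    (m1 m2 : {measure set (borel 'rV[R]_k) -> \bar R}) :
  (forall a b : 'I_k -> R, m1 (obox a b) = m2 (obox a b)) ->
  (forall n : nat, (m1 (obox (fun i : 'I_k => - n%:R)%R (fun i : 'I_k => n%:R)%R) < +oo)%E) ->
  forall A, measurable A -> m1 A = m2 A.
Proof.
move=> m12 fin; pose G : set (set 'rV[R]_k) := [set B | exists a b, B = obox a b].
have GE : @measurable _ (borel 'rV[R]_k) = <<s G >>.
  apply/seteqP; split.
    apply: smallest_sub; first exact: smallest_sigma_algebra.
    move=> O /open_bigcup_ratcube ->; rewrite bigcup_mkcond.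
    pose T := g_sigma_algebraType G.
    apply: (@countable_bigcupT_measurable _ T _ _ (countableP _)) => q.
    case: ifP => _; last exact: (@measurable0 _ T).
    apply: sub_sigma_algebra.
    by exists (fun i => ratr (q.1 ord0 i) - q.2.+1%:R^-1),
              (fun i => ratr (q.1 ord0 i) + q.2.+1%:R^-1).
  apply: smallest_sub; first exact: smallest_sigma_algebra.
  by move=> _ [a [b ->]]; exact: measurable_obox.
apply: (@measure_unique _ R (borel 'rV[R]_k) G (fun n => obox (fun=> - n%:R) (fun=> n%:R)) GE) => //.
- move=> _ _ [a [b ->]] [a' [b' ->]].
  exists (fun i => Num.max (a i) (a' i)), (fun i => Num.min (b i) (b' i)).
  apply/seteqP; split => v.
    move=> [h1 h2] i; have := h1 i; have := h2 i; rewrite /= !in_itv /= gt_max lt_min.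
    by move=> /andP[-> ->] /andP[-> ->].
  move=> h; split=> i; have := h i; rewrite /= !in_itv /= gt_max lt_min.
    by move=> /andP[/andP[-> _] /andP[-> _]].
  by move=> /andP[/andP[_ ->] /andP[_ ->]].
- by move=> n; exists (fun=> - n%:R), (fun=> n%:R).
- apply/seteqP; split => // v _; exists (Num.trunc `|v|).+1 => // i /=.
  rewrite in_itv /= -ltr_norml (le_lt_trans (row_coord_norm v i))//.
  by rewrite Num.Theory.truncnS_gt.
- by move=> _ [a [b ->]].
Qed.

Definition lebrow (k : nat) :
    {sigma_finite_measure set (borel 'rV[R]_k) -> \bar R} :=
  projT1 (cid (lebesgue_row_exists k)).

Lemma iterated_integralE (k : nat) (h : borel 'rV[R]_k -> \bar R) :
  measurable_fun setT h -> (forall v, 0 <= h v)%E ->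
  iterated_integral h = (\int[lebrow k]_v h v)%E.
Proof. by rewrite /lebrow; case: cid => mu /= [H _]; exact: H. Qed.

Lemma lebrow_box (k : nat) (A : 'I_k -> set R) :
  (forall i, measurable (A i)) ->
  lebrow k (box A) = (\prod_i lebesgue_measure (A i))%E.
Proof. by rewrite /lebrow; case: cid => mu /= [_ H]; exact: H. Qed.

Lemma lebrow_obox (k : nat) (a b : 'I_k -> R) : (forall i, a i <= b i) ->
  lebrow k (obox a b) = (\prod_i (b i - a i))%:E.
Proof.
move=> ab; rewrite lebrow_box; last by move=> i; exact: measurable_itv.
rewrite -prodEFin; apply: eq_bigr => i _; rewrite lebesgue_measure_itv /= lte_fin.
by case: ltP => // ba; rewrite EFinB (@le_anti _ _ (a i) (b i)) ?ab ?subee.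
Qed.

Lemma row_measure_fin (k : nat) (A : set 'rV[R]_k) (r : R) :
  measurable (A : set (borel _)) -> (forall v, A v -> `|v| < r) ->
  (lebrow k A < +oo)%E.
Proof.
move=> mA Ar; have [r0|r0] := leP r 0.
  rewrite (_ : A = set0) ?measure0//; apply/seteqP; split => // v /Ar.
  by rewrite ltNge (le_trans r0).
apply: (@le_lt_trans _ _ (lebrow k (obox (fun=> - r) (fun=> r)))).
  apply: le_measure; rewrite ?inE//; first exact: measurable_obox.
  move=> v /Ar vr i; rewrite /= in_itv /= -ltr_norml.
  exact: le_lt_trans (row_coord_norm v i) vr.
by rewrite lebrow_obox ?ltry// => i; rewrite ge0_cp// ltW.
Qed.

(** Change of variables with constant Jacobian [d]. Measurability is bundled in so that the property
    composes, which reduces affine maps to the factors of a matrix decomposition. *)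
Definition scales (k : nat) (T : borel 'rV[R]_k -> borel 'rV[R]_k) (d : R) : Prop :=
  [/\ measurable_fun setT T, 0 <= d &
   forall h : borel 'rV[R]_k -> \bar R, measurable_fun setT h ->
    (forall v, 0 <= h v)%E ->
    (d%:E * \int[lebrow k]_v h (T v) = \int[lebrow k]_v h v)%E].

Lemma scales_comp (k : nat) (S T : borel 'rV[R]_k -> borel 'rV[R]_k) (c d : R) :
  scales S c -> scales T d -> scales (S \o T) (c * d).
Proof.
move=> [mS c0 HS] [mT d0 HT]; split; [exact: measurableT_comp|exact: mulr_ge0|].
move=> h mh h0; rewrite EFinM -muleA.
rewrite (HT (fun v => h (S v)))//; last exact: measurableT_comp.
by rewrite HS.
Qed.

(** With the first coordinate [t] fixed, the others undergo an affine map whose translation depends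
    on [t]; this is why the statement carries a translation. The outer integral is then a
    one-dimensional affine substitution. *)
Lemma scales_upper (k : nat) (A : 'M[R]_k) (a : 'rV[R]_k) :
  (forall i j : 'I_k, (j < i)%N -> A i j = 0) -> \det A != 0 ->
  scales (fun v => v *m A + a) `|\det A|.
Proof.
have mAa (l : nat) (B : 'M[R]_l) (b : 'rV[R]_l) :
    measurable_fun [set: borel 'rV[R]_l] (fun v => v *m B + b : borel 'rV[R]_l).
  have cB : continuous (fun v : 'rV[R]_l => v *m B + b).
    move=> v; apply: (@continuousD R 'rV[R]_l 'rV[R]_l (fun u => u *m B) (fun=> b) v).
      exact: (@continuous_mulmxr R l l B v).
    exact: cst_continuous.
  exact: measurable_fun_borel cB.
elim: k A a => [|k IH] A a up dA; split => //; move=> h mh h0.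
  rewrite det_mx00 normr1 mul1e; apply: eq_integral => v _.
  by congr h; apply/rowP; case.
have mhA : measurable_fun setT (fun v : borel 'rV[R]_k.+1 => h (v *m A + a)) :=
  measurableT_comp mh (mAa _ A a).
rewrite -!iterated_integralE// {mhA}.
rewrite -[k.+1]/(1 + k)%N in A a up dA h mh h0 *.
pose A' := drsubmx A; pose r := ursubmx A; pose c := A ord0 ord0.
pose a0 := a ord0 ord0; pose a' := rsubmx a.
have Ac : ulsubmx A = c%:M.
  apply/matrixP => i j; rewrite !mxE (ord1 i) (ord1 j) eqxx /c.
  by congr (A _ _); apply: val_inj.
have A0 : dlsubmx A = 0.
  apply/matrixP => i j; rewrite !mxE; apply: up => /=.
  by rewrite (ord1 j).
have AE : A = block_mx c%:M r 0 A' by rewrite -[LHS]submxK Ac A0.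
have dE : \det A = c * \det A' by rewrite AE det_ublock det_scalar1.
have c0 : c != 0 by move: dA; rewrite dE mulf_eq0 negb_or => /andP[].
have dA' : \det A' != 0 by move: dA; rewrite dE mulf_eq0 negb_or => /andP[].
have up' (i j : 'I_k) : (j < i)%N -> A' i j = 0.
  by move=> ji; rewrite !mxE; apply: up.
have E (t : R) (v : 'rV[R]_k) : row_mx (t%:M : 'M[R]_1) v *m A + a =
    row_mx (c * t + a0)%:M (v *m A' + (t *: r + a')).
  rewrite AE mul_row_block mulmx0 addr0 -(hsubmxK a) add_row_mx.
  rewrite -scalar_mxM mul_scalar_mx (mulrC t); congr row_mx; last first.
    by rewrite addrCA addrA.
  rewrite raddfD /=; congr (_ + _); apply/matrixP => i j.
  by rewrite (ord1 i) (ord1 j) !mxE eqxx; congr (a _ _); apply: val_inj.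
have mrow (t : R) : measurable_fun setT (fun v : borel 'rV[R]_k =>
    row_mx (t%:M : 'M[R]_1) v : borel 'rV[R]_(1 + k)).
  exact: (measurableT_comp (@measurable_row_cons R k) (pair1_measurable (t : measurableTypeR R))).
have mht (t : R) : measurable_fun setT (fun v : borel 'rV[R]_k =>
    h (row_mx (t%:M : 'M[R]_1) v)).
  exact: (measurableT_comp mh (mrow t)).
pose H (t : R) := (\int[lebrow k]_v h (row_mx (t%:M : 'M[R]_1) v))%E.
have mH : measurable_fun [set: measurableTypeR R] H.
  have mhc : measurable_fun [set: measurableTypeR R * borel 'rV[R]_k]
      (fun p => h (row_mx ((p.1 : R)%:M : 'M[R]_1) p.2)).
    exact: (measurableT_comp mh (@measurable_row_cons R k)).
  exact: (@measurable_fun_fubini_tonelli_F _ _ _ _ _ (lebrow k) _ mhc).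
rewrite /= dE normrM EFinM -muleA.
have IHt (t : R) : (`|\det A'|%:E * iterated_integral (fun v : 'rV[R]_k =>
    h (row_mx (t%:M : 'M[R]_1) v *m A + a)%R) = H (c * t + a0)%R)%E.
  have [_ _ IH'] := IH A' (t *: r + a') up' dA'.
  have mA't : measurable_fun setT (fun v : borel 'rV[R]_k =>
      h (row_mx (c * t + a0)%:M (v *m A' + (t *: r + a')))) :=
    measurableT_comp (mht _) (mAa _ A' (t *: r + a')).
  under [X in iterated_integral X]eq_fun do rewrite E.
  rewrite iterated_integralE//.
  exact: (IH' (fun u => h (row_mx (c * t + a0)%:M u)) (mht _)).
have d0 : `|\det A'| != 0 by rewrite normr_eq0.
have IHt' (t : R) : iterated_integral (fun v : 'rV[R]_k =>
    h (row_mx (t%:M : 'M[R]_1) v *m A + a)%R) =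
    (`|\det A'|^-1%:E * H (c * t + a0)%R)%E.
  by rewrite -IHt muleA -EFinM mulVf// mul1e.
under eq_integral do rewrite IHt'.
have mHc : measurable_fun [set: measurableTypeR R] (fun t : R => H (c * t + a0)) :=
  measurableT_comp mH (measurable_affine c a0).
have H0 t : (0 <= H t)%E by exact: integral_ge0.
rewrite ge0_integralZl_EFin ?invr_ge0//.
rewrite (muleA `|\det A'|%:E) -EFinM divff// mul1e.
rewrite ge0_integral_affine//.
apply: eq_integral => t _; rewrite iterated_integralE//; exact: mht.
Qed.

Lemma ge0_integral_image d d' (S : measurableType d) (T : measurableType d')
    (m1 : {measure set S -> \bar R}) (m2 : {measure set T -> \bar R}) (f : S -> T)
    (mf : measurable_fun setT f) (h : T -> \bar R) :
  (forall A, measurable A -> m2 A = m1 (f @^-1` A)) ->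
  measurable_fun setT h -> (forall y, 0 <= h y)%E ->
  (\int[m1]_x h (f x) = \int[m2]_y h y)%E.
Proof.
move=> m12 mh h0.
pose nu0 : {measure set T -> \bar R} := pushforward m1 f.
have E := @ge0_integral_pushforward _ _ _ _ R f mf m1 setT h measurableT mh
  (fun y _ => h0 y).
rewrite preimage_setT in E; rewrite -[LHS]E.
by rewrite [RHS](@eq_measure_integral _ _ _ _ (nu0 mf) m2)// => A mA _; exact: m12.
Qed.

Lemma mul_perm_mxE (k : nat) (v : 'rV[R]_k) (s : 'S_k) j :
  (v *m perm_mx s) ord0 (s j) = v ord0 j.
Proof.
by rewrite -[s in perm_mx s]invgK -col_permE mxE permK.
Qed.

Lemma scales_perm (k : nat) (s : 'S_k) :
  scales (fun v => v *m perm_mx s) 1.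
Proof.
have mT : measurable_fun [set: borel 'rV[R]_k]
    (fun v => v *m perm_mx s : borel 'rV[R]_k).
  exact: (measurable_fun_borel (@continuous_mulmxr R k k (perm_mx s))).
split=> // h mh h0; rewrite mul1e.
apply: (ge0_integral_image mT) => // A mA.
pose nu0 : {measure set (borel 'rV[R]_k) -> \bar R} :=
  pushforward (lebrow k) (fun v : borel 'rV[R]_k => v *m perm_mx s : borel 'rV[R]_k).
apply: (@borel_row_unique k (lebrow k) (nu0 mT)) => //; last first.
  move=> n; rewrite -[ltLHS]/(lebrow k (obox (fun=> - n%:R)%R (fun=> n%:R)%R)).
  by rewrite lebrow_obox ?ltry// => i; rewrite ge0_cp.
move=> a b; rewrite -[LHS]/(lebrow k (obox a b)) lebrow_box; last by move=> i; exact: measurable_itv.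
rewrite -[RHS]/(lebrow k ((fun v => v *m perm_mx s) @^-1` obox a b)).
rewrite (_ : _ @^-1` _ = obox (a \o s) (b \o s)); last first.
  apply/seteqP; split => v /= H i; first by rewrite -(mul_perm_mxE v s); exact: H.
  by rewrite -(permKV s i) (mul_perm_mxE v s); exact: H.
rewrite lebrow_box; last by move=> i; exact: measurable_itv.
by rewrite (reindex_inj (@perm_inj _ s)).
Qed.

(** Conjugation by the permutation that reverses the coordinates turns a lower triangular matrix
    into an upper triangular one with the same determinant. *)
Lemma scales_lower (k : nat) (A : 'M[R]_k) :
  (forall i j : 'I_k, (i < j)%N -> A i j = 0) -> \det A != 0 ->
  scales (fun v => v *m A) `|\det A|.
Proof.
move=> low dA.
pose s : 'S_k := perm (@rev_ord_inj k); pose J := perm_mx s : 'M[R]_k.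
have ss : (s * s = 1)%g by apply/permP => i; rewrite permM !permE rev_ordK.
have JJ : J *m J = 1%:M by rewrite -perm_mxM ss perm_mx1.
have dJ : \det J * \det J = 1 by rewrite -det_mulmx JJ det1.
pose B := J *m A *m J.
have dB : \det B = \det A by rewrite !det_mulmx mulrAC dJ mul1r.
have sV : (s^-1 = s)%g by apply/eqP; rewrite eq_invg_mul ss.
have BE i j : B i j = A (rev_ord i) (rev_ord j).
  by rewrite /B /J -row_permE -[X in _ *m perm_mx X]sV -col_permE !mxE !permE.
have AE : (fun v : borel 'rV[R]_k => v *m A : borel 'rV[R]_k) =
   (fun v => v *m J) \o (fun v => v *m B + 0) \o (fun v => v *m J).
  apply/funext => v /=; rewrite addr0 /B -!mulmxA JJ mulmx1 !mulmxA.
  by rewrite -(mulmxA v) JJ mulmx1.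
rewrite AE -[X in scales _ X]mulr1 -[X in scales _ (X * _)]mul1r -dB.
apply: scales_comp; last exact: scales_perm.
apply: scales_comp; first exact: scales_perm.
apply: scales_upper; last by rewrite dB.
by move=> i j ji; rewrite BE low//= ltn_sub2l// (leq_trans _ (ltn_ord i)).
Qed.

(** An LUP decomposition writes the map as a permutation, then a unit lower triangular map, then an
    upper triangular affine one; only the last changes volume. *)
Lemma scales_affine (k : nat) (A : 'M[R]_k) (a : 'rV[R]_k) :
  \det A != 0 -> scales (fun v => v *m A + a) `|\det A|.
Proof.
case: k A a => [|k] A a dA; first by apply: scales_upper => // -[].
have [] := (cormen_lup_perm A, cormen_lup_correct A, @cormen_lup_lower _ _ A,
  @cormen_lup_upper _ _ A, cormen_lup_detL A).
case: (cormen_lup A) => [[P L] U] /= [[[Pp PA] Ll] Uu] dL.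
have /is_perm_mxP [s Ps] := Pp; have := PA; rewrite {}Ps => /(congr1 (mulmx (perm_mx s^-1%g))).
rewrite -!mulmxE mulmxA -perm_mxM mulVg perm_mx1 mul1mx => AE.
have dP : `|\det (perm_mx s^-1%g : 'M[R]_k.+1)| = 1 by rewrite det_perm normr_sign.
have dA' : `|\det A| = `|\det U|.
  by rewrite AE !det_mulmx dL mul1r normrM dP mul1r.
have -> : (fun v : borel 'rV[R]_k.+1 => v *m A + a : borel 'rV[R]_k.+1) =
   (fun v => v *m U + a) \o (fun v => v *m L) \o (fun v => v *m perm_mx s^-1%g).
  by apply/funext => v /=; rewrite AE !mulmxA.
rewrite dA' -[X in scales _ X]mulr1 -[X in scales _ (X * _)]mulr1.
apply: scales_comp; last exact: scales_perm.
apply: scales_comp.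
  by apply: scales_upper => //; rewrite -normr_eq0 -dA' normr_eq0.
rewrite -[X in scales _ X](@normr1 R) -dL; apply: scales_lower.
  by move=> i j ij; rewrite Ll ?(ltnW ij)// (_ : i == j = false)//; apply/eqP => e; rewrite e ltnn in ij.
by rewrite dL oner_neq0.
Qed.

(** The set is the image of [B] under [v |-> v *m A + a], written as a preimage under the inverse
    map so that it is visibly Borel. *)
Lemma lebrow_affine (k : nat) (A : 'M[R]_k) (a : 'rV[R]_k) (B : set 'rV[R]_k) :
  \det A != 0 -> measurable (B : set (borel _)) ->
  measurable ([set v | B ((v - a) *m invmx A)] : set (borel 'rV[R]_k)) /\
  lebrow k [set v | B ((v - a) *m invmx A)] = (`|\det A|%:E * lebrow k B)%E.
Proof.
move=> dA mB.
have Au : A \in unitmx by rewrite unitmxE unitfE.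
have mS : measurable ([set v | B ((v - a) *m invmx A)] : set (borel 'rV[R]_k)).
  have ci : continuous (fun v : 'rV[R]_k => (v - a) *m invmx A).
    rewrite (_ : (fun v => _) = fun v => v *m invmx A + (- a) *m invmx A).
      move=> v; apply: (@continuousD R 'rV[R]_k 'rV[R]_k (fun u => u *m invmx A) (fun=> (- a) *m invmx A) v).
        exact: (@continuous_mulmxr R k k (invmx A) v).
      exact: cst_continuous.
    by apply/funext => v; rewrite mulmxDl.
  rewrite -[X in measurable X]setTI; exact: (measurable_fun_borel ci).
split => //; have [_ _ H] := scales_affine a dA.
pose S := [set v | B ((v - a) *m invmx A)] : set (borel 'rV[R]_k).
have mS1 : measurable_fun [set: borel 'rV[R]_k] (EFin \o (\1_S : borel 'rV[R]_k -> R)).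
  by apply/measurable_EFinP; exact: measurable_indic.
have E := H (EFin \o \1_S) mS1 (fun v => ltac:(by rewrite lee_fin)).
have L : (\int[lebrow k]_v (\1_S v)%:E = lebrow k S)%E.
  by rewrite integral_indic//= setIT.
rewrite L in E; rewrite -[LHS]E; congr (_ * _)%E.
rewrite -[X in _ = lebrow k X]setIT -integral_indic//; apply: eq_integral => v _ /=.
rewrite !indicE; congr (_%:R%:E); congr (nat_of_bool _).
by apply/idP/idP; rewrite !inE /S /= addrK mulmxK.
Qed.

End LebRow.

(** * Regularity of Borel measures *)

Section Regularity.
Context {R : realType} {k : nat}.
Local Notation V := 'rV[R]_k.
Variable mu : {finite_measure set (borel V) -> \bar R}.

Let meas (A : set V) := @measurable _ (borel V) A.

(** Closed approximation from inside and open approximation from outside are required together: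
    complementation exchanges them, so the sandwiched sets form a sigma-algebra. *)
Definition sandwiched (B : set V) : Prop := forall e : R, 0 < e ->
  exists F O : set V, [/\ closed F, open O, F `<=` B, B `<=` O & (mu (O `\` F) < e%:E)%E].

Let mOF (O F : set V) : open O -> closed F -> meas (O `\` F).
Proof.
move=> oO cF; apply: measurableD; first exact: measurable_borel_open.
exact: measurable_borel_closed.
Qed.

(** The open neighbourhoods of radius [1/(n+1)] decrease to [F], and finiteness of [mu] makes the
    excess measure tend to 0. *)
Lemma sandwiched_closed (F : set V) : closed F -> sandwiched F.
Proof.
move=> cF e e0.
pose O n : set V := \bigcup_(x in F) ball x n.+1%:R^-1.
have oO n : open (O n) by apply: bigcup_open => x _; exact: ball_open.
have FO n : F `<=` O n by move=> x Fx; exists x => //; apply: ballxx.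
have : mu (O n `\` F) @[n --> \oo] --> mu (\bigcap_n (O n `\` F)).
  apply: nonincreasing_cvg_mu => //.
  - by rewrite ltey_eq fin_num_measure//; exact: mOF.
  - by move=> n; exact: mOF.
  - by apply: bigcapT_measurable => n; exact: mOF.
  - move=> m n mn; apply/subsetPset => x [[y Fy yx] nFx]; split => //.
    exists y => //; apply: le_ball yx.
    by rewrite lef_pV2 ?posrE// ler_nat.
rewrite (_ : \bigcap_n _ = set0); last first.
  apply/seteqP; split => // x H; have [_ nFx] := H 0%N I.
  have /nbhs_ballP [d d0 dF] : nbhs x (~` F).
    by apply: open_nbhs_nbhs; split => //; exact: closed_openC.
  have [n _ /(_ n (leqnn n)) nd] := near_infty_natSinv_lt (PosNum d0).
  have [[y Fy yx] _] := H n I.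
  apply: (dF y) => //; apply: ball_sym; apply: le_ball yx; exact: ltW.
rewrite measure0 => /fine_cvgP [_ /cvgrPdist_lt /(_ e e0)].
case=> n _ /(_ n (leqnn n)); rewrite sub0r normrN /= => ne.
exists F, (O n); split => //.
rewrite -[X in (X < _)%E]fineK ?lte_fin; first exact: (le_lt_trans (ler_norm _)).
exact: fin_num_measure (mOF _ _).
Qed.

Lemma sandwichedC (B : set V) : sandwiched B -> sandwiched (~` B).
Proof.
move=> sB e e0; have [F [ O [cF oO FB BO OF]]] := sB e e0.
exists (~` O), (~` F); split.
- exact: open_closedC.
- exact: closed_openC.
- exact: subsetC.
- exact: subsetC.
- by rewrite setDE setCK setIC -setDE.
Qed.

Lemma sandwiched_bigcup (B : nat -> set V) :
  (forall n, sandwiched (B n)) -> sandwiched (\bigcup_n B n).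
Proof.
move=> sB e e0.
have : forall n, exists F O : set V,
  [/\ closed F, open O, F `<=` B n, B n `<=` O &
   (mu (O `\` F) < ((e / 2) / (2 ^ n.+1)%:R)%:E)%E].
  by move=> n; apply: sB; rewrite !divr_gt0// ltr0n expn_gt0.
move=> /choice [F] /choice [ O FO].
have cF n : closed (F n) by have [] := FO n.
have oO n : open (O n) by have [] := FO n.
have FB n : F n `<=` B n by have [] := FO n.
have BO n : B n `<=` O n by have [] := FO n.
have OF n : (mu (O n `\` F n) < ((e / 2) / (2 ^ n.+1)%:R)%:E)%E by have [] := FO n.
pose U := \bigcup_n O n; pose FN n := \big[setU/set0]_(i < n) F i.
have oU : open U by apply: bigcup_open.
have cFN n : closed (FN n) by rewrite /FN -bigcup_mkord; apply: closed_bigcup.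
have le2 : (mu (U `\` \bigcup_n F n) <= (e / 2)%:E)%E.
  apply: (@le_trans _ _ (\sum_(n <oo) mu (O n `\` F n))%E).
    apply: measure_sigma_subadditive.
    - by move=> n; exact: mOF.
    - apply: measurableD; first exact: measurable_borel_open.
      by apply: bigcupT_measurable => n; exact: measurable_borel_closed.
    - move=> x [[n _ Onx] nF]; exists n => //; split => // Fnx; apply: nF.
      by exists n.
  apply: le_trans (@epsilon_trick0 R (e / 2) xpredT _); last by rewrite divr_ge0// ltW.
  by apply: lee_nneseries => // n _; exact/ltW/OF.
have : mu (U `\` FN n) @[n --> \oo] --> mu (\bigcap_n (U `\` FN n)).
  apply: nonincreasing_cvg_mu => //.
  - by rewrite ltey_eq fin_num_measure//; exact: mOF.
  - by move=> n; exact: mOF.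
  - by apply: bigcapT_measurable => n; exact: mOF.
  - move=> m n mn; apply/subsetPset; apply: setDS.
    by rewrite /FN; apply: subset_bigsetU.
have -> : \bigcap_n (U `\` FN n) = U `\` \bigcup_n F n.
  apply/seteqP; split => x.
    move=> H; split; first by have [] := H 0%N I.
    by move=> [n _ Fnx]; have [_] := H n.+1 I; apply; rewrite /FN -bigcup_mkord; exists n => /=.
  move=> [Ux nF] n _; split => // ; rewrite /FN -bigcup_mkord => -[i _ Fix].
  by apply: nF; exists i.
set L := mu (U `\` \bigcup_n F n) => cv.
have e2 : (L < e%:E)%E by apply: le_lt_trans le2 _; rewrite lte_fin ltr_pdivrMr// ltr_pMr// ltr1n.
have [n _ /(_ n (leqnn n)) /= Hn] : \forall n \near \oo, (mu (U `\` FN n) < e%:E)%E.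
  by apply: (cv [set x | (x < e%:E)%E]); apply: open_ereal_lt'.
exists (FN n), U; split => //.
- rewrite /FN -bigcup_mkord => x [i _ Fix]; exists i => //; exact: FB.
- by move=> x [i _ Bix]; exists i => //; exact: BO.
Qed.

Lemma borel_sandwiched (B : set V) : meas B -> sandwiched B.
Proof.
have : sigma_algebra setT sandwiched.
  split.
  - by apply: sandwiched_closed; exact: closed0.
  - by move=> A sA; rewrite setTD; exact: sandwichedC.
  - by move=> A sA; exact: sandwiched_bigcup.
move=> sg; apply: smallest_sub => // O oO.
by rewrite -(setCK O); apply: sandwichedC; apply: sandwiched_closed; exact: open_closedC.
Qed.

End Regularity.

(** * A change of variables inequality *)

Section ImageMeasure.
Context {R : realType} {k : nat}.
Local Notation V := 'rV[R]_k.
Local Notation leb := (lebrow k).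

Let meas (A : set V) := @measurable _ (borel V) A.

(** A grid of mesh [1/n] on [[-1, 1]^k]. Cells are half-open to be disjoint, so the index runs up to
    [2 * n] to catch coordinates equal to 1. *)
Definition cell (n : nat) (z : {ffun 'I_k -> 'I_(2 * n).+1}) : set V :=
  box (fun i => `[(z i)%:R / n%:R - 1, (z i).+1%:R / n%:R - 1[%classic).

Lemma measurable_cell n z : meas (@cell n z).
Proof. by apply: measurable_box => i; exact: measurable_itv. Qed.

Lemma lebrow_cell n z : (0 < n)%N -> leb (@cell n z) = ((n%:R^-1) ^+ k)%:E.
Proof.
move=> n0; rewrite lebrow_box; last by move=> i; exact: measurable_itv.
rewrite (eq_bigr (fun=> (n%:R^-1)%:E)); last first.
  move=> i _; rewrite lebesgue_measure_itv /= lte_fin.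
  have n0' : 0 < n%:R :> R by rewrite ltr0n.
  rewrite ltrD2r ltr_pM2r ?invr_gt0// ltr_nat leqnn -EFinB; congr (_%:E).
  by rewrite -addn1 natrD; field; rewrite gt_eqF.
by rewrite prodEFin prodr_const card_ord.
Qed.

Lemma cell_dist n z (x y : V) : (0 < n)%N -> @cell n z x -> cell z y ->
  `|y - x| < n%:R^-1.
Proof.
move=> n0 zx zy; apply: row_mx_norm_lt; first by rewrite invr_gt0 ltr0n.
move=> i; rewrite !mxE; have := zx i; have := zy i; rewrite /= !in_itv /=.
rewrite -(addn1 (z i)) natrD mulrDl mul1r ltr_norml.
by move: ((z i)%:R / n%:R : R) => a; move: (n%:R^-1) => b; lra.
Qed.

Lemma cell_exists n (x : V) : (0 < n)%N -> `|x| <= 1 -> exists z, @cell n z x.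
Proof.
move=> n0 x1; have n0' : 0 < n%:R :> R by rewrite ltr0n.
exists [ffun i => inord (Num.trunc (n%:R * (x ord0 i + 1)))] => i /=.
have := le_trans (row_coord_norm x i) x1; rewrite ler_norml => /andP[xl xu].
have x0 : 0 <= n%:R * (x ord0 i + 1) by rewrite mulr_ge0// -lerBlDr sub0r.
rewrite ffunE inordK; last first.
  rewrite ltnS truncn_le_nat; apply: (@le_lt_trans _ _ (n%:R * 2)).
    by rewrite ler_wpM2l//; lra.
  by rewrite mulrC -natrM ltr_nat.
have /andP[h1 h2] := truncn_itv x0.
rewrite in_itv /= lerBlDr ltrBrDr ler_pdivrMr// ltr_pdivlMr//.
by rewrite (mulrC (_ + _)) h1.
Qed.

Lemma cell_disj n z z' (x : V) : (0 < n)%N -> @cell n z x -> cell z' x -> z = z'.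
Proof.
move=> n0 zx zx'; have n0' : 0 < n%:R :> R by rewrite ltr0n.
apply/ffunP => i; apply: val_inj => /=.
have := zx i; have := zx' i; rewrite /= !in_itv /= !lerBlDr !ltrBrDr.
rewrite !ler_pdivrMr// !ltr_pdivlMr// => /andP[a b] /andP[c d].
apply/eqP; rewrite eqn_leq; apply/andP; split; rewrite -ltnS -(ltr_nat R).
  exact: le_lt_trans c b.
exact: le_lt_trans a d.
Qed.

(** On the points where the local bound already holds at scale [1/n], [G] sends a cell of that mesh
    into a translate of the image under [P x] of a cube of side [4/n]; hence the factor
    [4 ^+ k * J]. Apart from [E] and [B], only cells, parallelepipeds and open sets are measured,
    never images under [G]. *)
Lemma image_measure_le (E B : set V) (G : V -> V) (P : V -> 'M[R]_k) (J : R) :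
  meas E -> (forall x, E x -> `|x| <= 1) -> meas B -> B `<=` G @` E -> 0 <= J ->
  (forall x, E x -> \det (P x) != 0 /\ `|\det (P x)| <= J) ->
  (forall x, E x -> exists2 d, 0 < d & forall y, E y -> `|y - x| < d ->
     `|(G y - G x) *m invmx (P x)| <= 2 * `|y - x|) ->
  (leb B <= (4 ^+ k * J)%:E * leb E)%E.
Proof.
move=> mE E1 mB BG J0 PJ PG.
(* Restriction to a bounded open set around [E] makes the measure finite, as regularity requires. *)
pose W : set V := ball (0 : V) 2.
have WE (v : V) : W v <-> `|v| < 2 by rewrite /W -ball_normE /= sub0r normrN.
have oW : open W by exact: ball_open.
have mW : meas W by exact: measurable_borel_open.
have Woo : (leb W < +oo)%E by apply: (row_measure_fin mW) => v /WE; exact.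
apply/lee_addgt0Pr => e e0.
pose K := 4 ^+ k * J; have K0 : 0 <= K by rewrite mulr_ge0// exprn_ge0.
(* The divisor is [K + 1] because [K] may vanish. *)
have e'0 : 0 < e / (K + 1) by rewrite divr_gt0// ltr_wpDl.
have [F [ O [cF oO FE EO OF]]] := @borel_sandwiched R k (mfrestr mW Woo) E mE _ e'0.
pose U := O `&` W; have oU : open U by exact: openI.
have mU : meas U by exact: measurable_borel_open.
have EU : E `<=` U.
  by move=> x Ex; split; [exact: EO|apply/WE; rewrite (le_lt_trans (E1 _ Ex))// ltr1n].
have Uoo : (leb U < +oo)%E.
  by apply: (le_lt_trans _ Woo); apply: le_measure; rewrite ?inE// => x [].
have leU : (leb U <= leb E + (e / (K + 1))%:E)%E.
  have -> : U = E `|` (U `\` E) by rewrite setDUK.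
  apply: (le_trans (measureU2 _ mE (measurableD mU mE))).
  apply: leeD => //; apply: (le_trans _ (ltW OF)).
  apply: le_measure; rewrite ?inE; [exact: measurableD| |].
    apply: measurableI => //; apply: measurableD; first exact: measurable_borel_open.
    exact: measurable_borel_closed.
  by move=> x [[Ox Wx] nE]; split => //; split => // /FE.
(* The radius of validity depends on the point; [EN n] collects the points for which [n.+1%:R^-1] is
   small enough, and these sets exhaust [E]. *)
pose EN n := [set x | [/\ E x, ball x n.+1%:R^-1 `<=` U &
  forall y, E y -> `|y - x| < n.+1%:R^-1 ->
     `|(G y - G x) *m invmx (P x)| <= 2 * `|y - x|]].
pose Z n : set {ffun 'I_k -> 'I_(2 * n.+1).+1} := [set z | cell z `&` EN n !=set0].
pose c n z := xget 0 (@cell n.+1 z `&` EN n).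
have cP n z : Z n z -> (@cell n.+1 z `&` EN n) (c n z).
  by move=> [x zx]; exact: (xgetPex 0 (ex_intro _ x zx)).
pose par n z : set V := [set v | obox (fun=> - (2 / n.+1%:R)) (fun=> 2 / n.+1%:R)
  ((v - G (c n z)) *m invmx (P (c n z)))].
have mpar n z : Z n z -> meas (par n z) /\
   leb (par n z) = (`|\det (P (c n z))| * (4 / n.+1%:R) ^+ k)%:E.
  move=> /cP [_ [Ec _ _]]; have [dP _] := PJ _ Ec.
  have [m1 ->] := lebrow_affine (G (c n z)) dP
    (measurable_obox (fun=> - (2 / n.+1%:R)) (fun=> 2 / n.+1%:R)).
  split=> //; rewrite lebrow_obox; last first.
    by move=> i; rewrite ge0_cp// divr_ge0.
  rewrite -EFinM prodr_const card_ord; congr (_ * _ ^+ _)%:E.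
  by rewrite opprK -mulrDl -natrD.
pose BN n := \bigcup_(z in Z n) par n z.
have finZ n : finite_set (Z n) by exact: finite_finset.
have mBN n : meas (BN n).
  by apply: fin_bigcup_measurable => // z /mpar [].
have GBN n x : EN n x -> BN n (G x).
  move=> ENx; have [Ex _ _] := ENx.
  have [z zx] := @cell_exists n.+1 x isT (E1 _ Ex).
  have Zz : Z n z by exists x.
  exists z => //; have [zc [Ec _ Hc]] := cP _ _ Zz.
  have xc := cell_dist (ltn0Sn n) zc zx.
  move=> i /=; rewrite in_itv /= -ltr_norml.
  apply: le_lt_trans (row_coord_norm _ i) _.
  apply: le_lt_trans (Hc _ Ex xc) _.
  by rewrite ltr_pM2l.
have leBN n : (leb (BN n) <= K%:E * leb U)%E.
  apply: (@le_trans _ _ (\sum_(z \in Z n) leb (par n z))%E).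
    apply: content_sub_fsum; [exact: finZ|by move=> z /mpar []|exact: mBN|by []].
  apply: (@le_trans _ _ (\sum_(z \in Z n) (K%:E * leb (cell z)))%E).
    apply: lee_fsum; first exact: finZ.
    move=> z Zz; have [_ ->] := mpar _ _ Zz.
    have [_ [Ec _ _]] := cP _ _ Zz; have [_ dJ] := PJ _ Ec.
    rewrite lebrow_cell// -EFinM lee_fin exprMn mulrA.
    apply: ler_wpM2r; first by rewrite exprn_ge0// invr_ge0.
    by rewrite mulrC /K ler_wpM2l// exprn_ge0.
  rewrite -ge0_mule_fsumr//; apply: lee_wpmul2l => //.
  have tZ : trivIset (Z n) (@cell n.+1).
    by move=> z z' _ _ [x [zx zx']]; exact: (cell_disj (ltn0Sn n) zx zx').
  rewrite -(measure_fin_bigcup leb (finZ n) tZ); last first.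
    by move=> z _; exact: measurable_cell.
  apply: le_measure; rewrite ?inE//.
    apply: fin_bigcup_measurable; first exact: finZ.
    by move=> z _; exact: measurable_cell.
  move=> x [z Zz zx]; have [zc [_ cU _]] := cP _ _ Zz.
  by apply: cU; rewrite -ball_normE /= distrC; exact: (cell_dist (ltn0Sn n) zc zx).
have Einf x : E x -> exists N, forall n, (N <= n)%N -> EN n x.
  move=> Ex; have [d d0 Hd] := PG _ Ex.
  have /nbhs_ballP [d' d'0 Hd'] : nbhs x U by apply: open_nbhs_nbhs; split => //; exact: EU.
  have dd0 : 0 < Num.min d d' by rewrite lt_min d0.
  have [N _ HN] := near_infty_natSinv_lt (PosNum dd0).
  exists N => n /HN /=; rewrite lt_min => /andP[nd nd']; split => //.
    by apply: subset_trans Hd'; apply: le_ball; exact: ltW.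
  by move=> y Ey yx; apply: Hd => //; exact: lt_trans nd.
(* [BN n] need not be monotone in [n], but every point of [B] lies in all [BN m] with [m] large:
   these tail intersections increase to [B]. *)
pose D n := B `&` \bigcap_(m in [set m | (n <= m)%N]) BN m.
have mD n : meas (D n) 
  by apply: measurableI => //; apply: bigcap_measurable; [exists n => /=|move=> m _; exact: mBN].
have BD : B = \bigcup_n D n.
  apply/seteqP; split => v; last by case=> n _ [].
  move=> Bv; have [x Ex xv] := BG _ Bv; have [N HN] := Einf _ Ex.
  by exists N => //; split => // n /= Nn; rewrite -xv; apply/GBN/HN.
have cvD : leb (D n) @[n --> \oo] --> leb B.
  rewrite BD; apply: nondecreasing_cvg_mu => //; first by rewrite -BD.
  move=> m n mn; apply/subsetPset => v [Bv H]; split => // l /= nl; apply: H => /=.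
  exact: leq_trans nl.
have leB : (leb B <= K%:E * leb U)%E.
  rewrite -(cvg_lim _ cvD)//; apply: lime_le; first by apply/cvg_ex; eexists; exact: cvD.
  apply: nearW => n; apply: (le_trans _ (leBN n)); apply: le_measure; rewrite ?inE//.
  - exact: mD.
  - exact: mBN.
  - by move=> v [_ H]; exact: (H n (leqnn n)).
apply: (le_trans leB); apply: (@le_trans _ _ (K%:E * (leb E + (e / (K + 1))%:E))%E).
  exact: lee_wpmul2l.
rewrite muleDr//; last by rewrite ge0_adde_def ?inE// lee_fin ltW.
rewrite leeD2l// -EFinM lee_fin mulrCA ger_pMr//.
by rewrite ler_pdivrMr ?mul1r ?lerDl// ltr_wpDl.
Qed.

End ImageMeasure.

(** * Change of variables for densities *)

Section WeightedImage.
Context {R : realType} {k : nat}.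
Local Notation V := 'rV[R]_k.
Local Notation leb := (lebrow k).

Let meas (A : set V) := @measurable _ (borel V) A.

Lemma expR_floor_itv (r : R) : 0 < r ->
  r \in `[expR (Num.floor (ln r))%:~R, expR ((Num.floor (ln r))%:~R + 1)[.
Proof.
move=> r0; rewrite in_itv /= -{2 3}(lnK (x := r)) ?posrE// ler_expR ltr_expR.
by rewrite ge_floor /= -[1]/(1%:~R) -intrD floorD1_gt.
Qed.

Lemma expR_itv_inj (r : R) (i j : int) :
  r \in `[expR i%:~R, expR (i%:~R + 1)[ -> r \in `[expR j%:~R, expR (j%:~R + 1)[ ->
  i = j.
Proof.
rewrite !in_itv /= => /andP[a b] /andP[c d].
have := le_lt_trans a d; have := le_lt_trans c b; rewrite !ltr_expR.
by rewrite -[1]/(1%:~R) -!intrD !ltr_int; lia.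
Qed.

(** [E] is split by the integer parts i and j of [ln (r1 (G x))] and [ln (r2 x)]. On such a piece
    the determinant is at most [e^(j + 1 - i)]; replacing [r1] by [e^(i + 1)] and [r2] by [e^j] then
    loses [e^2] altogether. *)
Lemma weighted_image_le (E B : set V) (G H : V -> V) (P : V -> 'M[R]_k)
    (r1 r2 : V -> R) :
  meas E -> (forall x, E x -> `|x| <= 1) -> meas B ->
  (forall y, B y -> E (H y) /\ G (H y) = y) ->
  measurable_fun (E : set (borel V)) (G : borel V -> borel V) ->
  measurable_fun (B : set (borel V)) (H : borel V -> borel V) ->
  measurable_fun (B : set (borel V)) (r1 : borel V -> R) ->
  measurable_fun (E : set (borel V)) (r2 : borel V -> R) ->
  (forall y, B y -> 0 < r1 y) -> (forall x, E x -> 0 < r2 x) ->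
  (forall x, E x -> B (G x) -> \det (P x) != 0 /\ `|\det (P x)| * r1 (G x) <= r2 x) ->
  (forall x, E x -> exists2 d, 0 < d & forall y, E y -> `|y - x| < d ->
     `|(G y - G x) *m invmx (P x)| <= 2 * `|y - x|) ->
  (\int[leb]_(y in B) (r1 y)%:E <=
   (expR 2 * 4 ^+ k)%:E * \int[leb]_(x in E) (r2 x)%:E)%E.
Proof.
move=> mE E1 mB HB mG mH mr1 mr2 r10 r20 dP PG.
pose I (i : int) : set R := `[expR i%:~R, expR (i%:~R + 1)[%classic.
have mI i : measurable (I i) by exact: measurable_itv.
pose E' := E `&` G @^-1` B.
have mE' : meas E' by exact: mG.
have mr1G : measurable_fun (E' : set (borel V)) (r1 \o G : borel V -> R).
  apply: (@measurable_comp _ _ _ _ _ _ (B : set (borel V))) => //.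
    by move=> _ [x [_ Bx] <-].
  by apply: measurable_funS mG => // x [].
pose X (q : int * int) := E' `&` (r1 \o G) @^-1` (I q.1) `&` (r2 @^-1` (I q.2)).
pose Y (q : int * int) := B `&` H @^-1` (X q).
have mX q : meas (X q).
  rewrite /X -setIA; have -> : E' `&` ((r1 \o G) @^-1` I q.1 `&` r2 @^-1` I q.2) =
    (E' `&` (r1 \o G) @^-1` I q.1) `&` (E' `&` r2 @^-1` I q.2).
    by rewrite setIACA setIid.
  apply: measurableI; first exact: mr1G.
  have mr2' : measurable_fun (E' : set (borel V)) (r2 : borel V -> R).
    by apply: measurable_funS mr2 => // x [].
  exact: mr2'.
have mY q : meas (Y q) := mH mB _ (mX q).
have XE q : X q `<=` E by move=> x [[[Ex _] _] _].
have YB q : Y q `<=` B by move=> x [].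
have Xr1 q x : X q x -> r1 (G x) \in `[expR q.1%:~R, expR (q.1%:~R + 1)[.
  by move=> [[_ h] _].
have Xr2 q x : X q x -> r2 x \in `[expR q.2%:~R, expR (q.2%:~R + 1)[.
  by move=> [_ h].
have Xinj q q' x : X q x -> X q' x -> q = q'.
  move=> Xq Xq'; rewrite (surjective_pairing q) (surjective_pairing q').
  by rewrite (expR_itv_inj (Xr1 _ _ Xq) (Xr1 _ _ Xq'))
    (expR_itv_inj (Xr2 _ _ Xq) (Xr2 _ _ Xq')).
have measYX q : (leb (Y q) <= (4 ^+ k * expR (q.2%:~R + 1 - q.1%:~R))%:E * leb (X q))%E.
  apply: (@image_measure_le R k _ _ G P).
  - exact: mX.
  - by move=> x Xx; exact: E1 (XE _ _ Xx).
  - exact: mY.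
  - by move=> y [By Xy]; exists (H y) => //; have [] := HB _ By.
  - by rewrite expR_ge0.
  - move=> x Xx; have [[[Ex Bx] _] _] := Xx; have [dP0 dPr] := dP _ Ex Bx.
    split => //; have := Xr1 _ _ Xx; have := Xr2 _ _ Xx; rewrite !in_itv /=.
    move=> /andP[_ h2] /andP[h1 _].
    rewrite expRB -(ler_pM2r (expR_gt0 q.1%:~R)) divfK ?gt_eqF ?expR_gt0//.
    by apply: le_trans (ltW h2); apply: le_trans dPr; exact: ler_wpM2l.
  - move=> x Xx; have [d d0 Hd] := PG _ (XE _ _ Xx).
    by exists d => // y Xy; exact: Hd (XE _ _ Xy).
(* Reindexes families over pairs of integers by naturals, with the empty set at codes of no pair. *)
pose dec (F : int * int -> set V) n := if pickle_inv n is Some q then F q else set0.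
have decE (F : int * int -> set V) : \bigcup_n dec F n = \bigcup_q F q.
  apply/seteqP; split => x.
    by move=> [n _]; rewrite /dec; case: pickle_inv => // q Fq; exists q.
  move=> [q _ Fq]; have h : dec F (pickle q) x by rewrite /dec pickleK_inv.
  by move: (pickle q) h => n h; exists n.
have decm (F : int * int -> set V) : (forall q, meas (F q)) -> forall n, meas (dec F n).
  by move=> mF n; rewrite /dec; case: pickle_inv => [q|] //; exact: measurable0.
have dectr (F : int * int -> set V) : (forall q q' x, F q x -> F q' x -> q = q') ->
    trivIset setT (dec F).
  move=> Finj n m _ _ [x []]; rewrite /dec.
  move: (pickle_invK (T := (int * int)%type) n) (pickle_invK (T := (int * int)%type) m).
  case: (pickle_inv n) => [q|//]; case: (pickle_inv m) => [q'|//] /= <- <- Fq Fq'.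
  by rewrite (Finj _ _ _ Fq Fq').
have BE : B = \bigcup_n dec Y n.
  rewrite decE; apply/seteqP; split => y; last by case=> q _ [].
  move=> By; have [EHy GHy] := HB _ By.
  exists (Num.floor (ln (r1 y)), Num.floor (ln (r2 (H y)))) => //; split => //.
  split; last by apply: expR_floor_itv; exact: r20.
  split; first by split => //=; rewrite /preimage /= GHy.
  by rewrite /preimage /= GHy; apply: expR_floor_itv; exact: r10.
have r1_0 y : B y -> (0 <= (r1 y)%:E)%E by move=> By; rewrite lee_fin ltW// r10.
have r2_0 y : E y -> (0 <= (r2 y)%:E)%E by move=> By; rewrite lee_fin ltW// r20.
rewrite {1}BE ge0_integral_bigcup//; last 4 first.
- exact: decm.
- by rewrite -BE; apply/measurable_EFinP.
- by move=> x; rewrite -BE; exact: r1_0.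
- apply: dectr => q q' y [_ h] [_ h']; exact: Xinj h h'.
apply: (@le_trans _ _ (\sum_(n <oo) (expR 2 * 4 ^+ k)%:E *
   \int[leb]_(x in dec X n) (r2 x)%:E)%E).
  apply: lee_nneseries => [n _ _|n _].
    apply: integral_ge0 => x; rewrite /dec; case: pickle_inv => // q Yx; exact: r1_0 (YB _ _ Yx).
  rewrite /dec; case: pickle_inv => [q|]; last by rewrite !integral_set0 mule0.
  apply: (@le_trans _ _ (\int[leb]_(y in Y q) (expR (q.1%:~R + 1))%:E)%E).
    apply: ge0_le_integral.
    - exact: mY.
    - by move=> y Yy; exact: r1_0 (YB _ _ Yy).
    - by apply/measurable_EFinP; apply: measurable_funS mr1.
    - exact: measurable_cst.
    - move=> y [By /Xr1]; have [_ ->] := HB _ By.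
      by rewrite in_itv /= => /andP[_ h]; rewrite lee_fin ltW.
  rewrite integral_cst; last exact: mY.
  apply: (@le_trans _ _ ((expR (q.1%:~R + 1))%:E * ((4 ^+ k * expR (q.2%:~R + 1 - q.1%:~R))%:E * leb (X q)))%E).
    by apply: lee_wpmul2l (measYX q); rewrite lee_fin expR_ge0.
  rewrite muleA -EFinM.
  have -> : expR (q.1%:~R + 1) * (4 ^+ k * expR (q.2%:~R + 1 - q.1%:~R)) =
    (expR 2 * 4 ^+ k) * expR q.2%:~R :> R.
    rewrite mulrCA -expRD (mulrC (expR 2)) -mulrA -expRD; congr (_ * expR _); ring.
  rewrite EFinM -muleA; apply: lee_wpmul2l; first by rewrite lee_fin mulr_ge0// ?expR_ge0// exprn_ge0.
  rewrite -integral_cst; last exact: mX.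
  apply: ge0_le_integral.
  - exact: mX.
  - by move=> x _; rewrite lee_fin expR_ge0.
  - exact: measurable_cst.
  - by apply/measurable_EFinP; apply: measurable_funS mr2.
  - by move=> x /Xr2; rewrite in_itv /= => /andP[h _]; rewrite lee_fin.
rewrite nneseriesZl//; last by move=> n _; apply: integral_ge0 => x; rewrite /dec; case: pickle_inv => // q Xx; exact: r2_0 (XE _ _ Xx).
rewrite -ge0_integral_bigcup//; last 4 first.
- exact: decm.
- apply/measurable_EFinP; apply: measurable_funS mr2 => //; rewrite decE => x [q _ Xx]; exact: XE Xx.
- by move=> x; rewrite decE => -[q _ Xx]; exact: r2_0 (XE _ _ Xx).
- exact: dectr.
apply: lee_wpmul2l; first by rewrite lee_fin mulr_ge0// ?expR_ge0// exprn_ge0.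
apply: ge0_subset_integral => //; last first.
- by rewrite decE => x [q _ Xx]; exact: XE Xx.
- by apply/measurable_EFinP.
- by apply: bigcupT_measurable; exact: decm.
Qed.

End WeightedImage.

(** * Local comparison of two parametrizations *)

Section PositiveDefinite.
Context {R : realType}.

(* The segment from [S] to the identity consists of positive definite, hence
   invertible, matrices, so the determinant keeps its sign along it. *)
Lemma posdef_det_gt0 (n : nat) (S : 'M[R]_n) :
  (forall v : 'rV[R]_n, v != 0 -> 0 < (v *m S *m v^T) ord0 ord0) -> 0 < \det S.
Proof.
move=> pS; pose f (s : R) := \det (s%:M + (1 - s) *: S).
have fcont : {within `[0, 1], continuous (f : R -> R)}.
  apply: continuous_subspaceT => s; apply: cvg_det; apply: cvgD.
    apply: cvg_mx => i j; rewrite mxE; under eq_cvg do rewrite mxE.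
    case: (i == j); last exact: cvg_cst.
    exact: cvg_id.
  apply: cvgZl; apply: cvgB; [exact: cvg_cst|exact: cvg_id].
have f1 : f 1 = 1 by rewrite /f subrr scale0r addr0 det1.
have f0 : f 0 = \det S by rewrite /f subr0 scale1r raddf0 add0r.
have fn0 s : 0 <= s <= 1 -> f s != 0.
  move=> /andP[s0 s1]; apply/negP => /det0P [v v0 /(congr1 (fun w => (w *m v^T) ord0 ord0))].
  have -> : (v *m (s%:M + (1 - s) *: S) *m v^T) ord0 ord0 =
    s * (v *m v^T) ord0 ord0 + (1 - s) * (v *m S *m v^T) ord0 ord0.
    rewrite mulmxDr mulmxDl mxE; congr (_ + _).
      by rewrite mul_mx_scalar -scalemxAl mxE.
    by rewrite -scalemxAr -scalemxAl mxE.
  rewrite mul0mx [RHS]mxE.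
  have vv : 0 < (v *m v^T) ord0 ord0.
    have vvE : (v *m v^T) ord0 ord0 = \sum_j v ord0 j ^+ 2.
      by rewrite mxE; apply: eq_bigr => j _; rewrite mxE expr2.
    rewrite vvE lt_neqAle sumr_ge0 ?andbT; last by move=> j _; exact: sqr_ge0.
    rewrite eq_sym psumr_neq0; last by move=> j _; exact: sqr_ge0.
    have [j vj] : exists j, v ord0 j != 0 by apply/rV0Pn.
    by apply/hasP; exists j; rewrite ?mem_index_enum//= lt_neqAle eq_sym sqrf_eq0 vj sqr_ge0.
  have vS := pS _ v0.
  have [->|sn0] := eqVneq s 0; first by rewrite mul0r add0r subr0 mul1r => h; rewrite h ltxx in vS.
  have h1 : 0 < s * (v *m v^T) ord0 ord0 by rewrite mulr_gt0// lt_neqAle eq_sym sn0.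
  have h2 : 0 <= (1 - s) * (v *m S *m v^T) ord0 ord0 by rewrite mulr_ge0 ?subr_ge0// ltW.
  by move=> h; have := ltr_wpDr h2 h1; rewrite h ltxx.
rewrite -f0 ltNge; apply/negP => f0le.
have [c c01 /eqP] := @IVT R f 0 1 0 ler01 fcont ltac:(by rewrite f1 ge_min f0le/= le_max ler01 orbT).
by apply/negP; apply: fn0; move: c01; rewrite in_itv.
Qed.

End PositiveDefinite.

Lemma unit_disk0 (R : realType) (k : nat) : unit_disk k (0 : 'rV[R]_k).
Proof. by rewrite /unit_disk /= big1 ?ler01// => i _; rewrite mxE expr0n. Qed.

Lemma unit_disk_delta (R : realType) (k : nat) (i : 'I_k) :
  unit_disk k (delta_mx ord0 i : 'rV[R]_k).
Proof.
have E : \sum_(j < k) (delta_mx ord0 i : 'rV[R]_k) ord0 j ^+ 2 = 1.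
  rewrite (bigD1 i)//= big1 ?mxE ?eqxx/= ?expr1n ?addr0//.
  by move=> j ji; rewrite mxE (negbTE ji) andbF expr0n.
by rewrite /unit_disk /mkset E.
Qed.

Section Relation.
Context {R : realType} {k m : nat}.
Local Notation V := 'rV[R]_k.
Local Notation W := 'rV[R]_m.

Lemma differentiable_eps (a : V -> W) (x : V) (e : R) :
  differentiable a x -> 0 < e -> exists2 d, 0 < d &
    forall y, `|y - x| < d -> `|a y - a x - (y - x) *m 'J a x| <= e * `|y - x|.
Proof.
move=> da e0; have /eqaddoP := diff_locally da.
move=> /(_ e e0) /nbhs_ballP [d d0 H]; exists d => // y yd.
have := H (y - x); rewrite -ball_normE /= sub0r normrN => /(_ yd).
by rewrite /= !fctE /= subrK /jacobian mul_rV_lin1 opprD addrA.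
Qed.

(** Bundles differentiability with the value of the Jacobian, since ['J] is total and meaningful
    only at points of differentiability. *)
Definition has_jac (a : V -> W) (x : V) (A : 'M[R]_(k, m)) : Prop :=
  forall e, 0 < e -> exists2 d, 0 < d &
    forall y, `|y - x| < d -> `|a y - a x - (y - x) *m A| <= e * `|y - x|.

Lemma has_jacP (a : V -> W) (x : V) (A : 'M[R]_(k, m)) :
  has_jac a x A <-> differentiable a x /\ 'J a x = A.
Proof.
split; last by move=> [da <-] e; exact: differentiable_eps.
move=> H.
pose L : {linear V -> W} := mulmxr A.
have cA : continuous L by exact: continuous_mulmxr.
have E : a \o shift x = cst (a x) + L +o_ (0 : V) id.
  apply/eqaddoP => e e0; have [d d0 Hd] := H e e0.
  apply/nbhs_ballP; exists d => // h; rewrite -ball_normE /= sub0r normrN => hd.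
  have := Hd (h + x); rewrite addrK => /(_ hd).
  by rewrite /= !fctE opprD addrA.
have dE := diff_unique cA E.
split; first by apply/diff_locallyP; rewrite dE.
by apply/row_matrixP => i; rewrite !rowE /jacobian mul_rV_lin1 dE.
Qed.

Lemma near_has_jac (a b : V -> W) (x : V) (A : 'M[R]_(k, m)) :
  (\forall y \near x, a y = b y) -> has_jac a x A -> has_jac b x A.
Proof.
move=> /nbhs_ballP [d d0 ab] Ha e e0; have [d' d'0 Hd'] := Ha e e0.
exists (Num.min d d'); first by rewrite lt_min d0.
move=> y; rewrite lt_min => /andP[yd yd'].
have -> : b y = a y by rewrite ab// -ball_normE /= distrC.
have -> : b x = a x by rewrite ab//; exact: ballxx.
exact: Hd'.
Qed.

(** Neither variable is a function of the other here: two first order expansions of the same point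
    are compared, and a right inverse of the Jacobian of [b] isolates [(t - t0) *m invmx P]. *)
Lemma relation_local (a b : V -> W) (t0 u0 : V) (P : 'M[R]_k) :
  differentiable a t0 -> differentiable b u0 -> a t0 = b u0 ->
  row_free ('J b u0) -> P \in unitmx -> P *m 'J a t0 = 'J b u0 ->
  exists2 d, 0 < d & forall t u, `|t - t0| < d -> `|u - u0| < d -> a t = b u ->
    `|(t - t0) *m invmx P| <= 2 * `|u - u0|.
Proof.
move=> da db ab Bf Pu PA.
set A := 'J a t0 in PA; set B := 'J b u0 in Bf PA.
have AJ : 'J a t0 = A := erefl; have BJ : 'J b u0 = B := erefl.
clearbody A B.
have AE : A = invmx P *m B by rewrite -PA mulKmx.
have [c c0 cB] := mulmx_norm_le (pinvmx B).
have [p p0 pP] := mulmx_norm_le P.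
(* Makes both error coefficients at most 1/4, so that [3/4 |X| <= 5/4 |u - u0|], within the
   announced factor 2. *)
pose e := (4 * (c + 1) * (p + 1))^-1.
have cp0 : 0 < 4 * (c + 1) * (p + 1) by rewrite !mulr_gt0// ltr_wpDl.
have e0 : 0 < e by rewrite invr_gt0.
have [d1 d10 H1] := differentiable_eps da e0.
have [d2 d20 H2] := differentiable_eps db e0.
exists (Num.min d1 d2); first by rewrite lt_min d10.
move=> t u; rewrite !lt_min => /andP[t1 _] /andP[_ u2] tu.
have {}H1 := H1 _ t1; have {}H2 := H2 _ u2.
rewrite AJ in H1; rewrite BJ -ab -tu in H2.
pose X := (t - t0) *m invmx P.
have tX : t - t0 = X *m P by rewrite mulmxKV.
have XE : X - (u - u0) = ((t - t0) *m A - (u - u0) *m B) *m pinvmx B.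
  have -> : (t - t0) *m A = X *m B by rewrite AE mulmxA.
  by rewrite -mulmxBl -mulmxA (mulmxVp Bf) mulmx1.
have leAB : `|(t - t0) *m A - (u - u0) *m B| <= e * `|t - t0| + e * `|u - u0|.
  have -> : (t - t0) *m A - (u - u0) *m B =
    (a t - a t0 - (u - u0) *m B) - (a t - a t0 - (t - t0) *m A).
    by rewrite opprB [RHS]addrC addrA subrK.
  by rewrite (le_trans (ler_normB _ _))// addrC lerD.
have leX : `|X| <= `|u - u0| + c * (e * (p * `|X|) + e * `|u - u0|).
  rewrite -{1}(subrK (u - u0) X) addrC (le_trans (ler_normD _ _))// lerD2l XE.
  apply: le_trans (cB _) _; rewrite ler_wpM2l//; apply: le_trans leAB _.
  by rewrite lerD2r ler_wpM2l ?(ltW e0)// tX.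
have e1 : c * e * p <= 4^-1.
  rewrite mulrAC ler_pdivrMr// -!mulrA mulKf ?pnatr_eq0//.
  by apply: ler_pM; rewrite ?lerDl.
have e2 : c * e <= 4^-1.
  rewrite ler_pdivrMr// -!mulrA mulKf ?pnatr_eq0// -[leLHS]mulr1.
  by apply: ler_pM; rewrite ?lerDl ?lerDr.
have := ler_wpM2r (normr_ge0 X) e1; have := ler_wpM2r (normr_ge0 (u - u0)) e2.
rewrite -/X; move: leX; move: `|X| `|u - u0| (normr_ge0 (u - u0)) => x y y0.
by rewrite mulrDr !mulrA; lra.
Qed.

(** [N] is the part of the Jacobian of [b] that does not factor through that of [a]. Nearby points
    of the [b]-disk are also reached by [a], so [N] is negligible along the disk; convexity of the
    disk and homogeneity make it vanish on every [v - u0], even for [u0] on the boundary. Taking for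
    [v] the origin and the basis vectors gives [N = 0]. *)
Lemma relation_factor (a b : V -> W) (t0 u0 : V) :
  differentiable a t0 -> differentiable b u0 -> a t0 = b u0 ->
  row_free ('J a t0) -> row_free ('J b u0) -> unit_disk k u0 ->
  (forall d, 0 < d -> exists2 d', 0 < d' & forall u, unit_disk k u ->
     `|u - u0| < d' -> exists2 t, `|t - t0| < d & a t = b u) ->
  exists2 P, P \in unitmx & P *m 'J a t0 = 'J b u0.
Proof.
move=> da db ab Af Bf Du0 lift.
set A := 'J a t0 in Af *; set B := 'J b u0 in Bf *.
have AJ : 'J a t0 = A := erefl; have BJ : 'J b u0 = B := erefl.
clearbody A B.
pose P := B *m pinvmx A; pose N := B - P *m A.
have [c c0 cA] := mulmx_norm_le (pinvmx A).
have [p p0 pB] := mulmx_norm_le (1%:M - pinvmx A *m A).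
have [q q0 qB] := mulmx_norm_le B.
(* along the disk, [(u - u0) *m N] is negligible *)
have small e : 0 < e -> exists2 d, 0 < d & forall u, unit_disk k u ->
    `|u - u0| < d -> `|(u - u0) *m N| <= e * `|u - u0|.
  move=> e0; have pq0 : 0 < (p + 1) * (2 * q * c + 2).
    by rewrite mulr_gt0// ?ltr_wpDl// !mulr_ge0.
  have c10 : 0 < 2 * (c + 1) by rewrite mulr_gt0// ltr_wpDl.
  (* The first bound gives [c * e' <= 1/2], so that [|t - t0|] is controlled by [|u - u0|]; the
     second absorbs the constants accumulated after that. *)
  pose e' := Num.min (2 * (c + 1))^-1 (e / ((p + 1) * (2 * q * c + 2))).
  have e'0 : 0 < e' by rewrite lt_min invr_gt0 c10 divr_gt0.
  have ce' : c * e' <= 2^-1.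
    apply: (@le_trans _ _ (c * (2 * (c + 1))^-1)).
      by rewrite ler_wpM2l// ge_min lexx.
    by rewrite ler_pdivrMr// mulrA mulVf ?pnatr_eq0// mul1r lerDl.
  have pe' : p * e' * (2 * q * c + 2) <= e.
    apply: (@le_trans _ _ ((p + 1) * (2 * q * c + 2) * e')).
      rewrite mulrAC ler_wpM2r// ?(ltW e'0)// ler_wpM2r ?lerDl//.
      by rewrite addr_ge0// !mulr_ge0.
    by rewrite mulrC -ler_pdivlMr// ge_min lexx orbT.
  have [d1 d10 H1] := differentiable_eps da e'0.
  have [d2 d20 H2] := differentiable_eps db e'0.
  have [d' d'0 Hd'] := lift _ d10.
  exists (Num.min d' d2); first by rewrite lt_min d'0.
  move=> u Du; rewrite lt_min => /andP[ud' ud2].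
  have [t td1 tu] := Hd' _ Du ud'.
  have {}H1 := H1 _ td1; have {}H2 := H2 _ ud2.
  rewrite AJ in H1; rewrite BJ -ab -tu in H2.
  pose E1 := (t - t0) *m A - (u - u0) *m B.
  have leE1 : `|E1| <= e' * `|t - t0| + e' * `|u - u0|.
    have -> : E1 = (a t - a t0 - (u - u0) *m B) - (a t - a t0 - (t - t0) *m A).
      by rewrite /E1 opprB [RHS]addrC addrA subrK.
    by rewrite (le_trans (ler_normB _ _))// addrC lerD.
  have tE : t - t0 = (u - u0) *m B *m pinvmx A + E1 *m pinvmx A.
    by rewrite -mulmxDl /E1 (addrC (_ *m B)) subrK -mulmxA (mulmxVp Af) mulmx1.
  have leT : `|t - t0| <= c * (q * `|u - u0|) + c * (e' * `|t - t0| + e' * `|u - u0|).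
    rewrite {1}tE (le_trans (ler_normD _ _))// lerD//.
      by apply: le_trans (cA _) _; rewrite ler_wpM2l.
    by apply: le_trans (cA _) _; rewrite ler_wpM2l.
  have NE : (u - u0) *m N = - (E1 *m (1%:M - pinvmx A *m A)).
    have Z : (t - t0) *m A *m (1%:M - pinvmx A *m A) = 0.
      by rewrite -mulmxA mulmxBr mulmx1 mulmxA (mulmxVp Af) mul1mx subrr mulmx0.
    rewrite /N /P -mulmxA -{1}(mulmx1 B) -mulmxBr mulmxA.
    rewrite (_ : (u - u0) *m B = (t - t0) *m A - E1); last by rewrite /E1 subKr.
    by rewrite mulmxBl Z sub0r.
  have leT' : `|t - t0| <= (2 * q * c + 1) * `|u - u0|.
    move: leT (ler_wpM2r (normr_ge0 (t - t0)) ce') (ler_wpM2r (normr_ge0 (u - u0)) ce').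
    move: `|t - t0| `|u - u0| => x y; rewrite mulrDr !mulrA; nra.
  rewrite NE normrN (le_trans (pB _))//.
  apply: (@le_trans _ _ (p * (e' * (2 * q * c + 2) * `|u - u0|))).
    rewrite ler_wpM2l// (le_trans leE1)// -mulrDr -mulrA ler_wpM2l ?(ltW e'0)//.
    by move: leT'; rewrite !mulrDl; lra.
  by rewrite !mulrA ler_wpM2r// -!mulrA; move: pe'; rewrite -!mulrA.
have DN v : unit_disk k v -> (v - u0) *m N = 0.
  move=> Dv; apply/eqP; rewrite -normr_eq0 eq_le normr_ge0 andbT.
  apply/ler_addgt0Pl => e e0; rewrite addr0.
  have v1 : 0 < `|v - u0| + 1 by rewrite ltr_wpDl.
  have [d d0 Hd] := small _ (divr_gt0 e0 v1).
  pose s := Num.min 1 (d / (2 * (`|v - u0| + 1))).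
  have s0 : 0 < s by rewrite lt_min ltr01 divr_gt0// mulr_gt0.
  have s1 : s <= 1 by rewrite ge_min lexx.
  (* A point of the segment from [u0] to [v], close enough to [u0]; dividing the estimate at [u] by
     [s] gives one at [v]. *)
  pose u := u0 + s *: (v - u0).
  have uE : u - u0 = s *: (v - u0) by rewrite /u addrC addKr.
  have Du : unit_disk k u.
    rewrite /unit_disk /= /u; apply: (@le_trans _ _ ((1 - s) * \sum_i u0 ord0 i ^+ 2
        + s * \sum_i v ord0 i ^+ 2)).
      rewrite !mulr_sumr -big_split /=; apply: ler_sum => i _; rewrite !mxE.
      move: (u0 _ _) (v _ _) => x y.
      have : 0 <= s * (1 - s) * (x - y) ^+ 2.
        by rewrite mulr_ge0 ?sqr_ge0// mulr_ge0 ?(ltW s0)// subr_ge0.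
      rewrite !expr2; nra.
    move: Du0 Dv; rewrite /unit_disk /=; move: (\sum_i _) (\sum_i _) => x y; nra.
  have sd : `|u - u0| < d.
    rewrite uE normrZ gtr0_norm//.
    apply: (@le_lt_trans _ _ (d / (2 * (`|v - u0| + 1)) * (`|v - u0| + 1))).
      by apply: ler_pM; rewrite ?(ltW s0)// ?ge_min ?lexx ?orbT// lerDl.
    by rewrite invfM mulrA divfK ?gt_eqF// ltr_pdivrMr// ltr_pMr// ltr1n.
  have := Hd _ Du sd; rewrite uE -scalemxAl !normrZ !(gtr0_norm s0) mulrCA ler_pM2l// => h.
  apply: (le_trans h); rewrite mulrAC ler_pdivrMr// ler_wpM2l// ?(ltW e0)//.
  by rewrite lerDl.
have D0 := unit_disk0 R k.
have u0N : u0 *m N = 0.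
  by have /eqP := DN _ D0; rewrite sub0r mulNmx oppr_eq0 => /eqP.
have N0 : N = 0.
  apply/row_matrixP => i; rewrite row0 rowE.
  have := DN _ (unit_disk_delta R i); rewrite mulmxBl u0N subr0; exact.
have PA : P *m A = B by apply/esym/eqP; rewrite -subr_eq0 -/N N0.
exists P => //.
(* The rank of [P] is at least that of [P *m A = B], which is full. *)
rewrite -row_free_unit -row_leq_rank; move: Bf; rewrite -row_leq_rank => /leq_trans; apply.
by rewrite -PA mxrankM_maxl.
Qed.

End Relation.

Lemma has_jac_comp (R : realType) (k m n : nat) (a : 'rV[R]_k -> 'rV[R]_m)
    (b : 'rV[R]_m -> 'rV[R]_n) x A B :
  has_jac a x A -> has_jac b (a x) B -> has_jac (b \o a) x (A *m B).
Proof.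
move=> /has_jacP [da <-] /has_jacP [db <-]; apply/has_jacP; split.
  exact: differentiable_comp.
apply/row_matrixP => i; rewrite !rowE /jacobian mulmxA !mul_rV_lin1 /=.
by rewrite diff_comp.
Qed.

(** * Volume densities of parametrized disks *)

Section Charts.
Context {R : realType} {m : nat} (M : manifold R m).
Implicit Types (i j : chart_index M).

Lemma continuous_near (S T : topologicalType) (h : S -> T) (x : S) (O : set T) :
  {for x, continuous h} -> open O -> O (h x) -> \forall y \near x, O (h y).
Proof. by move=> ch oO Ohx; apply: ch; exact: open_nbhs_nbhs. Qed.

Lemma near_cvg (S T : topologicalType) (f h : S -> T) (x : S) (l : T) :
  (\forall y \near x, f y = h y) -> f y @[y --> x] --> l -> h y @[y --> x] --> l.
Proof. by move=> fh; apply: cvg_trans; apply: near_eq_cvg; apply: filterS fh => y ->. Qed.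

Section Map.
Context {k : nat} (U : set 'rV[R]_k) (Psi : 'rV[R]_k -> M).
Hypotheses (oU : open U) (C1 : C1_into U Psi).

Lemma C1_into_near i t : U t -> chart_dom i (Psi t) ->
  \forall s \near t, U s /\ chart_dom i (Psi s).
Proof.
move=> Ut it; apply: filterI; first exact: open_nbhs_nbhs.
exact: (continuous_near (C1.1 _ Ut) (@chart_dom_open R m M i) it).
Qed.

Lemma C1_into_diff i t : U t -> chart_dom i (Psi t) ->
  differentiable (@chart R m M i \o Psi) t.
Proof. by move=> Ut it; have [H _] := C1.2 i; exact: H. Qed.

Lemma C1_into_jac i t : U t -> chart_dom i (Psi t) ->
  has_jac (@chart R m M i \o Psi) t ('J (@chart R m M i \o Psi) t).
Proof. by move=> Ut it; apply/has_jacP; split=> //; exact: C1_into_diff. Qed.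

Lemma C1_into_jac_cvg i t : U t -> chart_dom i (Psi t) ->
  'J (@chart R m M i \o Psi) s @[s --> t] --> 'J (@chart R m M i \o Psi) t.
Proof.
move=> Ut it; have [_ H] := C1.2 i.
have E s : U s -> chart_dom i (Psi s) -> forall l c,
    'J (@chart R m M i \o Psi) s l c =
    ('D_(delta_mx ord0 l) (@chart R m M i \o Psi) s) ord0 c.
  move=> Us is' l c; rewrite deriveEjacobian; last exact: C1_into_diff.
  by rewrite -rowE [RHS]mxE.
have Ec l c : ('J (@chart R m M i \o Psi) s) l c @[s --> t] -->
    ('J (@chart R m M i \o Psi) t) l c.
  pose D s := ('D_(delta_mx ord0 l) (@chart R m M i \o Psi) s) ord0 c.
  have cD : D s @[s --> t] --> D t.
    by apply: cvg_mx_coord; exact: (H (delta_mx ord0 l) t).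
  have {}cD : D s @[s --> t] --> ('J (@chart R m M i \o Psi) t) l c :=
    eq_ind_r (fun z => D s @[s --> t] --> z) cD (E t Ut it l c).
  apply: near_cvg cD.
  by apply: filterS (C1_into_near Ut it) => s [Us is']; exact/esym/(E s Us is').
exact: (@cvg_mx R _ (nbhs t) _ _ _ (fun s => 'J (@chart R m M i \o Psi) s) _ Ec).
Qed.

Lemma C1_into_chart_cvg i t : U t -> chart_dom i (Psi t) ->
  {for t, continuous (@chart R m M i \o Psi)}.
Proof. by move=> Ut it; apply: differentiable_continuous; exact: C1_into_diff. Qed.

End Map.

Lemma chart_trans_diff i j x : chart_dom i x -> chart_dom j x ->
  differentiable (@chart R m M j \o @chart_inv R m M i) (chart i x).
Proof.
move=> ix jx; have [H _] := @chart_smooth R m M i j 1%N.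
by apply: H; exists x.
Qed.

(** [chart_at] may jump from one point to the next, so continuity is visible only in a fixed chart;
    this formula passes between the two. *)
Lemma C1_into_chart_change (k : nat) (U : set 'rV[R]_k) (Psi : 'rV[R]_k -> M) i j t :
  open U -> C1_into U Psi -> U t -> chart_dom i (Psi t) -> chart_dom j (Psi t) ->
  'J (@chart R m M j \o Psi) t = 'J (@chart R m M i \o Psi) t *m
     'J (@chart R m M j \o @chart_inv R m M i) (chart i (Psi t)).
Proof.
move=> oU C1 Ut it jt.
have : has_jac (@chart R m M j \o Psi) t ('J (@chart R m M i \o Psi) t *m
     'J (@chart R m M j \o @chart_inv R m M i) (chart i (Psi t))).
  apply: (@near_has_jac _ _ _
    ((@chart R m M j \o @chart_inv R m M i) \o (@chart R m M i \o Psi))).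
    apply: filterS (C1_into_near oU C1 Ut it) => s [Us is'].
    by rewrite /= chartK.
  apply: has_jac_comp; first exact: (C1_into_jac C1).
  by apply/has_jacP; split => //; exact: chart_trans_diff.
by move/has_jacP => [].
Qed.

Lemma C1_into_chart_inv i :
  C1_into (@chart R m M i @` @chart_dom R m M i) (@chart_inv R m M i).
Proof.
split; first by move=> x; exact: chart_inv_cont.
move=> j; have [H1 H2] := @chart_smooth R m M i j 1%N.
have sub p : (@chart R m M i @` @chart_dom R m M i `&`
    @chart_inv R m M i @^-1` @chart_dom R m M j) p ->
    (@chart R m M i @` (@chart_dom R m M i `&` @chart_dom R m M j)) p.
  move=> [[x ix <-]]; rewrite /preimage /= chartK// => jx.
  by exists x.
by split=> [x /sub|v x /sub]; [exact: H1|exact: H2].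
Qed.

(* A chart-free way to say that [F] is C^1. *)
Definition C1_pres (F : M -> M) : Prop :=
  forall (k : nat) (U : set 'rV[R]_k) (Psi : 'rV[R]_k -> M),
    open U -> C1_into U Psi -> C1_into U (F \o Psi).

Lemma C1_pres_holder (eta : R) (f : M -> M) : C1_holder eta f -> C1_pres f.
Proof.
move=> [cf Hf] k U Psi oU C1; split.
  move=> t Ut; apply: continuous_comp; [exact: C1.1|exact: cf].
move=> j.
(* The chain rule on a whole neighbourhood and in fixed charts, so that the derivative can be passed
   to the limit. *)
have key t : U t -> chart_dom j (f (Psi t)) ->
  let i := chart_at (Psi t) in let h := @chart R m M j \o f \o @chart_inv R m M i in
  \forall s \near t, has_jac (@chart R m M j \o (f \o Psi)) s
   ('J (@chart R m M i \o Psi) s *m 'J h (chart i (Psi s))) /\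
   differentiable h (chart i (Psi s)).
  move=> Ut jt i h.
  have it : chart_dom i (Psi t) by exact: chart_at_dom.
  have nj : \forall s \near t, chart_dom j (f (Psi s)).
    apply: (@continuous_near _ _ (f \o Psi)) jt; last exact: chart_dom_open.
    by apply: continuous_comp; [exact: C1.1|exact: cf].
  apply: filterS (nbhs_interior (filterI (C1_into_near oU C1 Ut it) nj)).
  move=> s sn; have [[Us is'] js] := nbhs_singleton sn.
  have dh : differentiable h (chart i (Psi s)).
    by have [[dh _] _] := Hf i j; apply: dh; exists (Psi s).
  split => //.
  apply: (@near_has_jac _ _ _ (h \o (@chart R m M i \o Psi))).
    by apply: filterS sn => r [[Ur ir] _]; rewrite /h /= chartK.
  apply: has_jac_comp; first exact: (C1_into_jac C1).
  by apply/has_jacP.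
split=> [t [Ut jt]|v t [Ut jt]].
  by have /nbhs_singleton[/has_jacP[]] := key t Ut jt.
pose i := chart_at (Psi t); pose h := @chart R m M j \o f \o @chart_inv R m M i.
have it : chart_dom i (Psi t) by exact: chart_at_dom.
(* The Jacobian of [h] is spelled out by directional derivatives, whose continuity is what [Ck]
   provides. *)
have E : \forall s \near t, 'D_v (@chart R m M j \o (f \o Psi)) s =
   v *m ('J (@chart R m M i \o Psi) s *m
     (\matrix_(l, c) ('D_(delta_mx ord0 l) h (chart i (Psi s))) ord0 c)).
  apply: filterS (key t Ut jt) => s [/has_jacP [ds Js] dh].
  rewrite deriveEjacobian// Js; congr (_ *m (_ *m _)).
  apply/matrixP => l c; rewrite [RHS]mxE deriveEjacobian//.
  by rewrite -rowE [RHS]mxE.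
rewrite /= /prop_for /continuous_at (nbhs_singleton E).
have : (v *m ('J (@chart R m M i \o Psi) s *m
     (\matrix_(l, c) ('D_(delta_mx ord0 l) h (chart i (Psi s))) ord0 c))) @[s --> t] -->
     (v *m ('J (@chart R m M i \o Psi) t *m
     (\matrix_(l, c) ('D_(delta_mx ord0 l) h (chart i (Psi t))) ord0 c))).
  have cJ := C1_into_jac_cvg oU C1 Ut it.
  have cH : (\matrix_(l < m, c < m) ('D_(delta_mx ord0 l) h (chart i (Psi s))) ord0 c)
      @[s --> t] --> (\matrix_(l, c) ('D_(delta_mx ord0 l) h (chart i (Psi t))) ord0 c).
    apply: (@cvg_mx R _ (nbhs t) _ _ _ (fun s => \matrix_(l < m, c < m)
      ('D_(delta_mx ord0 l) h (chart i (Psi s))) ord0 c)) => l c; rewrite mxE; under eq_cvg do rewrite mxE.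
    have c1 : {for chart i (Psi t), continuous ('D_(delta_mx ord0 l) h)}.
      by have [[_ dh] _] := Hf i j; apply: dh; exists (Psi t).
    have c2 : {for t, continuous (@chart R m M i \o Psi)}.
      exact: (C1_into_chart_cvg C1).
    exact: (@cvg_mx_coord R _ (nbhs t) 1 m (fun s =>
      ('D_(delta_mx ord0 l) h) ((@chart R m M i \o Psi) s)) _ ord0 c (continuous_comp c2 c1)).
  exact: cvg_mulmx (cvg_cst _) (cvg_mulmx cJ cH).
apply: near_cvg.
by apply: filterS E => s ->.
Qed.

Lemma C1_pres_iter (f : M -> M) (n : nat) : C1_pres f -> C1_pres (iter n f).
Proof.
move=> Hf; elim: n => [//|n IH] k U Psi oU C1.
exact: (Hf _ _ (iter n f \o Psi) oU (IH _ _ _ oU C1)).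
Qed.

Lemma C1_pres_jac (F : M -> M) (k : nat) (U : set 'rV[R]_k) (Psi : 'rV[R]_k -> M) i j t :
  C1_pres F -> open U -> C1_into U Psi -> U t ->
  chart_dom i (Psi t) -> chart_dom j (F (Psi t)) ->
  'J (@chart R m M j \o (F \o Psi)) t = 'J (@chart R m M i \o Psi) t *m
     'J (@chart R m M j \o F \o @chart_inv R m M i) (chart i (Psi t)).
Proof.
move=> HF oU C1 Ut it jt.
have : has_jac (@chart R m M j \o (F \o Psi)) t ('J (@chart R m M i \o Psi) t *m
     'J (@chart R m M j \o F \o @chart_inv R m M i) (chart i (Psi t))).
  apply: (@near_has_jac _ _ _
    ((@chart R m M j \o F \o @chart_inv R m M i) \o (@chart R m M i \o Psi))).
    apply: filterS (C1_into_near oU C1 Ut it) => s [Us is'].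
    by rewrite /= chartK.
  apply: has_jac_comp; first exact: (C1_into_jac C1).
  (* A chart inverse is itself a C^1 parametrization, which makes [F] differentiable in
     coordinates. *)
  have C2 := HF _ _ _ (@chart_img_open R m M i) (C1_into_chart_inv i).
  apply: (C1_into_jac C2); first by exists (Psi t).
  by rewrite /= chartK.
by move/has_jacP => [].
Qed.

Section Volume.
Variable g : riemannian_metric M.

(** The metric in the chart [i], in the form whose smoothness [metric_smooth] provides. *)
Definition chart_metric i (p : 'rV[R]_m) : 'M[R]_m :=
  let x := chart_inv i p in
  let A := 'J (@chart R m M (chart_at x) \o @chart_inv R m M i) p in
  A *m metric_mx g x *m A^T.

Lemma chart_metric_cvg i x : chart_dom i x ->
  {for chart i x, continuous (chart_metric i)}.
Proof. by move=> ix; apply: (metric_smooth g i 0%N); exists x. Qed.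

Definition param_jac k (Psi : 'rV[R]_k -> M) t :=
  'J (@chart R m M (chart_at (Psi t)) \o Psi) t.

Definition vol k (Psi : 'rV[R]_k -> M) t : R := tvolume g (Psi t) (param_jac Psi t).

Lemma volE k (U : set 'rV[R]_k) (Psi : 'rV[R]_k -> M) i t : open U -> C1_into U Psi ->
  U t -> chart_dom i (Psi t) ->
  let J := 'J (@chart R m M i \o Psi) t in
  vol Psi t = Num.sqrt (\det (J *m chart_metric i (chart i (Psi t)) *m J^T)).
Proof.
move=> oU C1 Ut it J; rewrite /vol /tvolume /param_jac.
rewrite (C1_into_chart_change oU C1 Ut it (chart_at_dom _)) /chart_metric chartK//.
by rewrite trmx_mul !mulmxA.
Qed.

Lemma vol_cvg k (U : set 'rV[R]_k) (Psi : 'rV[R]_k -> M) t : open U -> C1_into U Psi ->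
  U t -> {for t, continuous (vol Psi)}.
Proof.
move=> oU C1 Ut; pose i := chart_at (Psi t).
have it : chart_dom i (Psi t) by exact: chart_at_dom.
rewrite /prop_for /continuous_at (volE oU C1 Ut it).
have : Num.sqrt (\det ('J (@chart R m M i \o Psi) s *m chart_metric i (chart i (Psi s))
    *m ('J (@chart R m M i \o Psi) s)^T)) @[s --> t] -->
  Num.sqrt (\det ('J (@chart R m M i \o Psi) t *m chart_metric i (chart i (Psi t))
    *m ('J (@chart R m M i \o Psi) t)^T)).
  apply: (@cvg_comp _ _ _ _ Num.sqrt); last exact: sqrt_continuous.
  have cJ := C1_into_jac_cvg oU C1 Ut it.
  have cG : chart_metric i (chart i (Psi s)) @[s --> t] -->
      chart_metric i (chart i (Psi t)).
    have c2 : {for t, continuous (@chart R m M i \o Psi)}.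
      exact: (C1_into_chart_cvg C1).
    exact: (continuous_comp c2 (chart_metric_cvg it)).
  exact: cvg_det (cvg_mulmx (cvg_mulmx cJ cG) (cvg_trmx cJ)).
apply: near_cvg.
have n := C1_into_near oU C1 Ut it.
by apply: filterS n => s [Us is']; exact/esym/(volE oU C1 Us is').
Qed.

Lemma tvolume_gt0 k x (E : 'M[R]_(k, m)) : row_free E -> 0 < tvolume g x E.
Proof.
move=> Ef; rewrite sqrtr_gt0; apply: posdef_det_gt0 => v v0.
have := @metric_pos R m M g x (v *m E); rewrite /qform trmx_mul !mulmxA; apply.
by apply: contra v0 => /eqP vE; apply/eqP; apply: (row_free_inj Ef); rewrite vE mul0mx.
Qed.

Lemma tvolume_mulmx k x (P : 'M[R]_k) (E : 'M[R]_(k, m)) :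
  row_free E -> tvolume g x (P *m E) = `|\det P| * tvolume g x E.
Proof.
move=> Ef; rewrite /tvolume trmx_mul.
rewrite (_ : _ *m (_ *m _) = P *m (E *m metric_mx g x *m E^T) *m P^T); last by rewrite !mulmxA.
rewrite !det_mulmx det_tr mulrAC -expr2 sqrtrM ?sqr_ge0// sqrtr_sqr.
by [].
Qed.

End Volume.

(** The Jacobian of [Psi = Finv \o (F \o Psi)] is that of [F \o Psi] times a matrix, so the rank
    cannot drop under [F]. *)
Lemma row_free_pres (F Finv : M -> M) (k : nat) (U : set 'rV[R]_k)
    (Psi : 'rV[R]_k -> M) t :
  C1_pres F -> C1_pres Finv -> cancel F Finv -> open U -> C1_into U Psi -> U t ->
  row_free (param_jac Psi t) -> row_free (param_jac (F \o Psi) t).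
Proof.
move=> HF HFi FK oU C1 Ut; rewrite /param_jac.
have C2 := HF _ _ _ oU C1.
have := C1_pres_jac HFi oU C2 Ut (chart_at_dom (F (Psi t))).
move=> /(_ (chart_at (Psi t))); rewrite /= FK => /(_ (chart_at_dom _)).
have -> : @chart R m M (chart_at (Psi t)) \o (Finv \o (F \o Psi)) =
   @chart R m M (chart_at (Psi t)) \o Psi by apply/funext => s /=; rewrite FK.
move=> ->; rewrite -!row_leq_rank => /leq_trans; apply; exact: mxrankM_maxl.
Qed.

Lemma param_jac_pres (F : M -> M) (k : nat) (U : set 'rV[R]_k)
    (Psi : 'rV[R]_k -> M) t :
  C1_pres F -> open U -> C1_into U Psi -> U t ->
  param_jac Psi t *m tangent_map F (Psi t) = param_jac (F \o Psi) t.
Proof.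
move=> HF oU C1 Ut; rewrite /param_jac /tangent_map.
by rewrite (C1_pres_jac HF oU C1 Ut (chart_at_dom _) (chart_at_dom _)).
Qed.

End Charts.

Lemma closed_preimI (S T : topologicalType) (D : set S) (f : S -> T) (C : set T) :
  closed D -> (forall x, D x -> {for x, continuous f}) -> closed C ->
  closed (D `&` f @^-1` C).
Proof.
move=> cD cf cC x clx.
have Dx : D x by apply: cD => B /clx [y [[Dy _] By]]; exists y.
split => //; apply: cC => B nB.
by have [y [[Dy Cy] By]] := clx _ (cf _ Dx _ nB); exists (f y).
Qed.

Lemma measurable_fun_closed (S T : ptopologicalType) (D : set S) (f : S -> T) :
  closed D -> (forall C : set T, closed C -> closed (D `&` f @^-1` C)) ->
  measurable_fun (D : set (borel S)) (f : borel S -> borel T).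
Proof.
move=> cD cf; apply: (@measurability _ _ (borel S) (borel T) _ _ (@open T)) => //.
move=> _ [ O oO <-].
have -> : D `&` f @^-1` O = D `\` (D `&` f @^-1` (~` O)).
  apply/seteqP; split => x [Dx Ox]; split => //; first by case.
  by apply: contrapT => nO; apply: Ox.
apply: measurableD; first exact: measurable_borel_closed.
by apply: measurable_borel_closed; apply: cf; exact: open_closedC.
Qed.

Lemma measurable_fun_closedR (R : realType) (S : ptopologicalType) (D : set S) (f : S -> R) :
  closed D -> (forall C : set R, closed C -> closed (D `&` f @^-1` C)) ->
  measurable_fun (D : set (borel S)) (f : borel S -> R).
Proof.
move=> cD cf; apply: (measurability (@RGenOpens.G R)); first exact: RGenOpens.measurableE.
move=> _ [_ [a [b ->]] <-]; pose O : set R := `]a, b[%classic.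
have -> : D `&` f @^-1` O = D `\` (D `&` f @^-1` (~` O)).
  apply/seteqP; split => x [Dx Ox]; split => //; first by case.
  by apply: contrapT => nO; apply: Ox.
apply: measurableD; first exact: measurable_borel_closed.
apply: measurable_borel_closed; apply: cf; apply: open_closedC.
exact: interval_open.
Qed.

Section UnitDisk.
Context {R : realType} {k : nat}.
Local Notation D := (@unit_disk R k).

Lemma unit_disk_norm (x : 'rV[R]_k) : D x -> `|x| <= 1.
Proof.
move=> Dx; apply: row_mx_norm => // i.
have : x ord0 i ^+ 2 <= 1.
  apply: le_trans Dx; rewrite (bigD1 i)//= lerDl sumr_ge0// => j _.
  exact: sqr_ge0.
by rewrite -real_normK ?num_real// expr_le1.
Qed.

Lemma unit_disk_closed : closed D.
Proof.
have cf : continuous (fun t : 'rV[R]_k => \sum_(i < k) t ord0 i ^+ 2).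
  move=> t; apply: (@cvg_sumr R _ (nbhs t) _ _ (fun i (s : 'rV[R]_k) => s ord0 i ^+ 2)) => i.
  apply: (@continuous_comp _ _ _ (fun v : 'rV[R]_k => v ord0 i) (fun x => x ^+ 2)).
    exact: continuous_coord.
  exact: exprn_continuous.
have -> : D = setT `&` (fun t : 'rV[R]_k => \sum_(i < k) t ord0 i ^+ 2) @^-1` [set x | x <= 1].
  by rewrite setTI.
by apply: closed_preimI; [exact: closedT|move=> x _; exact: cf|exact: closed_le].
Qed.

Lemma unit_disk_compact : compact D.
Proof.
apply: bounded_closed_compact; last exact: unit_disk_closed.
exists 1; split; first exact: num_real.
by move=> r r1 x /unit_disk_norm; move/le_trans; apply; exact: ltW.
Qed.

End UnitDisk.

(** * Area of embedded disks and change of parametrization *)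

Section Area.
Context {R : realType} {m : nat} (M : manifold R m) (g : riemannian_metric M) {k : nat}.
Local Notation V := 'rV[R]_k.
Local Notation D := (@unit_disk R k).
Local Notation leb := (lebrow k).
Implicit Types (Psi : V -> M).

Definition embedding Psi : Prop :=
  [/\ exists U : set V, [/\ open U, D `<=` U & C1_into U Psi],
      forall t, D t -> row_free (param_jac Psi t) &
      forall t u, D t -> D u -> Psi t = Psi u -> t = u].

Definition area Psi (A : set M) : \bar R :=
  (\int[leb]_(t in D `&` Psi @^-1` A) (vol g Psi t)%:E)%E.

Section Embedding.
Variable Psi : V -> M.
Hypothesis eP : embedding Psi.

Lemma embedding_cont t : D t -> {for t, continuous Psi}.
Proof. by have [[U [_ DU [C _]]] _ _] := eP; move=> /DU; exact: C. Qed.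

Lemma embedding_vol_cont t : D t -> {for t, continuous (vol g Psi)}.
Proof. by have [[U [oU DU C]] _ _] := eP; move=> /DU; exact: vol_cvg. Qed.

Lemma embedding_vol_gt0 t : D t -> 0 < vol g Psi t.
Proof. by move=> Dt; apply: tvolume_gt0; have [_ H _] := eP; exact: H. Qed.

Lemma embedding_compact C : closed C -> C `<=` D -> compact (Psi @` C).
Proof.
move=> cC CD; apply: continuous_compact; last exact: (subclosed_compact cC unit_disk_compact).
by apply: continuous_in_subspaceT => t; rewrite inE => /CD; exact: embedding_cont.
Qed.

Lemma embedding_closed C : closed C -> C `<=` D -> closed (Psi @` C).
Proof.
move=> cC CD; apply: compact_closed; first exact: mpoint_hausdorff.
exact: embedding_compact.
Qed.

Lemma embedding_measurable :
  measurable_fun (D : set (borel V)) (Psi : borel V -> borel M).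
Proof.
apply: measurable_fun_closed; first exact: unit_disk_closed.
move=> C cC; apply: closed_preimI => //; first exact: unit_disk_closed.
exact: embedding_cont.
Qed.

Lemma embedding_vol_measurable :
  measurable_fun (D : set (borel V)) (vol g Psi : borel V -> R).
Proof.
apply: measurable_fun_closedR; first exact: unit_disk_closed.
move=> C cC; apply: closed_preimI => //; first exact: unit_disk_closed.
exact: embedding_vol_cont.
Qed.

Lemma measurable_unit_disk : measurable (D : set (borel V)).
Proof. by apply: measurable_borel_closed; exact: unit_disk_closed. Qed.

Lemma embedding_preim_measurable (A : set M) : measurable (A : set (borel M)) ->
  measurable (D `&` Psi @^-1` A : set (borel V)).
Proof. by move=> mA; exact: embedding_measurable measurable_unit_disk _ mA. Qed.

(** Continuity of the inverse on the image: the parameters at distance at least [d] from [t0] form a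
    compact set, whose closed image misses [Psi t0] by injectivity. *)
Lemma embedding_inv_cont t0 d : D t0 -> 0 < d ->
  exists O : set M, [/\ open O, O (Psi t0) & forall t, D t -> O (Psi t) -> `|t - t0| < d].
Proof.
move=> Dt0 d0; pose C := D `&` (fun t => `|t - t0|) @^-1` [set x | d <= x].
have cC : closed C.
  apply: closed_preimI; first exact: unit_disk_closed.
    move=> t _; apply: (@continuous_comp _ _ _ (fun s : V => s - t0) (fun s => `|s|)).
      by apply: continuousB; [exact: cvg_id|exact: cst_continuous].
    exact: norm_continuous.
  exact: closed_ge.
exists (~` (Psi @` C)); split.
- by apply: closed_openC; apply: embedding_closed => // t [].
- move=> [t [Dt /= dt] tt0]; have [_ _ inj] := eP.
  by move: dt; rewrite (inj _ _ Dt Dt0 tt0) subrr normr0 leNgt d0.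
- move=> t Dt Ot; rewrite ltNge; apply/negP => dt; apply: Ot.
  by exists t.
Qed.

Lemma area_ge0 A : (0 <= area Psi A)%E.
Proof. by apply: integral_ge0 => t [/embedding_vol_gt0 h _]; rewrite lee_fin ltW. Qed.

End Embedding.

Lemma param_jacE (Psi : V -> M) t c : chart_at (Psi t) = c ->
  param_jac Psi t = 'J (@chart R m M c \o Psi) t.
Proof. by move=> <-. Qed.

Section Compare.
Variables Psi1 Psi2 : V -> M.
Hypotheses (e1 : embedding Psi1) (e2 : embedding Psi2).
Hypothesis fac : forall t u, D t -> D u -> Psi1 t = Psi2 u ->
  exists2 P, P \in unitmx & P *m param_jac Psi1 t = param_jac Psi2 u.

(** [G] is the transition map between the parametrizations, meaningful only where the images meet.
    Its linear model is the matrix [P] of [fac], for which [|det P|] times the density of [Psi1] is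
    the density of [Psi2]; the weighted inequality applies to these densities. *)
Lemma area_le (A : set M) : measurable (A : set (borel M)) ->
  A `<=` Psi1 @` D -> A `<=` Psi2 @` D ->
  (area Psi1 A <= (expR 2 * 4 ^+ k)%:E * area Psi2 A)%E.
Proof.
move=> mA A1 A2.
pose G (u : V) : V := xget 0 [set t | D t /\ Psi1 t = Psi2 u].
pose H (t : V) : V := xget 0 [set u | D u /\ Psi2 u = Psi1 t].
have GP u : (Psi1 @` D) (Psi2 u) -> D (G u) /\ Psi1 (G u) = Psi2 u.
  move=> [t Dt tu]; rewrite /G.
  exact: (@xgetPex _ 0 [set t | D t /\ Psi1 t = Psi2 u] (ex_intro _ t (conj Dt tu))).
have HP t : (Psi2 @` D) (Psi1 t) -> D (H t) /\ Psi2 (H t) = Psi1 t.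
  move=> [u Du tu]; rewrite /H.
  exact: (@xgetPex _ 0 [set u | D u /\ Psi2 u = Psi1 t] (ex_intro _ u (conj Du tu))).
have [[U1 [oU1 DU1 C1]] f1 i1] := e1; have [[U2 [oU2 DU2 C2]] f2 i2] := e2.
have mE1 := embedding_preim_measurable e1 mA.
have mE2 := embedding_preim_measurable e2 mA.
have cD := @unit_disk_closed R k.
(* Transition maps pull closed sets back to closed sets, because embeddings send closed parts of the
   disk to closed sets. *)
have inv_measurable (F1 F2 : V -> M) (I : V -> V) (E : set V) :
    embedding F1 -> embedding F2 -> measurable (E : set (borel V)) ->
    (forall u, (F1 @` D) (F2 u) -> D (I u) /\ F1 (I u) = F2 u) ->
    E `<=` D `&` F2 @^-1` (F1 @` D) ->
    measurable_fun (E : set (borel V)) (I : borel V -> borel V).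
  move=> eF1 eF2 mE IP ED.
  have cF1 : closed (F1 @` D) by apply: (embedding_closed eF1).
  have cD' : closed (D `&` F2 @^-1` (F1 @` D)).
    by apply: closed_preimI => // u; exact: embedding_cont.
  apply: (@measurable_funS _ _ (borel V) (borel V) (D `&` F2 @^-1` (F1 @` D) : set (borel V))) => //.
    exact: measurable_borel_closed.
  apply: measurable_fun_closed => // C cC.
  have -> : D `&` F2 @^-1` (F1 @` D) `&` I @^-1` C = D `&` F2 @^-1` (F1 @` (D `&` C)).
    apply/seteqP; split => u.
      by move=> [[Du Fu] Cu]; have [DI FI] := IP _ Fu; split => //; exists (I u).
    move=> [Du [t [Dt Ct] tu]]; have Fu : (F1 @` D) (F2 u) by exists t.
    have [DI FI] := IP _ Fu; split => //; have [_ _ inj] := eF1.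
    by rewrite /preimage /= (inj (I u) t)// FI.
  apply: closed_preimI => //; first exact: embedding_cont.
  by apply: (embedding_closed eF1) => [|t []//]; exact: closedI.
have Psel : forall u, exists P : 'M[R]_k, D u -> (Psi1 @` D) (Psi2 u) ->
    P \in unitmx /\ P *m param_jac Psi1 (G u) = param_jac Psi2 u.
  move=> u; have [[Du Fu]|n] := pselect (D u /\ (Psi1 @` D) (Psi2 u)); last first.
    by exists 0 => Du Fu; exfalso; apply: n.
  have [DG FG] := GP _ Fu; have [P Pu PA] := fac DG Du FG.
  by exists P.
have {Psel} [P PP] := choice Psel.
apply: (@weighted_image_le R k _ _ G H P).
- exact: mE2.
- by move=> x [/unit_disk_norm].
- exact: mE1.
- move=> t [Dt At]; have [DH FH] := HP _ (A2 _ At).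
  split; first by split => //; rewrite /preimage /= FH.
  have Ft : (Psi1 @` D) (Psi2 (H t)) by rewrite FH; exists t.
  by have [DG FG] := GP _ Ft; apply: i1 => //; rewrite FG.
- apply: (inv_measurable Psi1 Psi2) => // u [Du Au]; split => //; exact: A1.
- apply: (inv_measurable Psi2 Psi1) => // u [Du Au]; split => //; exact: A2.
- by apply: (measurable_funS measurable_unit_disk _ (embedding_vol_measurable e1)) => t [].
- by apply: (measurable_funS measurable_unit_disk _ (embedding_vol_measurable e2)) => t [].
- by move=> t [Dt _]; exact: embedding_vol_gt0.
- by move=> t [Dt _]; exact: embedding_vol_gt0.
- move=> u [Du Au] _; have Fu := A1 _ Au; have [Pu PA] := PP _ Du Fu.
  have [DG FG] := GP _ Fu.
  split; first by move: Pu; rewrite unitmxE unitfE.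
  by rewrite /vol -PA -FG tvolume_mulmx//; exact: f1.
- move=> u0 [Du0 Au0]; have Fu0 := A1 _ Au0; have [Pu PA] := PP _ Du0 Fu0.
  have [DG FG] := GP _ Fu0.
  pose c := chart_at (Psi2 u0).
  have cx : chart_dom c (Psi2 u0) by exact: chart_at_dom.
  have d2 : differentiable (@chart R m M c \o Psi2) u0.
    by apply: (C1_into_diff C2) => //; exact: DU2.
  have d1 : differentiable (@chart R m M c \o Psi1) (G u0).
    by apply: (C1_into_diff C1); [exact: DU1|rewrite FG].
  have PA' : P u0 *m 'J (@chart R m M c \o Psi1) (G u0) = 'J (@chart R m M c \o Psi2) u0.
    have jE := param_jacE (congr1 (@chart_at R m M) FG).
    exact: (eq_ind _ (fun A => P u0 *m A = param_jac Psi2 u0) PA _ jE).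
  have ab : (@chart R m M c \o Psi1) (G u0) = (@chart R m M c \o Psi2) u0 by rewrite /= FG.
  have [d d0 Hd] := relation_local d1 d2 ab (f2 _ Du0) Pu PA'.
  have [ O [oO O0 HO]] := embedding_inv_cont e1 DG d0.
  have nO : \forall u \near u0, O (Psi2 u).
    by apply: (continuous_near (embedding_cont e2 Du0)) => //; rewrite -FG.
  move: nO => /nbhs_ballP [d' d'0 Hd'].
  exists (Num.min d d'); first by rewrite lt_min d0.
  move=> u [Du Au]; rewrite lt_min => /andP[ud ud'].
  have [DGu FGu] := GP _ (A1 _ Au).
  apply: Hd => //=; last by rewrite FGu.
  apply: HO => //; rewrite FGu; apply: Hd'.
  by rewrite -ball_normE /= distrC.
Qed.

End Compare.

Section Reparametrization.
Variables Psi1 Psi2 : V -> M.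
Hypotheses (e1 : embedding Psi1) (e2 : embedding Psi2).
Hypothesis sub : Psi2 @` D `<=` Psi1 @` D.

(** Continuity of the inverse of [Psi1] provides the lifting hypothesis of [relation_factor]. *)
Lemma embedding_factor t u : D t -> D u -> Psi1 t = Psi2 u ->
  exists2 P, P \in unitmx & P *m param_jac Psi1 t = param_jac Psi2 u.
Proof.
move=> Dt Du tu; pose c := chart_at (Psi2 u).
have [[U1 [oU1 DU1 C1]] f1 i1] := e1; have [[U2 [oU2 DU2 C2]] f2 i2] := e2.
have cx : chart_dom c (Psi2 u) by exact: chart_at_dom.
have d2 : differentiable (@chart R m M c \o Psi2) u.
  by apply: (C1_into_diff C2) => //; exact: DU2.
have d1 : differentiable (@chart R m M c \o Psi1) t.
  by apply: (C1_into_diff C1); [exact: DU1|rewrite tu].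
have ab : (@chart R m M c \o Psi1) t = (@chart R m M c \o Psi2) u by rewrite /= tu.
have jE : param_jac Psi1 t = 'J (@chart R m M c \o Psi1) t :=
  param_jacE (congr1 (@chart_at R m M) tu).
have fa : row_free ('J (@chart R m M c \o Psi1) t) :=
  eq_ind _ (fun A => is_true (row_free A)) (f1 _ Dt) _ jE.
have [|P Pu PA] := relation_factor d1 d2 ab fa (f2 _ Du) Du; last first.
  exists P; first exact: Pu.
  exact: (eq_ind _ (fun A => P *m A = param_jac Psi2 u) PA _ (esym jE)).
move=> {fa jE f1 f2 d1 d2 ab} d d0; have [ O [oO O0 HO]] := embedding_inv_cont e1 Dt d0.
have nO : \forall s \near u, O (Psi2 s).
  exact: (continuous_near (embedding_cont e2 Du) oO (eq_ind _ O O0 _ tu)).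
move: nO => /nbhs_ballP [d' d'0 Hd']; exists d'; first exact: d'0.
move=> s Ds sd.
have [r Dr rs] : (Psi1 @` D) (Psi2 s) by apply: sub; exists s.
exists r; last by rewrite /= rs.
by apply: HO => //; rewrite rs; apply: Hd'; rewrite -ball_normE /= distrC.
Qed.

Lemma area_reparam (A : set M) : measurable (A : set (borel M)) -> A `<=` Psi2 @` D ->
  (area Psi1 A <= (expR 2 * 4 ^+ k)%:E * area Psi2 A)%E /\
  (area Psi2 A <= (expR 2 * 4 ^+ k)%:E * area Psi1 A)%E.
Proof.
move=> mA A2; have A1 : A `<=` Psi1 @` D by move=> x /A2 /sub.
split; first by apply: area_le => // t u; exact: embedding_factor.
(* The images are nested one way only, so the reverse factorization is obtained by inverting [P]. *)
apply: area_le => // u t Du Dt ut; have [P Pu PA] := embedding_factor Dt Du (esym ut).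
exists (invmx P); first by rewrite unitmx_inv.
exact: (eq_ind _ (fun A => invmx P *m A = param_jac Psi1 t)
  (mulKmx Pu (param_jac Psi1 t)) _ PA).
Qed.

End Reparametrization.

End Area.

(** * The Lebesgue measure of a disk *)

Section DiskMeasure.
Context {R : realType} {m : nat} (M : manifold R m) (g : riemannian_metric M).
Variable (F : disk_family M).
Local Notation k := (disk_dim F).
Local Notation D := (@unit_disk R k).
Local Notation leb := (lebrow k).

Lemma disk_embedding (w : disk_param F) : embedding (disk_map w).
Proof.
split.
- by have [U [oU DU CU]] := disk_C1 w; exists U.
- by move=> t Dt; exact: disk_immersion.
- by move=> t u Dt Du /(disk_map_inj Dt Du) [].
Qed.

(** [disk_leb] is an iterated integral; this set function agrees with it on Borel sets ([disk_lebE])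
    and carries a measure structure. *)
Definition disk_area (w : disk_param F) (A : set (borel M)) : \bar R :=
  area g (disk_map w) A.

Section Instance.
Variable w : disk_param F.

Let mpre (A : set (borel M)) : measurable A ->
  measurable (D `&` disk_map w @^-1` A : set (borel 'rV[R]_k)).
Proof. by move=> mA; exact: (embedding_preim_measurable (disk_embedding w) mA). Qed.

Let vol0 t : D t -> (0 <= (vol g (disk_map w) t)%:E)%E.
Proof. by move=> Dt; rewrite lee_fin ltW// (embedding_vol_gt0 g (disk_embedding w)). Qed.

Let mvol (E : set 'rV[R]_k) : E `<=` D ->
  measurable_fun (E : set (borel 'rV[R]_k)) (fun t => (vol g (disk_map w) t)%:E).
Proof.
move=> ED; apply/measurable_EFinP.
exact: (measurable_funS (measurable_unit_disk (k := k)) ED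
  (embedding_vol_measurable g (disk_embedding w))).
Qed.

Let area_0 : disk_area w set0 = 0%E.
Proof. by rewrite /disk_area /area preimage_set0 setI0 integral_set0. Qed.

Let area_ge0' A : (0 <= disk_area w A)%E.
Proof. exact: (area_ge0 g (disk_embedding w)). Qed.

Let area_sigma : semi_sigma_additive (disk_area w).
Proof.
move=> A mA tA mUA; rewrite /disk_area /area preimage_bigcup setI_bigcupr.
rewrite ge0_integral_bigcup.
- by apply: is_cvg_nneseries => n _ _; exact: area_ge0'.
- by move=> n; exact: mpre.
- by apply: mvol => t [n _ []].
- by move=> t [n _ [Dt _]]; exact: vol0.
- apply/trivIsetP => i j _ _ ij; move/trivIsetP : tA => /(_ i j I I ij) e.
  by rewrite setIACA setIid -preimage_setI e preimage_set0 setI0.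
Qed.

HB.instance Definition _ := isMeasure.Build _ _ _ (disk_area w)
  area_0 area_ge0' area_sigma.

Lemma disk_integralE (h : M -> \bar R) :
  measurable_fun [set: borel M] (h : borel M -> \bar R) ->
  (forall x, disk w x -> 0 <= h x)%E ->
  disk_integral g w h =
  (\int[leb]_(t in D) ((vol g (disk_map w) t)%:E * h (disk_map w t)))%E.
Proof.
move=> mh h0; rewrite /disk_integral.
pose q t := ((vol g (disk_map w) t)%:E * h (disk_map w t))%E.
have -> : (fun t : 'rV[R]_k => ((\1_(unit_disk k) t *
      tvolume g (disk_map w t) (disk_tangent w t))%:E * h (disk_map w t))%E) = q \_ D.
  apply/funext => t; rewrite /patch indicE.
  by case: ifP => tD; rewrite ?mul1r// mul0r mul0e.
have q0 t : D t -> (0 <= q t)%E.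
  by move=> Dt; rewrite mule_ge0 ?vol0// h0//; exists t.
have mq : measurable_fun (D : set (borel 'rV[R]_k)) q.
  apply: emeasurable_funM; first exact: mvol.
  have mphi := embedding_measurable (disk_embedding w).
  exact: (measurable_comp measurableT (@subsetT _ _) mh mphi).
rewrite iterated_integralE.
- by rewrite -integral_mkcond.
- by apply/(measurable_restrictT _ (measurable_unit_disk (k := k))).
- by move=> t; rewrite /patch; case: ifP => // /set_mem; exact: q0.
Qed.

Lemma disk_lebE (A : set M) : measurable (A : set (borel M)) ->
  disk_leb g w A = disk_area w A.
Proof.
move=> mA; rewrite /disk_leb disk_integralE; last 2 first.
- by apply/measurable_EFinP; exact: measurable_indic.
- by move=> x _; rewrite lee_fin.
rewrite /disk_area /area integral_mkcondr; apply: eq_integral => t _.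
rewrite /patch indicE.
have -> : (disk_map w t \in A) = (t \in disk_map w @^-1` A) by apply/idP/idP; rewrite !inE.
by case: ifP => _; rewrite ?mule1 ?mule0.
Qed.

Lemma disk_areaI (A : set M) : disk_area w (disk w `&` A) = disk_area w A.
Proof.
rewrite /disk_area /area; congr integral; apply/seteqP; split => t.
  by move=> [Dt [_ At]].
by move=> [Dt At]; split => //; split => //; exists t.
Qed.

End Instance.
End DiskMeasure.

(** * Iterates of [f] along embedded disks *)

Section Iterates.
Context {R : realType} {m : nat} (M : manifold R m) (g : riemannian_metric M).
Variables (f finv : M -> M) (eta : R).
Hypothesis hf : C1_holder_diffeo eta f finv.

Lemma iter_cancel n : cancel (iter n f) (iter n finv).
Proof.
have [fK _ _ _] := hf; elim: n => [//|n IH] x.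
by rewrite iterSr [iter n.+1 f x]/= fK IH.
Qed.

Lemma iter_inj n : injective (iter n f).
Proof. exact: can_inj (iter_cancel n). Qed.

Lemma iter_continuous n : continuous (iter n f).
Proof.
have [_ _ [cf _] _] := hf; elim: n => [|n IH] x; first exact: cvg_id.
by apply: (@continuous_comp _ _ _ (iter n f) f); [exact: IH|exact: cf].
Qed.

Lemma iter_measurable n (A : set M) : measurable (A : set (borel M)) ->
  measurable (iter n f @^-1` A : set (borel M)).
Proof.
move=> mA; rewrite -[X in measurable X]setTI.
exact: (measurable_fun_borel (@iter_continuous n) measurableT mA).
Qed.

Lemma iter_embedding (k n : nat) (Psi : 'rV[R]_k -> M) :
  embedding Psi -> embedding (iter n f \o Psi).
Proof.
have [_ _ h1 h2] := hf.
have p1 := C1_pres_iter n (C1_pres_holder h1).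
have p2 := C1_pres_iter n (C1_pres_holder h2).
move=> [[U [oU DU CU]] fr inj]; split.
- by exists U; split => //; exact: p1.
- move=> t Dt; apply: (row_free_pres p1 p2 (@iter_cancel n) oU CU (DU _ Dt)).
  exact: fr.
- by move=> t u Dt Du /= /iter_inj; exact: inj.
Qed.

Lemma vol_iter (k n : nat) (Psi : 'rV[R]_k -> M) t : embedding Psi -> unit_disk k t ->
  vol g (iter n f \o Psi) t =
  tvolume g (iter n f (Psi t)) (param_jac Psi t *m tangent_map (iter n f) (Psi t)).
Proof.
have [_ _ h1 h2] := hf.
have p1 := C1_pres_iter n (C1_pres_holder h1).
move=> [[U [oU DU CU]] fr inj] Dt; rewrite /vol.
have E := param_jac_pres p1 oU CU (DU _ Dt).
exact: (eq_ind _ (fun A => tvolume g _ A = _) erefl _ E).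
Qed.

End Iterates.

Section Transfer.
Context {R : realType} {m : nat} (M : manifold R m) (g : riemannian_metric M).
Variables (f finv : M -> M) (eta : R).
Hypothesis hf : C1_holder_diffeo eta f finv.
Variable Y : young_data M.
Local Notation k := (disk_dim (udisks Y)).
Local Notation D := (@unit_disk R k).
Local Notation K := (expR 2 * 4 ^+ k : R).

Lemma disk_detE (w : disk_param (udisks Y)) t n : D t ->
  disk_det f g w t n = vol g (iter n f \o disk_map w) t / vol g (disk_map w) t.
Proof. by move=> Dt; rewrite (vol_iter g hf n (disk_embedding w) Dt). Qed.

Lemma disk_det_gt0 (w : disk_param (udisks Y)) t n : D t -> 0 < disk_det f g w t n.
Proof.
move=> Dt; rewrite disk_detE// divr_gt0//.
  exact: (embedding_vol_gt0 g (iter_embedding hf n (disk_embedding w))).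
exact: (embedding_vol_gt0 g (disk_embedding w)).
Qed.

(** [A] is parametrized both by [disk_map w'] and by [iter n f \o disk_map w]. The two areas agree
    up to [K], and the density of the second is [disk_det] times that of [disk_map w]. *)
Lemma transfer (w w' : disk_param (udisks Y)) n (A : set M) (lo hi : R) :
  disk w' `<=` iter n f @` disk w -> measurable (A : set (borel M)) ->
  A `<=` disk w' -> 0 <= lo -> 0 <= hi ->
  (forall t, D t -> A (iter n f (disk_map w t)) -> lo <= disk_det f g w t n <= hi) ->
  (disk_area g w' A <= (K * hi)%:E * disk_area g w (iter n f @^-1` A))%E /\
  (lo%:E * disk_area g w (iter n f @^-1` A) <= K%:E * disk_area g w' A)%E.
Proof.
move=> sub mA Aw lo0 hi0 H.
have sub' : disk_map w' @` D `<=` (iter n f \o disk_map w) @` D.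
  by move=> x /sub [y [t Dt <-] <-]; exists t.
have [h1 h2] := area_reparam g (iter_embedding hf n (disk_embedding w))
  (disk_embedding w') sub' mA Aw.
have mA' := iter_measurable hf n mA.
have mE := embedding_preim_measurable (disk_embedding w) mA'.
have ED : D `&` disk_map w @^-1` (iter n f @^-1` A) `<=` D by move=> t [].
have mv := measurable_funS (measurable_unit_disk (R := R) (k := k)) ED
  (embedding_vol_measurable g (disk_embedding w)).
have mvn := measurable_funS (measurable_unit_disk (R := R) (k := k)) ED
  (embedding_vol_measurable g (iter_embedding hf n (disk_embedding w))).
have v0 t : D t -> 0 < vol g (disk_map w) t by exact: (embedding_vol_gt0 g (disk_embedding w)).
have vn0 t : D t -> 0 < vol g (iter n f \o disk_map w) t.
  exact: (embedding_vol_gt0 g (iter_embedding hf n (disk_embedding w))).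
have vE t : D t -> vol g (iter n f \o disk_map w) t = disk_det f g w t n * vol g (disk_map w) t.
  by move=> Dt; rewrite disk_detE// divfK// gt_eqF// v0.
have mv' : measurable_fun (D `&` disk_map w @^-1` (iter n f @^-1` A) : set (borel 'rV[R]_k))
    (fun t => (vol g (disk_map w) t)%:E) by apply/measurable_EFinP; exact: mv.
have mvn' : measurable_fun (D `&` disk_map w @^-1` (iter n f @^-1` A) : set (borel 'rV[R]_k))
    (fun t => (vol g (iter n f \o disk_map w) t)%:E) by apply/measurable_EFinP; exact: mvn.
have v0' t : (D `&` disk_map w @^-1` (iter n f @^-1` A)) t ->
    (0 <= (vol g (disk_map w) t)%:E)%E.
  by move=> [Dt _]; rewrite lee_fin; exact: ltW (v0 _ Dt).
have up : (area g (iter n f \o disk_map w) A <= hi%:E * disk_area g w (iter n f @^-1` A))%E.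
  rewrite /disk_area /area -(ge0_integralZl_EFin _ mE v0' mv' hi0).
  apply: ge0_le_integral.
  - exact: mE.
  - by move=> t [Dt _]; rewrite lee_fin; exact: ltW (vn0 _ Dt).
  - exact: mvn'.
  - exact: (measurable_funeM hi%:E mv').
  - move=> t [Dt At]; rewrite -EFinM lee_fin (vE _ Dt).
    by apply: ler_wpM2r; [exact: ltW (v0 _ Dt)|have /andP[] := H _ Dt At].
have lw : (lo%:E * disk_area g w (iter n f @^-1` A) <= area g (iter n f \o disk_map w) A)%E.
  rewrite /disk_area /area -(ge0_integralZl_EFin _ mE v0' mv' lo0).
  apply: ge0_le_integral.
  - exact: mE.
  - move=> t [Dt _]; rewrite -EFinM lee_fin.
    by apply: mulr_ge0; [exact: lo0|exact: ltW (v0 _ Dt)].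
  - exact: (measurable_funeM lo%:E mv').
  - exact: mvn'.
  - move=> t [Dt At]; rewrite -EFinM lee_fin (vE _ Dt).
    by apply: ler_wpM2r; [exact: ltW (v0 _ Dt)|have /andP[] := H _ Dt At].
split; last exact: le_trans lw h1.
apply: (le_trans h2); rewrite (EFinM K hi) -muleA; apply: lee_wpmul2l; last exact: up.
by rewrite lee_fin.
Qed.

Lemma disk_det_bounded (w : disk_param (udisks Y)) n :
  exists2 b, 0 < b & forall t, D t -> disk_det f g w t n <= b.
Proof.
pose q t := vol g (iter n f \o disk_map w) t / vol g (disk_map w) t.
have cq : {within D, continuous q}.
  apply: continuous_in_subspaceT => t /set_mem Dt.
  apply: continuousM.
    exact: (embedding_vol_cont (iter_embedding hf n (disk_embedding w)) Dt).
  apply: continuousV; last exact: (embedding_vol_cont (disk_embedding w) Dt).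
  by rewrite gt_eqF// (embedding_vol_gt0 g (disk_embedding w)).
have [B [_ HB]] := compact_bounded (continuous_compact cq (@unit_disk_compact R k)).
exists (`|B| + 1); first by rewrite ltr_wpDl.
move=> t Dt; rewrite disk_detE//; apply: le_trans (ler_norm _) _.
apply: (HB (`|B| + 1)); last by exists t.
by rewrite (le_lt_trans (ler_norm _))// ltrDl.
Qed.

End Transfer.

(** * Young structures *)

Section Young.
Context {R : realType} {m : nat} (M : manifold R m) (g : riemannian_metric M).
Variables (f : M -> M) (Y : young_data M) (C b : R).
Hypothesis hY : young_structure f Y g C b.
Local Notation S := (sdisks Y).
Local Notation U := (udisks Y).
Local Notation k := (disk_dim U).
Local Notation D := (@unit_disk R k).
Local Notation bs := (base Y).
Local Notation L := (disk_area g).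

Lemma young_C0 : 0 < C. Proof. by have [[]] := hY. Qed.
Lemma young_b0 : 0 < b. Proof. by have [[_ /andP[]]] := hY. Qed.
Lemma young_b1 : b < 1. Proof. by have [[_ /andP[]]] := hY. Qed.

Lemma young_base_product : product_structure bs S U.
Proof. by have [[]] := hY. Qed.

Lemma compact_borel (A : set M) : compact A -> measurable (A : set (borel M)).
Proof.
move=> cA; apply: measurable_borel_closed.
by apply: compact_closed => //; exact: mpoint_hausdorff.
Qed.

Lemma disk_borel (F : disk_family M) (w : disk_param F) :
  measurable (disk w : set (borel M)).
Proof.
apply: compact_borel; rewrite /disk.
by apply: (embedding_compact (disk_embedding w)) => //; exact: unit_disk_closed.
Qed.

Lemma disk_unique (F : disk_family M) (w w' : disk_param F) x :
  disk w x -> disk w' x -> w = w'.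
Proof.
by move=> [t Dt <-] [u Du tu]; have [->] := disk_map_inj Du Dt tu.
Qed.

Lemma leaf_disk (F : disk_family M) (w : disk_param F) x y :
  disk w x -> leaf F x y -> disk w y.
Proof. by move=> wx [w' [w'x w'y]]; rewrite (disk_unique wx w'x). Qed.

Lemma leaf_sym (F : disk_family M) x y : leaf F x y -> leaf F y x.
Proof. by move=> [w [wx wy]]; exists w. Qed.

Lemma base_borel : measurable (bs : set (borel M)).
Proof. by have [c _ _ _] := young_base_product; exact: compact_borel. Qed.

Lemma base_sdisk x : bs x -> exists w : disk_param S, disk w x.
Proof. by have [_ -> _ _] := young_base_product; move=> [[w _ wx] _]; exists w. Qed.

Lemma base_udisk x : bs x -> exists w : disk_param U, disk w x.
Proof. by have [_ -> _ _] := young_base_product; move=> [_ [w _ wx]]; exists w. Qed.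

Lemma base_meet x (w : disk_param U) : bs x ->
  exists y, [/\ leaf S x y, disk w y & bs y].
Proof.
move=> bx; have [a ax] := base_sdisk bx.
have [_ bE _ H] := young_base_product; have [z [[az wz] _]] := H a w.
by exists z; split => //; [exists a|rewrite bE; split; [exists a|exists w]].
Qed.

Definition s_saturated (A : set M) : Prop :=
  forall x y, A x -> bs y -> leaf S x y -> A y.

(** The holonomy of a disk to itself is the identity, so the total mass in (Y5) is the measure of
    the base on that disk. *)
Lemma disk_area_base (w : disk_param U) : ((C^-1)%:E <= L w bs <= C%:E)%E.
Proof.
have [_ [_ _ _ _ /(_ w w) [rho [mrho rho0 H1 H2 _]]]] := hY.
have := H1 setT (@measurableT _ (borel M)).
rewrite setTI.
have -> : holonomy_preimage w w setT = disk w `&` bs.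
  apply/seteqP; split => x; first by move=> [wx bx _].
  move=> [wx bx]; split => //; exists x; split => //.
  by have [a ax] := base_sdisk bx; exists a.
rewrite disk_lebE; last by apply: measurableI; [exact: disk_borel|exact: base_borel].
by rewrite disk_areaI => ->.
Qed.

Lemma sep_pow_le1 s : sep_pow b s <= 1.
Proof.
by case: s => [n|] //=; rewrite exprn_ile1// ?(ltW young_b0) ?(ltW young_b1).
Qed.

(** For a saturated set the holonomy preimage is a mere intersection, so [L w A] is the integral of
    [rho] over [A] on [w']. The bound on logarithms makes [rho] constant up to [expR C], its
    integral is at most [C] and the base has mass at least [1 / C]; hence
    [rho <= expR C * C ^+ 2]. *)
Lemma sat_compare (w w' : disk_param U) (A : set M) :
  measurable (A : set (borel M)) -> A `<=` bs -> s_saturated A ->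
  (L w A <= (expR C * C ^+ 2)%:E * L w' A)%E.
Proof.
move=> mA Ab sA.
have [_ [_ _ _ _ /(_ w w') [rho [mrho rho0 H1 /andP[_ H2] H3]]]] := hY.
have C0 := young_C0.
have hol : holonomy_preimage w w' A = disk w `&` A.
  apply/seteqP; split => x.
    by move=> [wx bx [y [xy w'y Ay]]]; split => //; exact: sA Ay bx (leaf_sym xy).
  move=> [wx Ax]; split => //; first exact: Ab.
  have [y [xy w'y by_]] := base_meet w' (Ab _ Ax).
  by exists y; split => //; exact: sA Ax by_ xy.
have e1 := H1 A mA; rewrite hol disk_lebE in e1; last first.
  by apply: measurableI => //; exact: disk_borel.
rewrite disk_areaI in e1; rewrite e1.
have rle x y : (disk w' `&` bs) x -> (disk w' `&` bs) y -> rho x <= expR C * rho y.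
  move=> wx wy; have [w'x bx] := wx; have [w'y by_] := wy.
  have rx := rho0 _ w'x bx; have ry := rho0 _ w'y by_.
  rewrite -ler_pdivrMr// -[leLHS]lnK ?posrE ?divr_gt0// ler_expR.
  apply: le_trans (H3 _ _ wx wy) _.
  by rewrite -[leRHS]mulr1 ler_wpM2l ?(ltW C0)// sep_pow_le1.
pose E B := D `&` disk_map w' @^-1` B.
have eP := disk_embedding w'.
have mE B : measurable (B : set (borel M)) -> measurable (E B : set (borel 'rV[R]_k)).
  exact: embedding_preim_measurable.
have ED B : E B `<=` D by move=> t [].
have mvol B : measurable (B : set (borel M)) ->
    measurable_fun (E B : set (borel 'rV[R]_k)) (fun t => (vol g (disk_map w') t)%:E).
  move=> mB; apply/measurable_EFinP.
  exact: (measurable_funS (measurable_unit_disk (k := k)) (ED B)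
    (embedding_vol_measurable g eP)).
have vol0 t : D t -> 0 < vol g (disk_map w') t by exact: (embedding_vol_gt0 g eP).
have intE B : measurable (B : set (borel M)) -> B `<=` bs ->
    disk_integral g w' (fun x => (\1_B x * rho x)%:E) =
    (\int[lebrow k]_(t in E B) (vol g (disk_map w') t * rho (disk_map w' t))%:E)%E.
  move=> mB Bb; rewrite disk_integralE; last 2 first.
  - by apply/measurable_EFinP; apply: measurable_funM => //; exact: measurable_indic.
  - move=> x w'x; rewrite lee_fin indicE; case: (boolP (x \in B)) => [/set_mem Bx|_].
      by rewrite mul1r ltW// rho0//; exact: Bb.
    by rewrite mul0r.
  rewrite integral_mkcondr; apply: eq_integral => t _; rewrite /patch indicE.
  have -> : (disk_map w' t \in B) = (t \in disk_map w' @^-1` B) by apply/idP/idP; rewrite !inE.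
  by case: ifP => _; rewrite ?mul1r ?mul0r ?mule0// EFinM.
have mrv B : measurable (B : set (borel M)) ->
    measurable_fun (E B : set (borel 'rV[R]_k))
      (fun t => (vol g (disk_map w') t * rho (disk_map w' t))%:E).
  move=> mB; apply/measurable_EFinP; apply: measurable_funM.
    by have /measurable_EFinP := mvol B mB.
  have mphi := measurable_funS (measurable_unit_disk (k := k)) (ED B) (embedding_measurable eP).
  exact: (measurable_comp measurableT (@subsetT _ _) mrho mphi).
rewrite setIidl// intE//.
have mbs := base_borel.
have rbound x : (disk w' `&` bs) x -> rho x <= expR C * C ^+ 2.
  move=> wx; have [w'x bx] := wx; have rx := rho0 _ w'x bx.
  have : ((rho x)%:E * L w' bs <= (expR C)%:E * C%:E)%E.
    apply: (@le_trans _ _ ((expR C)%:E * disk_integral g w' (fun x => (\1_bs x * rho x)%:E))%E).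
      rewrite intE//.
      have r0 t : E bs t -> (0 <= (vol g (disk_map w') t * rho (disk_map w' t))%:E)%E.
        move=> [Dt bt]; rewrite lee_fin mulr_ge0//; first exact: ltW (vol0 _ Dt).
        by apply: ltW; apply: rho0 => //; exists t.
      have v0 t : E bs t -> (0 <= (vol g (disk_map w') t)%:E)%E.
        by move=> [Dt _]; rewrite lee_fin; exact: ltW (vol0 _ Dt).
      rewrite -(ge0_integralZl_EFin _ (mE _ mbs) r0 (mrv _ mbs) (expR_ge0 C)).
      rewrite /disk_area /area -(ge0_integralZl_EFin _ (mE _ mbs) v0 (mvol _ mbs) (ltW rx)).
      apply: ge0_le_integral.
      - exact: mE.
      - by move=> t Et; apply: mule_ge0; [rewrite lee_fin ltW|exact: v0].
      - exact: (measurable_funeM _ (mvol _ mbs)).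
      - exact: (measurable_funeM _ (mrv _ mbs)).
      - move=> t [Dt bt]; rewrite -!EFinM lee_fin mulrC mulrCA.
        by apply: ler_wpM2l; [exact: ltW (vol0 _ Dt)|apply: rle => //; split => //; exists t].
    by apply: lee_wpmul2l H2; rewrite lee_fin expR_ge0.
  have /andP[lb _] := disk_area_base w'.
  move=> h; have : ((rho x)%:E * (C^-1)%:E <= (expR C)%:E * C%:E)%E.
    by apply: le_trans h; apply: lee_wpmul2l lb; rewrite lee_fin ltW.
  by rewrite -!EFinM lee_fin ler_pdivrMr// expr2 mulrA.
have eC0 : 0 <= expR C * C ^+ 2 by rewrite mulr_ge0// ?expR_ge0// sqr_ge0.
have v0 t : E A t -> (0 <= (vol g (disk_map w') t)%:E)%E.
  by move=> [Dt _]; rewrite lee_fin; exact: ltW (vol0 _ Dt).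
rewrite /disk_area /area -(ge0_integralZl_EFin _ (mE _ mA) v0 (mvol _ mA) eC0).
apply: ge0_le_integral.
- exact: mE.
- move=> t [Dt At]; rewrite lee_fin mulr_ge0//; first exact: ltW (vol0 _ Dt).
  by apply: ltW; apply: rho0; [exists t|exact: Ab].
- exact: mrv.
- exact: (measurable_funeM _ (mvol _ mA)).
- move=> t [Dt At]; rewrite -!EFinM lee_fin mulrC.
  apply: ler_wpM2r; first exact: ltW (vol0 _ Dt).
  by apply: rbound; split; [exists t|exact: Ab].
Qed.

Lemma young_markov : Y1_markov f Y g.
Proof. by have [_ []] := hY. Qed.

Lemma piece_uniq i j x : piece_index Y i -> piece_index Y j ->
  piece Y i x -> piece Y j x -> i = j.
Proof.
by have [tr _ _ _] := young_markov; move=> Ii Ij ix jx; apply: (tr i j) => //; exists x.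
Qed.

Lemma piece_base i : piece_index Y i -> piece Y i `<=` bs.
Proof. by have [_ H _ _] := young_markov; move=> /H []. Qed.

Lemma piece_borel i : piece_index Y i -> measurable (piece Y i : set (borel M)).
Proof.
have [_ H _ _] := young_markov.
by move=> /H [_ [F0 _ [c _ _ _]]]; exact: compact_borel.
Qed.

(** An s-subset keeps or discards the whole trace of a stable disk. *)
Lemma piece_sat i : piece_index Y i -> s_saturated (piece Y i).
Proof.
have [_ H _ _] := young_markov; move=> /H [_ [F0 sF [_ pE _ _]]] x y.
rewrite pE => -[[w0 _ w0x] _] bsy xy.
split; last by have [w wy] := base_udisk bsy; exists w.
exists w0 => //; have [w wE] := sF w0; rewrite wE in w0x *.
exact: leaf_disk xy.
Qed.

Lemma recurrenceE i x : piece_index Y i -> piece Y i x -> recurrence Y x = ret_time Y i.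
Proof.
move=> Ii ix; rewrite /recurrence; case: xgetP => [j _ [Ij jx]|/(_ i)].
  by rewrite (piece_uniq Ii Ij ix jx).
by case.
Qed.

Lemma return_mapE i x : piece_index Y i -> piece Y i x ->
  return_map f Y x = iter (ret_time Y i) f x.
Proof. by move=> Ii ix; rewrite /return_map (recurrenceE Ii ix). Qed.

Lemma return_base i x : piece_index Y i -> piece Y i x -> bs (iter (ret_time Y i) f x).
Proof.
have [_ _ _ H] := young_markov.
by move=> Ii ix; have [_ [sub _] _] := H _ Ii; apply: sub; exists x.
Qed.

Lemma return_leaf i x y : piece_index Y i -> piece Y i x -> leaf S x y ->
  leaf S (iter (ret_time Y i) f x) (iter (ret_time Y i) f y).
Proof.
have [_ _ _ H] := young_markov.
by move=> Ii ix xy; have [_ _ /(_ x ix) [sub _]] := H _ Ii; apply: sub; exists y.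
Qed.

End Young.

(** * Cylinders and bounded distortion *)

(** An infinite family would contain more disjoint sets of mass [c] than [mu E] can hold. *)
Lemma finite_disjoint_mass d (T : measurableType d) (R : realType)
    (mu : {measure set T -> \bar R}) (I : pointedType) (G : set I) (B : I -> set T)
    (E : set T) (c : R) :
  measurable E -> (mu E < +oo)%E -> 0 < c ->
  (forall i, G i -> measurable (B i)) -> (forall i, G i -> B i `<=` E) ->
  trivIset G B -> (forall i, G i -> (c%:E <= mu (B i))%E) -> finite_set G.
Proof.
move=> mE Eoo c0 mB BE tB cB; apply: contrapT => /infiniteP /pcard_leP [h].
have hG n : G (h n) by apply: funS.
have hinj : injective h by move=> x y; apply: inj; rewrite inE.
have Efin : mu E \is a fin_num by rewrite ge0_fin_numE.
pose n := (Num.trunc (fine (mu E) / c)).+1.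
have le_n : ((n%:R * c)%:E <= mu E)%E.
  apply: (@le_trans _ _ (mu (\big[setU/set0]_(i < n) B (h i)))).
    rewrite measure_bigsetU_ord; last 2 first.
    - by move=> i; exact/mB/hG.
    - apply/trivIsetP => i j _ _ ij; move/trivIsetP : tB => /(_ (h i) (h j) (hG _) (hG _)).
      by apply; apply: contra ij => /eqP /hinj /val_inj ->.
    apply: (@le_trans _ _ (\sum_(i < n) c%:E)%E); last by apply: lee_sum => i _; exact/cB/hG.
    by rewrite sumEFin sumr_const card_ord mulr_natl.
  apply: le_measure; rewrite ?inE//; first by apply: bigsetU_measurable => i _; exact/mB/hG.
  rewrite -bigcup_mkord_ord => x [i _ Bx]; exact: BE Bx.
move: le_n; rewrite -(fineK Efin) lee_fin leNgt => /negP; apply.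
by rewrite -ltr_pdivrMr// /n Num.Theory.truncnS_gt.
Qed.

Section Factor.
Context {R : realType} {m : nat} (M : manifold R m) (g : riemannian_metric M).

Lemma tvolume_factor k x (P : 'M[R]_k) (A B : 'M[R]_(k, m)) (T : 'M[R]_m) :
  row_free (A *m T) -> P *m A = B ->
  tvolume g x (B *m T) = `|\det P| * tvolume g x (A *m T).
Proof. by move=> fr <-; rewrite -mulmxA tvolume_mulmx. Qed.

Lemma iter_row_free (f finv : M -> M) (eta : R) (hf : C1_holder_diffeo eta f finv)
    (k n : nat) (Psi : 'rV[R]_k -> M) t : embedding Psi -> unit_disk k t ->
  row_free (param_jac Psi t *m tangent_map (iter n f) (Psi t)).
Proof.
have [_ _ h1 h2] := hf.
have p1 := C1_pres_iter n (C1_pres_holder h1).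
have p2 := C1_pres_iter n (C1_pres_holder h2).
move=> [[U [oU DU CU]] fr inj] Dt.
have E := param_jac_pres p1 oU CU (DU _ Dt).
have H := row_free_pres p1 p2 (@iter_cancel _ _ _ f finv eta hf n) oU CU (DU _ Dt) (fr _ Dt).
exact: (eq_ind_r (fun A => row_free A) H E).
Qed.

End Factor.

Section Cylinders.
Context {R : realType} {m : nat} (M : manifold R m) (g : riemannian_metric M).
Variables (f finv : M -> M) (eta : R).
Hypothesis hf : C1_holder_diffeo eta f finv.
Variables (Y : young_data M) (C b : R).
Hypothesis hY : young_structure f Y g C b.
Local Notation U := (udisks Y).
Local Notation k := (disk_dim U).
Local Notation D := (@unit_disk R k).
Local Notation bs := (base Y).
Local Notation BI := (base_inf f Y).
Local Notation ret := (ret_time Y).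
Local Notation F := (return_map f Y).

(** The return map is unfolded into explicit iterates of [f], whose continuity makes cylinders
    Borel. *)
Fixpoint cyl (s : seq nat) : set M :=
  if s is i :: s' then
    [set x | [/\ piece_index Y i, piece Y i x & cyl s' (iter (ret i) f x)]]
  else bs.

Fixpoint time (s : seq nat) : nat := if s is i :: s' then (time s' + ret i)%N else 0%N.

Lemma iter_time i s x : iter (time (i :: s)) f x = iter (time s) f (iter (ret i) f x).
Proof. by rewrite /= iterD. Qed.

Lemma cyl_base s : cyl s `<=` bs.
Proof. by case: s => [//|i s] x [Ii ix _]; exact: (piece_base hY Ii). Qed.

Lemma cyl_borel s : measurable (cyl s : set (borel M)).
Proof.
elim: s => [|i s IH]; first exact: (base_borel hY).
have [Ii|nI] := pselect (piece_index Y i); last first.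
  rewrite (_ : cyl _ = set0); first exact: measurable0.
  by apply/seteqP; split => x // [].
rewrite (_ : cyl _ = piece Y i `&` iter (ret i) f @^-1` cyl s); last first.
  by apply/seteqP; split => x [] //.
by apply: measurableI; [exact: (piece_borel hY)|exact: (iter_measurable hf)].
Qed.

Lemma cyl_sat s : s_saturated Y (cyl s).
Proof.
elim: s => [|i s IH] x y //= [Ii ix sx] by_ xy.
have iy := piece_sat hY Ii ix by_ xy.
split => //; apply: (IH _ _ sx); first exact: (return_base hY).
exact: (return_leaf hY).
Qed.

Lemma cyl_time s x : cyl s x -> iter (size s) F x = iter (time s) f x.
Proof.
elim: s x => [//|i s IH] x [Ii ix sx].
by rewrite iter_time -(IH _ sx) -[size (i :: s)]/(size s).+1 iterSr (return_mapE hY Ii ix).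
Qed.

Lemma cyl_time_base s x : cyl s x -> bs (iter (time s) f x).
Proof. by elim: s x => [//|i s IH] x [Ii ix sx]; rewrite iter_time; exact: IH. Qed.

Lemma cyl_nth s x n : cyl s x -> (n < size s)%N ->
  piece_index Y (nth 0%N s n) /\ piece Y (nth 0%N s n) (iter n F x).
Proof.
elim: s x n => [//|i s IH] x [|n] [Ii ix sx] //= ns.
by rewrite -iterS iterSr (return_mapE hY Ii ix); exact: IH.
Qed.

Lemma cyl_rcons s i x : piece_index Y i ->
  cyl (rcons s i) x <-> cyl s x /\ piece Y i (iter (time s) f x).
Proof.
move=> Ii; elim: s x => [|j s IH] x.
  split; last by move=> [bx ix]; split => //; exact: (return_base hY).
  by move=> [_ ix _]; split => //; exact: (piece_base hY Ii).
rewrite iter_time; split.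
  by move=> [Ij jx] /IH [sx ix]; split => //; split.
by move=> [[Ij jx sx] ix]; split => //; apply/IH.
Qed.

Lemma base_inf_base : BI `<=` bs.
Proof.
move=> x /(_ 1%N 0%N isT) [i Ii ix]; exact: (piece_base hY Ii).
Qed.

Lemma base_inf_return x : BI x -> BI (F x).
Proof. by move=> bx n j jn; rewrite -iterSr; exact: (bx n.+1). Qed.

Lemma base_inf_piece x : BI x -> exists2 i, piece_index Y i & piece Y i x.
Proof. by move=> /(_ 1%N 0%N isT). Qed.

Lemma base_inf_cons i x : piece_index Y i -> piece Y i x ->
  BI (iter (ret i) f x) -> BI x.
Proof.
move=> Ii ix bx n [|j] jn; first by exists i.
rewrite iterSr (return_mapE hY Ii ix); case: n jn => // n jn; exact: (bx n).
Qed.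

Lemma base_inf_iter s x : cyl s x -> BI (iter (time s) f x) <-> BI x.
Proof.
elim: s x => [//|i s IH] x [Ii ix sx]; rewrite iter_time IH//; split.
  exact: base_inf_cons.
by rewrite -(return_mapE hY Ii ix); exact: base_inf_return.
Qed.

Lemma base_inf_cyl n x : BI x -> exists2 s, size s = n & cyl s x.
Proof.
elim: n x => [|n IH] x bx; first by exists [::] => //; exact: base_inf_base.
have [i Ii ix] := base_inf_piece bx.
have [s sn sx] := IH _ (base_inf_return bx).
by exists (i :: s); rewrite /= ?sn//; split => //; rewrite -(return_mapE hY Ii ix).
Qed.

Lemma returns_cyl n x : bs x -> returns f Y n x -> exists2 s, size s = n & cyl s x.
Proof.
elim: n x => [|n IH] x bx rx; first by exists [::].
have [i Ii ix] := rx 0%N isT.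
have rF : returns f Y n (F x) by move=> j jn; rewrite -iterSr; exact: rx.
have bF : bs (F x) by rewrite (return_mapE hY Ii ix); exact: (return_base hY).
have [s sn sx] := IH _ bF rF.
by exists (i :: s); rewrite /= ?sn//; split => //; rewrite -(return_mapE hY Ii ix).
Qed.

(** Pieces are disjoint, so two points with the same itinerary [s] cannot be separated before time
    [size s]. *)
Lemma cyl_sep s x y : cyl s x -> cyl s y -> BI x -> BI y ->
  sep_pow b (sep_time f Y x y) <= b ^+ size s.
Proof.
move=> sx sy bx by_; rewrite /sep_time asboolT//.
case: pselect => [h|] /=; last by rewrite exprn_ge0// ltW// (young_b0 hY).
case: ex_minnP => n /asboolP [i [j [Ii Ij ij ix jy]]] _.
rewrite leNgt; apply/negP => lt_sn.
have ns : (n < size s)%N.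
  rewrite ltnNge; apply/negP => sn; move: lt_sn; rewrite ltNge => /negP; apply.
  by rewrite ler_wiXn2l// ?ltW// ?(young_b0 hY) ?(young_b1 hY).
have [Is isx] := cyl_nth sx ns; have [_ isy] := cyl_nth sy ns.
apply: ij; rewrite (piece_uniq hY Ii Is ix isx).
by rewrite (piece_uniq hY Ij Is jy isy).
Qed.

(* [f^R] may spread a piece of [disk w] over several unstable disks, so the disk
   [w'] reached along [s] is not determined by [s] and [w]. *)
Fixpoint chain (s : seq nat) (w w' : disk_param U) : Prop :=
  if s is i :: s' then
    [/\ piece_index Y i & exists w1, [/\ disk w1 `<=` iter (ret i) f @` disk w,
      forall z, bs z -> disk w1 z -> (iter (ret i) f @` (piece Y i `&` disk w)) z &
      chain s' w1 w']]
  else w = w'.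

Lemma chain_disk s w w' : chain s w w' -> disk w' `<=` iter (time s) f @` disk w.
Proof.
elim: s w => [|i s IH] w; first by move=> -> x wx; exists x.
move=> [Ii [w1 [sub _ /IH sub']]] x /sub' [y /sub [z wz <-] <-].
by exists z; rewrite ?iter_time.
Qed.

(** The surjectivity clause of [chain] places a preimage of the endpoint in the right piece at each
    step, and injectivity of [f] identifies it with the orbit of [x]. *)
Lemma chain_onto s w w' : chain s w w' -> forall x, disk w x ->
  bs (iter (time s) f x) -> disk w' (iter (time s) f x) -> cyl s x.
Proof.
elim: s w => [//|i s IH] w [Ii [w1 [sub onto ch]]] x wx.
rewrite iter_time => bx w'x.
have w1x : disk w1 (iter (ret i) f x).
  have [y w1y yx] := chain_disk ch w'x.
  by rewrite -(iter_inj hf yx).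
have sx := IH _ ch _ w1x bx w'x.
have [y [iy _] yx] := onto _ (cyl_base sx) w1x.
by split => //; rewrite -(iter_inj hf yx).
Qed.

(** The Markov property puts [disk w1] inside the image of [disk w]. For the surjectivity clause,
    the image of the piece is a u-subset: once it meets [disk w1], it contains all base points of
    that disk. *)
Lemma chain_exists s w x : cyl s x -> disk w x ->
  exists2 w', chain s w w' & disk w' (iter (time s) f x).
Proof.
have [_ _ _ H] := young_markov hY.
elim: s w x => [|i s IH] w x; first by move=> bx wx; exists w.
move=> [Ii ix sx] wx; have [_ [_ [F1 subF [_ imE _ _]]] /(_ x ix) [_ leafH]] := H _ Ii.
set z0 := iter (ret i) f x in sx leafH.
have bz0 := cyl_base sx.
have [w1 w1z0] := base_udisk hY bz0.
have w1sub : disk w1 `<=` iter (ret i) f @` disk w.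
  move=> z w1z; have [y xy yz] := leafH z (ex_intro _ w1 (conj w1z0 w1z)).
  by exists y => //; exact: leaf_disk xy.
have [w' ch w'z] := IH _ _ sx w1z0.
exists w'; last by rewrite iter_time.
split => //; exists w1; split => // z bz w1z.
have : (iter (ret i) f @` piece Y i) z0 by exists x.
rewrite imE => -[_ [v _ vz0]]; have [v' vE] := subF v.
have v'w1 : v' = w1 by apply: disk_unique w1z0; rewrite -vE.
have : (iter (ret i) f @` piece Y i) z.
  rewrite imE; split; first by have [a az] := base_sdisk hY bz; exists a.
  by exists v => //; rewrite vE v'w1.
move=> [y iy yz]; exists y => //; split => //.
by have [y' wy' y'z] := w1sub _ w1z; rewrite -yz in y'z; rewrite -(iter_inj hf y'z).
Qed.

(** At the intermediate point, the tangent frames given by [w1] and by the image of [w] differ by an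
    invertible [P], whose determinant cancels in the quotient. *)
Lemma det_chain i s w w1 t t1 : D t -> D t1 ->
  disk w1 `<=` iter (ret i) f @` disk w ->
  iter (ret i) f (disk_map w t) = disk_map w1 t1 ->
  disk_det f g w t (time (i :: s)) =
  disk_det f g w1 t1 (time s) * disk_det f g w t (ret i).
Proof.
move=> Dt Dt1 sub tt1.
pose P1 := iter (ret i) f \o disk_map w.
have e1 : embedding P1 := iter_embedding hf (ret i) (disk_embedding w).
have e2 := disk_embedding w1.
have sub' : disk_map w1 @` D `<=` P1 @` D.
  by move=> x /sub [y [r Dr <-] <-]; exists r.
have [P Pu PA] := embedding_factor e1 e2 sub' Dt Dt1 tt1.
have v1 : vol g (disk_map w1) t1 = `|\det P| * vol g P1 t.
  have [_ fr _] := e1.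
  have h := tvolume_mulmx g (P1 t) P (fr _ Dt).
  have h2 : tvolume g (P1 t) (param_jac (disk_map w1) t1) = `|\det P| * vol g P1 t :=
    eq_ind _ (fun A => tvolume g (P1 t) A = `|\det P| * vol g P1 t) h _ PA.
  exact: (eq_ind _ (fun x => tvolume g x (param_jac (disk_map w1) t1) = _) h2 _ tt1).
have v2 : vol g (iter (time s) f \o disk_map w1) t1 =
    `|\det P| * vol g (iter (time s) f \o P1) t.
  have fr := iter_row_free hf (time s) e1 Dt.
  have h := tvolume_factor g (iter (time s) f (P1 t)) fr PA.
  have h2 : tvolume g (iter (time s) f (disk_map w1 t1))
     (param_jac (disk_map w1) t1 *m tangent_map (iter (time s) f) (disk_map w1 t1)) =
     `|\det P| * tvolume g (iter (time s) f (P1 t)) (param_jac P1 t *m tangent_map (iter (time s) f) (P1 t)) :=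
    eq_ind _ (fun x => tvolume g (iter (time s) f x)
     (param_jac (disk_map w1) t1 *m tangent_map (iter (time s) f) x) = _) h _ tt1.
  apply: (etrans (vol_iter g hf (time s) e2 Dt1)); apply: (etrans h2).
  by congr (_ * _); exact/esym/(vol_iter g hf (time s) e1 Dt).
have e3 := embedding_vol_gt0 g e1 Dt.
have dP : `|\det P| != 0 by rewrite normr_eq0; move: Pu; rewrite unitmxE unitfE.
have E4 : iter (time (i :: s)) f \o disk_map w = iter (time s) f \o P1.
  by apply/funext => r; rewrite /comp iter_time.
have E1 : disk_det f g w t (time (i :: s)) =
    vol g (iter (time s) f \o P1) t / vol g (disk_map w) t.
  apply: (etrans (disk_detE g hf w _ Dt)).
  exact: (congr1 (fun h => vol g h t / vol g (disk_map w) t) E4).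
have E2 : disk_det f g w t (ret i) = vol g P1 t / vol g (disk_map w) t.
  exact: (disk_detE g hf w (ret i) Dt).
have E3 := disk_detE g hf w1 (time s) Dt1.
rewrite E1 E2 E3 v1 v2; clear - dP e3.
move: e3 dP; set q := vol g P1 t; set d := `|\det P|; set r := vol g (_ \o P1) t.
set p := vol g _ t; clearbody q d r p => q0 d0.
by rewrite -mulf_div divff// mul1r mulrA divfK// gt_eqF.
Qed.

(** Exponential of the geometric series [C * (1 + b + b^2 + ...)]. *)
Definition dist_const : R := expR (C / (1 - b)).

(** (Y4) at a step followed by [j] further common returns costs [C * b ^+ j]. Both points are taken
    in [base_inf] because elsewhere the separation time is set to 0, which would spoil this
    decay. *)
Lemma distortion s w w' t u : chain s w w' -> D t -> D u ->
  cyl s (disk_map w t) -> cyl s (disk_map w u) ->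
  BI (disk_map w t) -> BI (disk_map w u) ->
  disk w' (iter (time s) f (disk_map w t)) -> disk w' (iter (time s) f (disk_map w u)) ->
  disk_det f g w t (time s) <= dist_const * disk_det f g w u (time s).
Proof.
move=> ch Dt Du st su bt bu w't w'u.
have b0 := young_b0 hY; have b1 := young_b1 hY; have C0 := young_C0 hY.
suff H : ln (disk_det f g w t (time s) / disk_det f g w u (time s)) <=
    C * \sum_(j < size s) b ^+ j.
  have dt := disk_det_gt0 g hf w (time s) Dt; have du := disk_det_gt0 g hf w (time s) Du.
  move: dt du H; rewrite /dist_const; clear - b0 b1 C0.
  set p := disk_det _ _ _ _ _; set q := disk_det _ _ _ _ _; clearbody p q => dt du H.
  have q0 : p / q \is Num.pos by rewrite posrE divr_gt0.
  rewrite -ler_pdivrMr// -(lnK q0) ler_expR; apply: (le_trans H).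
  rewrite ler_wpM2l ?(ltW C0)//.
  have b10 : 0 < 1 - b by rewrite subr_gt0.
  rewrite -[leRHS]mul1r ler_pdivlMr//.
  have := subrX1 b (size s); have : 0 <= b ^+ size s by rewrite exprn_ge0// ltW.
  by set X := b ^+ _; set Z := \sum_(j < _) _; move=> *; lra.
elim: s w t u ch Dt Du st su bt bu w't w'u => [|i s IH] w t u.
  move=> _ Dt Du _ _ _ _ _ _; rewrite big_ord0 mulr0.
  have det0 v : D v -> disk_det f g w v 0 = 1.
    move=> Dv; rewrite (disk_detE g hf w 0 Dv); apply: divff.
    by rewrite gt_eqF// (embedding_vol_gt0 g (disk_embedding w)).
  by rewrite /time (det0 _ Dt) (det0 _ Du) divr1 ln1.
move=> [Ii [w1 [sub onto ch]]] Dt Du [_ it st] [_ iu su] bt bu.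
rewrite !iter_time => w't w'u.
have toD x : disk w' (iter (time s) f x) -> disk w1 x.
  by move=> w'x; have [y w1y yx] := chain_disk ch w'x; rewrite -(iter_inj hf yx).
have [t1 Dt1 t1E] := toD _ w't; have [u1 Du1 u1E] := toD _ w'u.
have bt1 : BI (disk_map w1 t1) by rewrite t1E -(return_mapE hY Ii it); exact: base_inf_return.
have bu1 : BI (disk_map w1 u1) by rewrite u1E -(return_mapE hY Ii iu); exact: base_inf_return.
rewrite (det_chain s Dt Dt1 sub (esym t1E)) (det_chain s Du Du1 sub (esym u1E)).
have [p1 p2] := (disk_det_gt0 g hf w1 (time s) Dt1, disk_det_gt0 g hf w1 (time s) Du1).
have [p3 p4] := (disk_det_gt0 g hf w (ret i) Dt, disk_det_gt0 g hf w (ret i) Du).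
rewrite -mulf_div lnM ?posrE; [|exact: divr_gt0 p1 p2|exact: divr_gt0 p3 p4].
rewrite big_ord_recr /= mulrDr; apply: lerD.
  by apply: IH => //; rewrite ?t1E ?u1E.
have [_ [_ _ _ Y4 _]] := hY.
apply: le_trans (Y4 i w t u Ii Dt Du it iu) _.
rewrite ler_wpM2l ?(ltW C0)//; rewrite (return_mapE hY Ii it) (return_mapE hY Ii iu).
by apply: cyl_sep => //; rewrite -?t1E -?u1E.
Qed.

End Cylinders.

(** * Mass of cylinders *)

Section Lower.
Context {R : realType} {m : nat} (M : manifold R m) (g : riemannian_metric M).
Variables (f finv : M -> M) (eta : R).
Hypothesis hf : C1_holder_diffeo eta f finv.
Variable Y : young_data M.
Local Notation k := (disk_dim (udisks Y)).
Local Notation D := (@unit_disk R k).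

Lemma disk_det_bounded_below (w : disk_param (udisks Y)) n :
  exists2 c, 0 < c & forall t, D t -> c <= disk_det f g w t n.
Proof.
pose q t := vol g (disk_map w) t / vol g (iter n f \o disk_map w) t.
have e1 := disk_embedding w; have e2 := iter_embedding hf n e1.
have cq : {within D, continuous q}.
  apply: continuous_in_subspaceT => t /set_mem Dt.
  apply: continuousM; first exact: (embedding_vol_cont e1 Dt).
  apply: continuousV; last exact: (embedding_vol_cont e2 Dt).
  by rewrite gt_eqF// (embedding_vol_gt0 g e2).
have [B [_ HB]] := compact_bounded (continuous_compact cq (@unit_disk_compact R k)).
exists (`|B| + 1)^-1; first by rewrite invr_gt0.
move=> t Dt.
have v1 := embedding_vol_gt0 g e1 Dt; have v2 := embedding_vol_gt0 g e2 Dt.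
have qB : q t <= `|B| + 1.
  apply: le_trans (ler_norm _) _.
  apply: (HB (`|B| + 1)); last by exists t.
  by rewrite (le_lt_trans (ler_norm _))// ltrDl.
rewrite (disk_detE g hf w n Dt); move: v1 v2 qB; rewrite /q.
set p := vol g (disk_map w) t; set r := vol _ _ _; clearbody p r => v1 v2 qB.
by rewrite ler_pdivlMr// mulrC ler_pdivrMr// mulrC -ler_pdivrMr.
Qed.

End Lower.

(** * Branches of the iterated return map and the mass of cylinders *)

Section Mass.
Context {R : realType} {m : nat} (M : manifold R m) (g : riemannian_metric M).
Variables (f finv : M -> M) (eta : R).
Hypothesis hf : C1_holder_diffeo eta f finv.
Variables (Y : young_data M) (C b : R).
Hypothesis hY : young_structure f Y g C b.
Local Notation U := (udisks Y).
Local Notation k := (disk_dim U).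
Local Notation D := (@unit_disk R k).
Local Notation bs := (base Y).
Local Notation BI := (base_inf f Y).
Local Notation L := (disk_area g).
Local Notation K := (expR 2 * 4 ^+ k : R).
Local Notation cyl := (cyl f Y).
Local Notation time := (time Y).
Local Notation chain := (chain f).

Let K0 : 0 < K. Proof. by rewrite mulr_gt0 ?expR_gt0// exprn_gt0. Qed.

Lemma disk_area_sub (w : disk_param U) (A : set M) : measurable (A : set (borel M)) ->
  A `<=` bs -> (L w A <= C%:E)%E.
Proof.
move=> mA Ab; have /andP[_ h] := disk_area_base hY w; apply: (le_trans _ h).
by apply: (le_measure (disk_area g w)); rewrite ?inE//; exact: (base_borel hY).
Qed.

(** Distinct terminal disks are disjoint, and so are their preimages in [w]. The base has mass at
    least [1 / C] on each of them and the determinant along [s] is at most [B] on [w], so each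
    preimage has mass at least [C^-1 / (K * B)]. *)
Lemma chain_finite s (w : disk_param U) : finite_set (chain s w).
Proof.
have mb := base_borel hY.
have [B B0 HB] := disk_det_bounded g hf w (time s).
have C0 := young_C0 hY.
pose X (w' : disk_param U) := disk w `&` (iter (time s) f @^-1` (bs `&` disk w')).
have mX w' : measurable (X w' : set (borel M)).
  apply: measurableI; first exact: disk_borel.
  by apply: (iter_measurable hf); apply: measurableI => //; exact: disk_borel.
have c0 : 0 < C^-1 / (K * B) by rewrite divr_gt0 ?invr_gt0// mulr_gt0.
apply: (@finite_disjoint_mass _ (borel M) R (disk_area g w) (disk_param U) _ X bs
   (C^-1 / (K * B))).
- exact: mb.
- by rewrite (@le_lt_trans _ _ C%:E) ?ltry//; exact: disk_area_sub.
- exact: c0.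
- by move=> w' _; exact: mX.
- by move=> w' ch x [wx [bx w'x]]; exact: (cyl_base hY (chain_onto hf hY ch wx bx w'x)).
- apply/trivIsetP => u v _ _ uv; rewrite -subset0 => x [[_ [_ ux]] [_ [_ vx]]].
  by move/eqP: uv; apply; exact: disk_unique ux vx.
- move=> w' ch.
  have [h _] := transfer hf (chain_disk ch)
    (measurableI _ _ mb (disk_borel w')) (@subIsetr _ _ _) (lexx 0) (ltW B0)
    (fun t Dt _ => introT andP (conj (ltW (disk_det_gt0 g hf w (time s) Dt)) (HB t Dt))).
  have /andP[h1 _] := disk_area_base hY w'.
  move: h; rewrite setIC disk_areaI => h; have {h1}h := le_trans h1 h.
  have e : L w (X w') = L w (iter (time s) f @^-1` (disk w' `&` bs)).
    by rewrite /X disk_areaI setIC.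
  rewrite -[leRHS]/(L w (X w')) e.
  have KB0 : 0 < K * B by exact: mulr_gt0.
  by rewrite EFinM muleC lee_pdivrMl.
Qed.

Lemma disk_area_cyl s (w : disk_param U) (E : set M) : measurable (E : set (borel M)) ->
  E `<=` cyl s ->
  L w E = (\sum_(w' \in chain s w) L w (E `&` iter (time s) f @^-1` disk w'))%E.
Proof.
move=> mE Es.
rewrite -disk_areaI.
have -> : disk w `&` E = \bigcup_(w' in chain s w)
    (disk w `&` (E `&` iter (time s) f @^-1` disk w')).
  apply/seteqP; split => x.
    by move=> [wx Ex]; have [w' ch w'x] := chain_exists hf hY (Es _ Ex) wx; exists w'.
  by move=> [w' _ [wx [Ex _]]].
rewrite (measure_fin_bigcup (disk_area g w)).
- by apply: eq_fsbigr => w' _; exact: disk_areaI.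
- exact: chain_finite.
- apply/trivIsetP => u v _ _ uv; rewrite -subset0 => x [[_ [_ ux]] [_ [_ vx]]].
  by move/eqP: uv; apply; exact: disk_unique ux vx.
- move=> w' _; apply: measurableI; first exact: disk_borel.
  by apply: measurableI => //; apply: (iter_measurable hf); exact: disk_borel.
Qed.

(** A qualitative fact: the positive lower bound on the determinant may depend on [s] and [w]. *)
Lemma chain_null s (w w' : disk_param U) (A : set M) : chain s w w' ->
  measurable (A : set (borel M)) -> A `<=` disk w' -> L w' A = 0%E ->
  L w (iter (time s) f @^-1` A) = 0%E.
Proof.
move=> ch mA Aw A0.
have [B B0 HB] := disk_det_bounded g hf w (time s).
have [c c0 Hc] := disk_det_bounded_below g hf w (time s).
have [_ h] := transfer hf (chain_disk ch) mA Aw (ltW c0) (ltW B0)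
    (fun t Dt _ => introT andP (conj (Hc t Dt) (HB t Dt))).
move: h; rewrite A0 mule0 => h.
apply/eqP; rewrite eq_le measure_ge0 andbT.
by move: h; rewrite -lee_pdivlMl// mule0.
Qed.

Lemma pieces_borel : measurable (pieces Y : set (borel M)).
Proof.
rewrite /pieces bigcup_mkcond; apply: bigcup_measurable => i _.
by case: ifPn => // /set_mem Ii; exact: (piece_borel hY).
Qed.

(** The points whose itinerary stops exactly after [s]. As there are countably many [s], removing
    these sets from the base exhibits [base_inf] as Borel and of full measure. *)
Definition escape (s : seq nat) : set M :=
  cyl s `&` iter (time s) f @^-1` (bs `\` pieces Y).

Lemma escape_borel s : measurable (escape s : set (borel M)).
Proof.
apply: measurableI; first exact: (cyl_borel hf hY).
apply: (iter_measurable hf); apply: measurableD; first exact: (base_borel hY).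
exact: pieces_borel.
Qed.

Lemma base_infE : BI = bs `\` \bigcup_n \bigcup_(s in [set s | unpickle n = Some s]) escape s.
Proof.
apply/seteqP; split => x.
  move=> bx; split; first exact: (base_inf_base hY).
  move=> [n _ [s _ [sx [_]]]]; apply.
  rewrite -(cyl_time hY sx); exact: (bx (size s).+1).
move=> [bx nx]; elim => [//|n IH] j; rewrite ltnS leq_eqVlt => /orP[/eqP ->|]; last exact: IH.
have [s sn sx] := returns_cyl hY bx IH.
rewrite -sn (cyl_time hY sx); apply: contrapT => np; apply: nx.
exists (pickle s) => //; exists s; first exact: pickleK.
by split => //; split => //; exact: (cyl_time_base sx).
Qed.

Lemma escapes_borel :
  measurable (\bigcup_n \bigcup_(s in [set s | unpickle n = Some s]) escape s : set (borel M)).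
Proof.
apply: bigcup_measurable => n _; case: (unpickle n) => [s|].
  rewrite (_ : \bigcup_(_ in _) _ = escape s); first exact: escape_borel.
  by apply/seteqP; split => x; [move=> [_ [<-]]|exists s].
rewrite (_ : \bigcup_(_ in _) _ = set0); first exact: measurable0.
by apply/seteqP; split => x // [].
Qed.

Lemma base_inf_borel : measurable (BI : set (borel M)).
Proof. by rewrite base_infE; apply: measurableD; [exact: (base_borel hY)|exact: escapes_borel]. Qed.

(** (Y1) makes the complement of the pieces null on each terminal disk, and nullity is pulled back
    along the finitely many branches. *)
Lemma escape_null s (w : disk_param U) : L w (escape s) = 0%E.
Proof.
have mb := base_borel hY; have mp := pieces_borel.
rewrite (@disk_area_cyl s) //; last 2 first.
- exact: escape_borel.
- by move=> x [].
apply: fsbig1 => w' ch.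
have h : L w (iter (time s) f @^-1` (disk w' `&` (bs `\` pieces Y))) = 0%E.
  apply: (chain_null ch).
  - by apply: measurableI; [exact: disk_borel|exact: measurableD].
  - by move=> x [].
  - rewrite disk_areaI; have [_ _ /(_ w') h _] := young_markov hY.
    by rewrite disk_lebE in h; last exact: measurableD.
apply: (subset_measure0 (mu := disk_area g w)) h.
- apply: measurableI; first exact: escape_borel.
  by apply: (iter_measurable hf); exact: disk_borel.
- apply: (iter_measurable hf).
  by apply: measurableI; [exact: disk_borel|exact: measurableD].
- by move=> x [[_ px] w'x].
Qed.

Lemma base_inf_null (w : disk_param U) : L w (bs `\` BI) = 0%E.
Proof.
rewrite base_infE setDD.
have me := escapes_borel; have mb := base_borel hY.
pose e n := \bigcup_(s in [set s | unpickle n = Some s]) escape s.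
have me' n : measurable (e n : set (borel M)) /\ L w (e n) = 0%E.
  rewrite /e; case: (unpickle n) => [s|].
    rewrite (_ : \bigcup_(_ in _) _ = escape s).
      by split; [exact: escape_borel|exact: escape_null].
    by apply/seteqP; split => x; [move=> [_ [<-]]|exists s].
  rewrite (_ : \bigcup_(_ in _) _ = set0); first by split; [exact: measurable0|exact: measure0].
  by apply/seteqP; split => x // [].
have h : L w (\bigcup_n e n) = 0%E.
  apply/(measure_negligible me)/negligible_bigcup => n.
  by have [m1 m0] := me' n; apply/negligibleP.
apply: (subset_measure0 (mu := disk_area g w)) h => //.
exact: measurableI.
Qed.

Lemma disk_area_base_inf (w : disk_param U) (A : set M) : measurable (A : set (borel M)) ->
  A `<=` bs -> L w (A `&` BI) = L w A.
Proof.
move=> mA Ab; have mBI := base_inf_borel.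
have mA1 : measurable (A `&` BI : set (borel M)) by exact: measurableI.
have mA2 : measurable (A `\` BI : set (borel M)) by exact: measurableD.
apply/eqP; rewrite eq_le; apply/andP; split.
  by apply: (le_measure (disk_area g w)); rewrite ?inE//; exact: subIsetl.
have h : L w (A `\` BI) = 0%E.
  apply: (subset_measure0 (mu := disk_area g w)) (base_inf_null w) => //.
    by apply: measurableD => //; exact: (base_borel hY).
  by move=> x [/Ab bx nx].
have hU : (L w A = L w (A `&` BI) + L w (A `\` BI))%E.
  rewrite -{1}(setUIDK A BI); apply: (measureU (disk_area g w) mA1 mA2).
  by rewrite -subset0 => x [[_ ?] []].
by rewrite hU h adde0.
Qed.

(** Three losses: the holonomy from [w] to [w']; the transfer, with distortion, of the part in
    [piece Y i]; and the transfer, with distortion, of the whole branch, whose mass on [w'] is at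
    most [C]. *)
Definition mult_const : R :=
  expR C * C ^+ 2 * (K * dist_const C b) * (K * C * dist_const C b).

Lemma mult_const_gt0 : 0 < mult_const.
Proof.
have C0 := young_C0 hY; rewrite /mult_const /dist_const.
by rewrite !mulr_gt0// ?expR_gt0// ?exprn_gt0.
Qed.

(* The branch of [f^N] over one disk [w'] has bounded distortion, so there the
   proportion of [piece Y i] is comparable before and after applying [f^N]. *)
Lemma chain_mult s i (w w' : disk_param U) : chain s w w' -> piece_index Y i ->
  (L w (piece Y i) * L w (iter (time s) f @^-1` (BI `&` disk w')) <=
   mult_const%:E *
   L w (iter (time s) f @^-1` (BI `&` (piece Y i `&` disk w'))))%E.
Proof.
move=> ch Ii.
have C0 := young_C0 hY; have mBI := base_inf_borel.
have mi := piece_borel hY Ii; have ib := piece_base hY Ii.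
set N := time s; set A2 := BI `&` disk w'; set A1 := BI `&` _.
have mA2 : measurable (A2 : set (borel M)) by apply: measurableI => //; exact: disk_borel.
have mA1 : measurable (A1 : set (borel M)).
  by apply: measurableI => //; apply: measurableI => //; exact: disk_borel.
have A12 : A1 `<=` A2 by move=> x [bx [_ w'x]].
(* The determinant [d0] at a reference point stands for that of the whole branch and cancels in the
   product of the two transfers. With no such point the left side is 0. *)
have [[t0 Dt0 t0A]|none] := pselect (exists2 t0, D t0 & A2 (iter N f (disk_map w t0))); last first.
  have -> : L w (iter N f @^-1` A2) = 0%E.
    rewrite -disk_areaI (_ : _ `&` _ = set0) ?measure0//.
    by rewrite -subset0 => x [[t Dt <-] xA]; apply: none; exists t.
  by rewrite mule0; apply: mule_ge0; [rewrite lee_fin ltW// mult_const_gt0|exact: measure_ge0].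
set d0 := disk_det f g w t0 N; have d00 : 0 < d0 := disk_det_gt0 g hf w N Dt0.
set q := dist_const C b; have q0 : 0 < q by exact: expR_gt0.
have inC t : D t -> A2 (iter N f (disk_map w t)) -> cyl s (disk_map w t) /\ BI (disk_map w t).
  move=> Dt [bt w't].
  have st : cyl s (disk_map w t).
    by apply: (chain_onto hf hY ch) => //; [exists t|exact: (base_inf_base hY)].
  by split => //; apply/(base_inf_iter hY st).
have dd t : D t -> A2 (iter N f (disk_map w t)) ->
    q^-1 * d0 <= disk_det f g w t N <= q * d0.
  move=> Dt tA; have [st bt] := inC t Dt tA; have [st0 bt0] := inC t0 Dt0 t0A.
  have [_ w't] := tA; have [_ w't0] := t0A.
  rewrite (distortion hf hY ch Dt Dt0 st st0 bt bt0 w't w't0) andbT.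
  rewrite mulrC ler_pdivrMr// mulrC.
  exact: (distortion hf hY ch Dt0 Dt st0 st bt0 bt w't0 w't).
have lo0 : 0 <= q^-1 * d0 by rewrite ltW// mulr_gt0// invr_gt0.
have hi0 : 0 <= q * d0 by rewrite ltW// mulr_gt0.
have [h1 _] := transfer hf (chain_disk ch) mA1 (fun x xA => xA.2.2) lo0 hi0
   (fun t Dt tA => dd t Dt (A12 _ tA)).
have [_ h2] := transfer hf (chain_disk ch) mA2 (fun x xA => xA.2) lo0 hi0 dd.
have e1 : L w' A1 = L w' (piece Y i).
  rewrite -(disk_area_base_inf w' mi ib) -[RHS]disk_areaI; congr (L w' _).
  by apply/seteqP; split => x [? [? ?]].
have e2 : (L w' A2 <= C%:E)%E.
  by apply: disk_area_sub => // x [/(base_inf_base hY)].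
have e3 := sat_compare hY w w' mi ib (piece_sat hY Ii).
rewrite -/N in h1 h2.
set x1 := L w _ in h1 *; set x2 := L w _ in h2 *.
have x20 : (0 <= x2)%E by exact: measure_ge0.
have x2f : (x2 <= (K * C * q / d0)%:E)%E.
  have : ((q^-1 * d0)%:E * x2 <= (K * C)%:E)%E.
    by apply: (le_trans h2); rewrite (EFinM K C); apply: lee_wpmul2l => //; rewrite lee_fin ltW.
  rewrite -lee_pdivlMl; last by rewrite mulr_gt0 ?invr_gt0.
  rewrite -EFinM => /le_trans; apply; rewrite lee_fin invfM invrK.
  by rewrite le_eqVlt; apply/orP; left; apply/eqP; ring.
have x1f : (L w (piece Y i) <= (expR C * C ^+ 2 * (K * (q * d0)))%:E * x1)%E.
  apply: (le_trans e3); rewrite (EFinM (expR C * C ^+ 2)) -muleA; apply: lee_wpmul2l.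
    by rewrite lee_fin mulr_ge0 ?expR_ge0// sqr_ge0.
  exact: (eq_ind _ (fun z => (z <= _)%E) h1 _ e1).
apply: (le_trans (lee_pmul (measure_ge0 _ _) x20 x1f x2f)).
rewrite muleAC -EFinM; apply: lee_wpmul2r; first exact: measure_ge0.
rewrite lee_fin /mult_const -/q le_eqVlt; apply/orP; left; apply/eqP.
by field; rewrite gt_eqF.
Qed.

(** The sum of [chain_mult] over the branches; by [chain_onto], points that land in [base_inf] on a
    terminal disk are automatically in the cylinder. *)
Lemma cyl_mult s i (w : disk_param U) : piece_index Y i ->
  (L w (piece Y i) * L w (cyl s) <= mult_const%:E * L w (cyl (rcons s i)))%E.
Proof.
move=> Ii; have mBI := base_inf_borel.
have mc s' := cyl_borel hf hY s'.
rewrite -(disk_area_base_inf w (mc s) (fun x sx => cyl_base hY sx)).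
rewrite -(disk_area_base_inf w (mc (rcons s i)) (fun x sx => cyl_base hY sx)).
rewrite (@disk_area_cyl s w (cyl s `&` BI)); [|exact: measurableI|by move=> x []].
rewrite (@disk_area_cyl s w (cyl (rcons s i) `&` BI)); [|exact: measurableI|]; last first.
  by move=> x [/(cyl_rcons hY _ _ Ii)[]].
rewrite !ge0_mule_fsumr; [|by move=> w'; exact: measure_ge0..].
apply: lee_fsum; first exact: chain_finite.
move=> w' ch.
have E1 : L w (cyl s `&` BI `&` iter (time s) f @^-1` disk w') =
    L w (iter (time s) f @^-1` (BI `&` disk w')).
  rewrite -disk_areaI -[RHS]disk_areaI; congr (L w _); apply/seteqP; split => x.
    by move=> [wx [[sx bx] w'x]]; split => //; split => //; exact/(base_inf_iter hY sx).
  move=> [wx [bx w'x]].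
  have sx := chain_onto hf hY ch wx (base_inf_base hY bx) w'x.
  by split => //; split => //; split => //; exact/(base_inf_iter hY sx).
have E2 : L w (cyl (rcons s i) `&` BI `&` iter (time s) f @^-1` disk w') =
    L w (iter (time s) f @^-1` (BI `&` (piece Y i `&` disk w'))).
  rewrite -disk_areaI -[RHS]disk_areaI; congr (L w _); apply/seteqP; split => x.
    move=> [wx [[/(cyl_rcons hY _ _ Ii)[sx ix] bx] w'x]]; split => //; split => //.
    exact/(base_inf_iter hY sx).
  move=> [wx [bx [ix w'x]]].
  have sx := chain_onto hf hY ch wx (base_inf_base hY bx) w'x.
  split => //; split => //; split; last exact/(base_inf_iter hY sx).
  exact/(cyl_rcons hY _ _ Ii).
by rewrite E1 E2; exact: chain_mult.
Qed.

End Mass.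

(** * Hahn decomposition and approximation on a generated sigma-algebra *)

Section SubMeasure.
Context d (T : measurableType d) (R : realType).
Variables (mu : {measure set T -> \bar R}) (G : set (set T)).
Hypothesis Gm : <<s G >> `<=` measurable.
Hypothesis mufin : (mu setT < +oo)%E.

(** The same set function on the sigma-algebra generated by [G], where the Hahn decomposition is
    taken so that its positive set belongs to that sigma-algebra. *)
Definition submeasure (A : set (g_sigma_algebraType G)) : \bar R := mu A.

Let sub0 : submeasure set0 = 0%E. Proof. exact: measure0. Qed.

Let sub_ge0 A : (0 <= submeasure A)%E. Proof. exact: measure_ge0. Qed.

Let sub_sigma : semi_sigma_additive submeasure.
Proof.
move=> A mA tA mU; apply: (measure_semi_sigma_additive (s := mu)) => //.
  by move=> n; apply: Gm; exact: mA.
by apply: Gm; exact: mU.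
Qed.

HB.instance Definition _ := isMeasure.Build _ _ _ submeasure sub0 sub_ge0 sub_sigma.

Let sub_fin : fin_num_fun submeasure.
Proof.
move=> A mA; rewrite ge0_fin_numE ?sub_ge0//; apply: (le_lt_trans _ mufin).
by apply: le_measure; rewrite ?inE//; exact: Gm.
Qed.

HB.instance Definition _ := @Measure_isFinite.Build _ _ _ submeasure sub_fin.

Lemma submeasure_pack : exists nu : {finite_measure set (g_sigma_algebraType G) -> \bar R},
  (nu : set (g_sigma_algebraType G) -> \bar R) = (mu : set T -> \bar R).
Proof. by exists submeasure. Qed.

End SubMeasure.

Lemma sub_hahn d (T : measurableType d) (R : realType) (mu1 mu2 : {measure set T -> \bar R})
    (G : set (set T)) (c : R) :
  <<s G >> `<=` measurable -> (mu1 setT < +oo)%E -> (mu2 setT < +oo)%E ->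
  exists P, [/\ <<s G >> P,
    forall A, <<s G >> A -> A `<=` P -> (c%:E * mu2 A <= mu1 A)%E &
    forall A, <<s G >> A -> A `<=` ~` P -> (mu1 A <= c%:E * mu2 A)%E].
Proof.
move=> Gm f1 f2.
have [n1 n1E] := submeasure_pack Gm f1; have [n2 n2E] := submeasure_pack Gm f2.
pose nu := cadd (charge_of_finite_measure n1) (cscale (- c) (charge_of_finite_measure n2)).
have nuE A : nu A = (mu1 A - c%:E * mu2 A)%E.
  have e1 : n1 A = mu1 A := congr1 (fun h => h A) n1E.
  have e2 : n2 A = mu2 A := congr1 (fun h => h A) n2E.
  rewrite -mulNe -EFinN -e1 -e2; reflexivity.
have fin A : <<s G >> A -> mu2 A \is a fin_num /\ mu1 A \is a fin_num.
  move=> GA; split; rewrite ge0_fin_numE//.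
    by apply: (le_lt_trans _ f2); apply: le_measure; rewrite ?inE//; exact: Gm.
  by apply: (le_lt_trans _ f1); apply: le_measure; rewrite ?inE//; exact: Gm.
have [P [N [[mP hP] [mN hN] PN PN0]]] := Hahn_decomposition nu.
exists P; split => //.
- move=> A GA AP; have := hP A GA AP; have [a2 a1] := fin A GA.
  by rewrite -[X in (0 <= X)%E]/(nu A) nuE sube_ge0// fin_numM.
- move=> A GA AP; have [a2 a1] := fin A GA.
  have AN : A `<=` N.
    move=> x Ax; have : (P `|` N) x by rewrite PN.
    by move=> [Px|//]; have := AP _ Ax Px.
  by have := hN A GA AN; rewrite -[X in (X <= 0)%E]/(nu A) nuE sube_le0.
Qed.

Section Approximation.
Context d (T : measurableType d) (R : realType).
Variables (mu : {measure set T -> \bar R}) (Cn : nat -> set (set T)).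
Hypothesis mufin : (mu setT < +oo)%E.
Hypothesis Cn0 : forall n, Cn n set0.
Hypothesis CnC : forall n U, Cn n U -> Cn n (~` U).
Hypothesis CnU : forall n U V, Cn n U -> Cn n V -> Cn n (U `|` V).

Definition symdiff (A B : set T) := (A `\` B) `|` (B `\` A).

(** Approximation is asked at every large level, so that two sets can be approximated at a common
    level [n], where [Cn n] is stable under unions. *)
Definition approximable (A : set T) : Prop :=
  forall e : R, 0 < e -> exists n0, forall n, (n0 <= n)%N ->
    exists U, [/\ measurable U, Cn n U & (mu (symdiff A U) < e%:E)%E].

Let msd A B : measurable A -> measurable B -> measurable (symdiff A B).
Proof. by move=> mA mB; apply: measurableU; exact: measurableD. Qed.

Let mu_cover A B C : measurable A -> measurable B -> measurable C ->
  A `<=` B `|` C -> (mu A <= mu B + mu C)%E.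
Proof.
move=> mA mB mC ABC; apply: (le_trans _ (measureU2 mu mB mC)).
by apply: le_measure; rewrite ?inE//; exact: measurableU.
Qed.

Lemma approximable0 : approximable set0.
Proof.
move=> e e0; exists 0%N => n _; exists set0; split => //.
by rewrite /symdiff set0D set0U measure0 lte_fin.
Qed.

Lemma approximableC A : approximable A -> approximable (~` A).
Proof.
move=> H e e0; have [n0 Hn] := H e e0; exists n0 => n /Hn [U [mU CU AU]].
exists (~` U); split; [exact: measurableC|exact: CnC|].
by rewrite /symdiff !setDE !setCK setIC [X in _ `|` X]setIC setUC.
Qed.

Lemma approximableU A B : measurable A -> measurable B ->
  approximable A -> approximable B -> approximable (A `|` B).
Proof.
move=> mA mB HA HB e e0; have e20 : 0 < e / 2 by rewrite divr_gt0.
have [n1 H1] := HA _ e20; have [n2 H2] := HB _ e20.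
exists (maxn n1 n2) => n; rewrite geq_max => /andP[/H1 [U [mU CU AU]] /H2 [V [mV CV BV]]].
exists (U `|` V); split; [exact: measurableU|exact: CnU|].
rewrite [e]splitr EFinD; apply: le_lt_trans (lteD AU BV).
apply: mu_cover; [by apply: msd; exact: measurableU|exact: msd|exact: msd|].
move=> x [[[Ax|Bx] nUV]|[[Ux|Vx] nAB]].
- by left; left; split => // ?; apply: nUV; left.
- by right; left; split => // ?; apply: nUV; right.
- by left; right; split => // ?; apply: nAB; left.
- by right; right; split => // ?; apply: nAB; right.
Qed.

Lemma approximable_lim A : measurable A ->
  (forall e : R, 0 < e -> exists B, [/\ measurable B, approximable B &
     (mu (symdiff A B) < e%:E)%E]) -> approximable A.
Proof.
move=> mA H e e0; have e20 : 0 < e / 2 by rewrite divr_gt0.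
have [B [mB HB AB]] := H _ e20; have [n0 Hn] := HB _ e20.
exists n0 => n /Hn [U [mU CU BU]]; exists U; split => //.
rewrite [e]splitr EFinD; apply: le_lt_trans (lteD AB BU).
apply: mu_cover; [exact: msd..|].
move=> x [[Ax nU]|[Ux nA]]; have [Bx|nB] := pselect (B x).
- by right; left.
- by left; left.
- by left; right.
- by right; right.
Qed.

Lemma approximable_bigcup (A : nat -> set T) : (forall n, measurable (A n)) ->
  (forall n, approximable (A n)) -> approximable (\bigcup_n A n).
Proof.
move=> mA HA.
pose B m := \big[setU/set0]_(i < m) A i.
have mB m : measurable (B m) by apply: bigsetU_measurable.
have HB m : approximable (B m).
  elim: m => [|m IH]; first by rewrite /B big_ord0; exact: approximable0.
  by rewrite /B big_ord_recr /=; apply: approximableU => //; exact: mB.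
have mU : measurable (\bigcup_n A n) by exact: bigcup_measurable.
apply: approximable_lim => // e e0.
have BA m : B m `<=` \bigcup_n A n.
  by rewrite /B -bigcup_mkord => x [i _ Ax]; exists i.
have cv : (mu \o (fun m => (\bigcup_n A n) `\` B m)) @ \oo --> (0 : \bar R)%E.
  rewrite -(measure0 mu).
  have <- : \bigcap_m ((\bigcup_n A n) `\` B m) = set0.
    rewrite -subset0 => x /[dup] /(_ 0%N I) [[n _ Anx] _] /(_ n.+1 I) [_]; apply.
    by rewrite /B -bigcup_mkord; exists n => /=.
  apply: nonincreasing_cvg_mu.
  - apply: (le_lt_trans _ mufin); apply: le_measure; rewrite ?inE//.
    exact: measurableD.
  - by move=> m; exact: measurableD.
  - by apply: bigcap_measurable => // m _; exact: measurableD.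
  - move=> i j ij; apply/subsetPset => x [Ux nB]; split => // Bx; apply: nB.
    move: Bx; rewrite /B -!bigcup_mkord => -[l /= li Al]; exists l => //=.
    exact: leq_trans ij.
have : nbhs (0 : \bar R)%E [set x | (x < e%:E)%E].
  by apply: open_nbhs_nbhs; split; [exact: open_ereal_lt_ereal|rewrite /= lte_fin].
move=> /cv [m _ Hm]; exists (B m); split => //.
have -> : symdiff (\bigcup_n A n) (B m) = (\bigcup_n A n) `\` B m.
  rewrite /symdiff (_ : B m `\` _ = set0) ?setU0//.
  by rewrite -subset0 => x [/BA].
by apply: Hm => /=.
Qed.

Lemma approximable_sigma_algebra :
  sigma_algebra setT [set A | measurable A /\ approximable A].
Proof.
split.
- by split => //; exact: approximable0.
- move=> A [mA HA]; rewrite setTD.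
  by split; [exact: measurableC|exact: approximableC].
- move=> A H; split; first by apply: bigcup_measurable => n _; have [] := H n.
  by apply: approximable_bigcup => n; have [] := H n.
Qed.

End Approximation.

(** * The SRB measure on the base of the tower *)

Section Tower.
Context {R : realType} {m : nat} (M : manifold R m) (g : riemannian_metric M).
Variables (f finv : M -> M) (eta : R).
Hypothesis hf : C1_holder_diffeo eta f finv.
Variables (Y : young_data M) (C b : R).
Hypothesis hY : young_structure f Y g C b.
Variable nu : probability (borel M * nat)%type R.
Hypothesis hnu : srb_measure f Y g nu.
Local Notation U := (udisks Y).
Local Notation bs := (base Y).
Local Notation BI := (base_inf f Y).
Local Notation L := (disk_area g).
Local Notation ret := (ret_time Y).
Local Notation F := (return_map f Y).
Local Notation T := (tower_map f Y).
Local Notation lev A l := ((A : set (borel M)) `*` [set (l : nat)]).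

Lemma level_measurable (A : set M) l : measurable (A : set (borel M)) -> measurable (lev A l).
Proof. by move=> mA; apply: measurableX. Qed.

Lemma tailE n : tail Y n = \bigcup_(i in [set i | piece_index Y i /\ (n < ret i)%N]) piece Y i.
Proof.
apply/seteqP; split => x.
  by move=> [[i Ii ix]]; rewrite (recurrenceE hY Ii ix) => ni; exists i.
move=> [i [Ii ni] ix]; split; first by exists i.
by rewrite (recurrenceE hY Ii ix).
Qed.

Lemma tail_borel n : measurable (tail Y n : set (borel M)).
Proof.
rewrite tailE bigcup_mkcond; apply: bigcup_measurable => i _.
by case: ifPn => [/set_mem [Ii _]|//]; exact: (piece_borel hY).
Qed.

Lemma tail_base n : tail Y n `<=` bs.
Proof. by rewrite tailE => x [i [Ii _] ix]; exact: (piece_base hY Ii). Qed.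

Lemma tail_sat n : s_saturated Y (tail Y n).
Proof.
rewrite tailE => x y [i [Ii ni] ix] by_ xy; exists i => //.
exact: (piece_sat hY Ii ix by_ xy).
Qed.

Lemma base_inf_tail0 : BI `<=` tail Y 0.
Proof.
move=> x /base_inf_piece [i Ii ix]; rewrite tailE; exists i => //; split => //.
by have [_ _ _ /(_ i Ii) []] := young_markov hY.
Qed.

Let mBI : measurable (BI : set (borel M)). Proof. exact: (base_inf_borel hf hY). Qed.

Lemma towerE : tower f Y = \bigcup_l lev (BI `&` tail Y l) l.
Proof.
apply/seteqP; split => -[x n].
  move=> [/= bx nx]; exists n => //; split => //=; split => //.
  by have [px _] := base_inf_tail0 bx.
by move=> [l _ [/= [bx [_ lx]] ->]].
Qed.

Lemma tower_borel : measurable (tower f Y : set (borel M * nat)%type).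
Proof.
rewrite towerE; apply: bigcup_measurable => l _; apply: level_measurable.
by apply: measurableI => //; exact: tail_borel.
Qed.

(** Inside the tower, a level above 0 is entered only from the level below it, so invariance carries
    mass from one level to the next. *)
Lemma nu_level l (A : set M) : measurable (A : set (borel M)) -> A `<=` BI ->
  A `<=` tail Y l -> nu (lev A l) = nu (lev A 0).
Proof.
move=> mA AB; elim: l => [//|l IH] Al.
rewrite -IH; last by move=> x /Al [px lx]; split => //; exact: ltnW.
have [_ inv _] := hnu.
rewrite -(inv (lev A l.+1)); last 2 first.
- exact: level_measurable.
- by move=> [x n] [/= Ax ->]; split => /=; [exact: AB|have [] := Al _ Ax].
congr (nu _); apply/seteqP; split => -[x n].
  move=> [[/= bx nx]]; rewrite /preimage /tower_map /=.
  by case: ifP => [_ [/= Ax [->]]|_ [_ /=]].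
move=> [/= Ax ->]; have [_ lx] := Al _ Ax.
split; first by split => /=; [exact: AB|exact: ltnW].
by rewrite /preimage /tower_map /= lx.
Qed.

Lemma return_preim_borel (B : set M) : measurable (B : set (borel M)) ->
  measurable (BI `&` F @^-1` B : set (borel M)).
Proof.
move=> mB.
have -> : BI `&` F @^-1` B =
    \bigcup_i (if i \in piece_index Y then BI `&` piece Y i `&` iter (ret i) f @^-1` B else set0).
  apply/seteqP; split => x.
    move=> [bx Bx]; have [i Ii ix] := base_inf_piece bx; exists i => //.
    by rewrite mem_set//; split => //; rewrite /preimage /= -(return_mapE hY Ii ix).
  move=> [i _]; case: ifPn => [/set_mem Ii [[bx ix] Bx]|//].
  by split => //; rewrite /preimage /= (return_mapE hY Ii ix).
apply: bigcup_measurable => i _; case: ifPn => [/set_mem Ii|//].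
apply: measurableI; last exact: (iter_measurable hf).
by apply: measurableI => //; exact: (piece_borel hY).
Qed.

(** The tower preimage of [B] at level 0 consists of the tops of the columns that return into [B];
    [nu_level] lowers each top to the base, where together they form the preimage under the return
    map. *)
Lemma nu_return (B : set M) : measurable (B : set (borel M)) -> B `<=` BI ->
  nu (lev (BI `&` F @^-1` B) 0) = nu (lev B 0).
Proof.
move=> mB BB; have [_ inv _] := hnu.
rewrite -(inv (lev B 0)); last 2 first.
- exact: level_measurable.
- move=> [x n] [/= Bx ->]; split => /=; first exact: BB.
  by have [] := base_inf_tail0 (BB _ Bx).
(* Return time exactly [l + 1], so that [l] is the top level of the column. *)
pose E l := BI `&` F @^-1` B `&` (tail Y l `\` tail Y l.+1).
have mE l : measurable (E l : set (borel M)).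
  apply: measurableI; first exact: return_preim_borel.
  by apply: measurableD; exact: tail_borel.
have ElR l x : E l x -> recurrence Y x = l.+1.
  move=> [_ [[px lx] nl]]; apply/eqP; rewrite eqn_leq lx andbT leqNgt.
  by apply/negP => l2; apply: nl.
have e1 : tower f Y `&` T @^-1` lev B 0 = \bigcup_l lev (E l) l.
  apply/seteqP; split => -[x n].
    move=> [[/= bx nx]]; rewrite /preimage /tower_map /=; case: ifPn => [_ [_ //]|].
    rewrite -leqNgt => xn [/= Bx _]; exists n => //; split => //=; split => //.
    have [px _] := base_inf_tail0 bx.
    by split => //; move=> [_]; rewrite ltnNge xn.
  move=> [l _ [/= El ->]]; have xl := ElR _ _ El; have [[bx Bx] _] := El.
  split; first by split => //=; rewrite xl.
  by rewrite /preimage /tower_map /= xl ltnn.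
have e2 : lev (BI `&` F @^-1` B) 0 = \bigcup_l lev (E l) 0.
  apply/seteqP; split => -[x n].
    move=> [/= [bx Bx] ->]; have [px x0] := base_inf_tail0 bx.
    exists (recurrence Y x).-1 => //; split => //=; split => //; split.
      by split => //; rewrite prednK.
    by move=> [_]; rewrite prednK// ltnn.
  by move=> [l _ [/= [BB' _] ->]]; split.
rewrite e1 e2 !measure_semi_bigcup.
- apply: eq_eseriesr => l _; apply/esym; apply: nu_level => //.
    by move=> x [[]].
  by move=> x [_ []].
- by move=> l; exact: level_measurable.
- apply/trivIsetP => i j _ _ ij; rewrite -subset0 => -[x n] [[/= Ei ->] [/= _ nij]].
  by move/eqP: ij; apply.
- by apply: bigcup_measurable => l _; exact: level_measurable.
- by move=> l; exact: level_measurable.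
- apply/trivIsetP => i j _ _ ij; rewrite -subset0 => -[x n] [[/= Ei _] [/= Ej _]].
  by move/eqP: ij; apply; have := ElR _ _ Ei; rewrite (ElR _ _ Ej) => -[].
- by apply: bigcup_measurable => l _; exact: level_measurable.
Qed.

(** Every level is a copy of a part of the base, so a null base would make the whole tower null. *)
Lemma nu_base_inf : (0 < nu (lev BI 0))%E.
Proof.
rewrite lt0e measure_ge0 andbT; apply/eqP => h.
have [h1 _ _] := hnu.
have mE l : measurable (BI `&` tail Y l : set (borel M)).
  by apply: measurableI => //; exact: tail_borel.
have : nu (tower f Y) = 0%E.
  rewrite towerE; apply/negligibleP.
    by apply: bigcup_measurable => l _; exact: level_measurable.
  apply: negligible_bigcup => l; apply/negligibleP; first exact: level_measurable.
  apply: (etrans (nu_level (mE l) (@subIsetl _ _ _) (@subIsetr _ _ _))).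
  apply: (subset_measure0 (mu := nu)) h; [exact: level_measurable..|].
  by move=> [x n] [/= [bx _] ->].
by rewrite h1 => /eqP; rewrite onee_eq0.
Qed.

Definition itinerary n i : set M := [set x | BI x /\ piece Y i (iter n F x)].

Lemma itineraryS n i : itinerary n.+1 i = BI `&` F @^-1` itinerary n i.
Proof.
apply/seteqP; split => x.
  by move=> [bx]; rewrite iterSr => h; split => //; split => //; exact: base_inf_return.
by move=> [bx [_ h]]; split => //; rewrite iterSr.
Qed.

Lemma itinerary_borel n i : piece_index Y i -> measurable (itinerary n i : set (borel M)).
Proof.
move=> Ii; elim: n => [|n IH]; last by rewrite itineraryS; exact: return_preim_borel.
by apply: (@measurableI _ (borel M)) => //; exact: (piece_borel hY).
Qed.

Lemma nu_itinerary n i : piece_index Y i ->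
  nu (lev (itinerary n i) 0) = nu (lev (itinerary 0 i) 0).
Proof.
move=> Ii; elim: n => [//|n IH]; rewrite -IH itineraryS; apply: nu_return.
  exact: itinerary_borel.
by move=> x [].
Qed.

Lemma nu_ac (A : set M) : measurable (A : set (borel M)) ->
  (forall w : disk_param U, L w A = 0%E) -> nu (lev A 0) = 0%E.
Proof.
move=> mA A0; have [_ _ [q [k /(_ 0%N) [kE kae]]]] := hnu.
rewrite kE//.
transitivity (\int[q 0%N]_(w in setT) (0 : \bar R))%E; last by rewrite integral0.
apply: ae_eq_integral => //; first exact: measurable_kernel.
apply: filterS kae => w [_ H] _; apply: H => //.
by rewrite disk_lebE.
Qed.

End Tower.

(** * Lower bound for the SRB mass of the pieces on the base *)

Section Density.
Context {R : realType} {m : nat} (M : manifold R m) (g : riemannian_metric M).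
Variables (f finv : M -> M) (eta : R).
Hypothesis hf : C1_holder_diffeo eta f finv.
Variables (Y : young_data M) (C b : R).
Hypothesis hY : young_structure f Y g C b.
Variable nu : probability (borel M * nat)%type R.
Hypothesis hnu : srb_measure f Y g nu.
Variable a : disk_param (udisks Y).
Local Notation bs := (base Y).
Local Notation BI := (base_inf f Y).
Local Notation L := (disk_area g).
Local Notation lev A l := ((A : set (borel M)) `*` [set (l : nat)]).
Local Notation cyl := (cyl f Y).
Local Notation Q := (mult_const Y C b).

Let mBI : measurable (BI : set (borel M)). Proof. exact: (base_inf_borel hf hY). Qed.

Definition level0_mass (A : set (borel M)) : \bar R := nu (lev (A `&` BI) 0).

Let mass0 : level0_mass set0 = 0%E.
Proof. by rewrite /level0_mass set0I set0X measure0. Qed.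

Let mass_ge0 A : (0 <= level0_mass A)%E. Proof. exact: measure_ge0. Qed.

Let mass_sigma : semi_sigma_additive level0_mass.
Proof.
move=> A mA tA mU; rewrite /level0_mass.
have -> : lev (\bigcup_n A n `&` BI) 0 = \bigcup_n lev (A n `&` BI) 0.
  apply/seteqP; split => -[x n].
    by move=> [/= [[j _ Ax] bx] ->]; exists j.
  by move=> [j _ [/= [Ax bx] ->]]; split => //=; split => //; exists j.
have ml n : measurable (lev (A n `&` BI) 0).
  by apply: level_measurable; apply: measurableI.
apply: (measure_semi_sigma_additive (s := nu)) => //.
- apply/trivIsetP => i j _ _ ij; move/trivIsetP : tA => /(_ i j I I ij) e.
  rewrite -subset0 => -[x n] [[/= [Ai _] _] [/= [Aj _] _]].
  by have : (A i `&` A j) x by []; rewrite e.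
- exact: bigcup_measurable.
Qed.

HB.instance Definition _ := isMeasure.Build _ _ _ level0_mass mass0 mass_ge0 mass_sigma.

Local Notation mL := (mrestr (disk_area g a) mBI).

(** On [base_inf] the cylinders of length [n] form a partition, and [V] is to be a union of its
    classes there; the family is stable under complements. *)
Definition ncyl (n : nat) (V : set M) : Prop := forall s x y, size s = n ->
  cyl s x -> cyl s y -> BI x -> BI y -> V x -> V y.

Lemma cyl_refine s0 s x z : (size s0 <= size s)%N -> cyl s x -> cyl s z ->
  cyl s0 z -> cyl s0 x.
Proof.
elim: s0 s x z => [|i s0 IH] s x z.
  by move=> _ sx _ _; exact: (cyl_base hY sx).
case: s => [//|j s] /=; rewrite ltnS => le_s [Ij jx sx] [_ jz sz] [Ii iz s0z].
have ij := piece_uniq hY Ii Ij iz jz; rewrite -{}ij in Ij jx sx jz sz.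
by split => //; exact: IH sz s0z.
Qed.

Lemma cyl_inj s s' x : size s = size s' -> cyl s x -> cyl s' x -> s = s'.
Proof.
elim: s s' x => [|i s IH] [|j s'] x //= [ss] [Ii ix sx] [Ij jx s'x].
have ij := piece_uniq hY Ii Ij ix jx; rewrite -{}ij in Ij jx s'x *.
by congr (_ :: _); exact: IH sx s'x.
Qed.

Lemma gen_borel : <<s range cyl >> `<=` (@measurable _ (borel M)).
Proof.
apply: smallest_sub; first exact: sigma_algebra_measurable.
by move=> _ [s _ <-]; exact: (cyl_borel hf hY).
Qed.

Lemma mLfin : (mL setT < +oo)%E.
Proof.
rewrite /mrestr setTI; apply: le_lt_trans (ltry C).
by apply: (disk_area_sub hY) => //; exact: (base_inf_base hY).
Qed.

(** A cylinder is a union of longer cylinders on [base_inf], so it is its own approximation at every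
    level beyond its length; the rest is stability under the sigma-algebra operations. *)
Lemma gen_approx A : <<s range cyl >> A -> approximable mL ncyl A.
Proof.
have S := @approximable_sigma_algebra _ (borel M) R mL ncyl mLfin.
have {}S : sigma_algebra setT
    [set A | measurable (A : set (borel M)) /\ approximable mL ncyl A].
  apply: S.
  - by move=> n s x y.
  - by move=> n V CV s x y sn sx sy bx by_ nx Vy; apply: nx; exact: CV sn sy sx by_ bx Vy.
  - move=> n V W CV CW s x y sn sx sy bx by_ [Vx|Wx].
      by left; exact: CV sn sx sy bx by_ Vx.
    by right; exact: CW sn sx sy bx by_ Wx.
move=> /(smallest_sub S) [] // _ [s _ <-]; split; first exact: (cyl_borel hf hY).
move=> e e0; exists (size s) => n sn; exists (cyl s); split.
- exact: (cyl_borel hf hY).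
- by move=> s' x y s'n s'x s'y _ _ sx; apply: (cyl_refine _ s'y s'x sx); rewrite s'n.
- by rewrite /symdiff setDv setU0 measure0 lte_fin.
Qed.

Lemma gen_sat A : <<s range cyl >> A -> s_saturated Y (A `&` bs).
Proof.
have S : sigma_algebra setT [set A | s_saturated Y (A `&` bs)].
  split.
  - by move=> x y [].
  - move=> B SB x y [[_ nB] bx] by_ xy; split => //; split => // By.
    by apply: nB; have [] := SB y x (conj By by_) bx (leaf_sym xy).
  - move=> B SB x y [[n _ Bx] bx] by_ xy; split => //; exists n => //.
    by have [] := SB n x y (conj Bx bx) by_ xy.
have sub : range cyl `<=` [set A | s_saturated Y (A `&` bs)].
  by move=> _ [s _ <-] x y [sx bx] by_ xy; split => //; exact: (cyl_sat hY sx by_ xy).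
exact: (smallest_sub S sub).
Qed.

Definition next_piece n i : set M := \bigcup_(s in [set s | size s = n]) cyl (rcons s i).

Let unp (G : seq nat -> set M) (j : nat) : set M := if pickle_inv j is Some s then G s else set0.

Let unpE (G : seq nat -> set M) (A : set (seq nat)) :
  \bigcup_(s in A) G s = \bigcup_j unp (fun s => if s \in A then G s else set0) j.
Proof.
apply/seteqP; split => x.
  by move=> [s As Gx]; exists (pickle s) => //; rewrite /unp pickleK_inv mem_set.
move=> [j _]; rewrite /unp; case: (pickle_inv j) => [s|//].
by case: ifPn => // /set_mem As Gx; exists s.
Qed.

Lemma next_piece_gen n i : <<s range cyl >> (next_piece n i).
Proof.
have [G0 _ GU] := smallest_sigma_algebra setT (range cyl).
rewrite /next_piece unpE; apply: GU => j; rewrite /unp; case: (pickle_inv j) => [s|//].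
by case: ifPn => // _; apply: sub_sigma_algebra; exists (rcons s i).
Qed.

Lemma next_piece_itinerary n i : piece_index Y i ->
  next_piece n i `&` BI `<=` itinerary f Y n i.
Proof.
move=> Ii x [[s sn /(cyl_rcons hY _ _ Ii) [sx ix]] bx]; split => //.
by rewrite -sn (cyl_time hY sx).
Qed.

(* The mass of an [ncyl] set is spread over whole cylinders, and inside each of
   these the set returning to [piece Y i] keeps a fixed proportion. *)
Lemma ncyl_mult n i (V : set M) : piece_index Y i -> measurable (V : set (borel M)) ->
  ncyl n V -> (L a (piece Y i) * mL V <= Q%:E * mL (V `&` next_piece n i))%E.
Proof.
move=> Ii mV CV; have mc s := cyl_borel hf hY s.
pose A : set (seq nat) := [set s | size s = n /\ exists x, [/\ cyl s x, BI x & V x]].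
pose c j := unp (fun s => if s \in A then cyl s else set0) j.
pose c' j := unp (fun s => if s \in A then cyl (rcons s i) else set0) j.
have mcc j : measurable (c j : set (borel M)).
  by rewrite /c /unp; case: (pickle_inv j) => [s|]; [case: ifP => _|].
have mcc' j : measurable (c' j : set (borel M)).
  by rewrite /c' /unp; case: (pickle_inv j) => [s|]; [case: ifP => _|].
have cc j : c' j `<=` c j.
  rewrite /c' /c /unp; case: (pickle_inv j) => [s|//]; case: ifP => [_ x|_ x //].
  by move=> /(cyl_rcons hY _ _ Ii) [].
have tc : trivIset setT c.
  apply/trivIsetP => j1 j2 _ _ j12; rewrite -subset0 => z [].
  rewrite /c /unp.
  have := pickle_invK (T := seq nat) j1; have := pickle_invK (T := seq nat) j2.
  case: (pickle_inv j1) => [s1|//]; case: (pickle_inv j2) => [s2|//] /= p2 p1.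
  case: ifPn => // /set_mem [n1 _] h1; case: ifPn => // /set_mem [n2 _] h2.
  by move/eqP: j12; apply; rewrite -p1 -p2 (cyl_inj _ h1 h2)// n1 n2.
have tc' : trivIset setT c'.
  apply/trivIsetP => i1 i2 _ _ i12; move/trivIsetP : tc => /(_ i1 i2 I I i12) e.
  rewrite -subset0 => z [z1 z2]; have h1 := cc _ _ z1; have h2 := cc _ _ z2.
  by have : (c i1 `&` c i2) z by []; rewrite e.
have fi : L a (piece Y i) \is a fin_num.
  rewrite ge0_fin_numE ?measure_ge0//; apply: le_lt_trans (ltry C).
  by apply: (disk_area_sub hY); [exact: (piece_borel hY)|exact: (piece_base hY)].
have e1 : mL V = mL (\bigcup_j c j).
  rewrite /mrestr; congr (L a _); rewrite -unpE; apply/seteqP; split => x.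
    move=> [Vx bx]; split => //; have [s sn sx] := base_inf_cyl hY n bx.
    by exists s => //; split => //; exists x.
  move=> [[s [sn [y [sy by_ Vy]]] sx] bx]; split => //.
  exact: CV sn sy sx by_ bx Vy.
have le2 : (mL (\bigcup_j c' j) <= mL (V `&` next_piece n i))%E.
  have mn : measurable (next_piece n i : set (borel M)).
    by apply: gen_borel; exact: next_piece_gen.
  rewrite /mrestr; apply: (le_measure (disk_area g a)); rewrite ?inE.
  - by apply: measurableI => //; exact: bigcup_measurable.
  - by apply: measurableI => //; exact: measurableI.
  - rewrite -unpE => x [[s [sn [y [sy by_ Vy]]] sx] bx]; split => //; split.
      have [sx' _] := (cyl_rcons hY _ _ Ii).1 sx.
      exact: CV sn sy sx' by_ bx Vy.
    by exists s.
apply: le_trans (lee_wpmul2l _ le2); last by rewrite lee_fin ltW// (mult_const_gt0 hY).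
rewrite e1 -(fineK fi) !measure_semi_bigcup //; try exact: bigcup_measurable.
rewrite -!nneseriesZl; [|by move=> j _; exact: measure_ge0..].
apply: lee_nneseries => j _.
  by move=> _; apply: mule_ge0; [rewrite lee_fin fine_ge0// measure_ge0|exact: measure_ge0].
rewrite fineK// /c /c' /unp; case: (pickle_inv j) => [s|]; last by rewrite !measure0 !mule0.
case: ifP => _; last by rewrite !measure0 !mule0.
have h := cyl_mult hf hY s a Ii.
rewrite -(disk_area_base_inf hf hY a (mc s) (fun z sz => cyl_base hY sz)) in h.
rewrite -(disk_area_base_inf hf hY a (mc (rcons s i)) (fun z sz => cyl_base hY sz)) in h.
exact: h.
Qed.

(** The constant is uniform in [i]: neither [d], nor the mass [h] of the Hahn set, nor [Q] involves
    [i]. The approximation level [n] depends on [i], but disappears because the visits to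
    [piece Y i] at the return number [n] have the same [nu]-mass for all [n]. *)
Lemma piece_density : exists2 c, 0 < c & forall i, piece_index Y i ->
  (c%:E * L a (piece Y i) <= nu (lev (piece Y i `&` BI) 0))%E.
Proof.
have C0 := young_C0 hY; have Q0 := mult_const_gt0 hY.
have fin1 A : measurable (A : set (borel M)) -> level0_mass A \is a fin_num.
  by move=> mA; apply: fin_num_measure; apply: level_measurable; exact: measurableI.
have fin2 A : measurable (A : set (borel M)) -> mL A \is a fin_num.
  move=> mA; rewrite ge0_fin_numE ?measure_ge0//; apply: le_lt_trans mLfin.
  by apply: le_measure; rewrite ?inE.
pose m0 := fine (level0_mass setT).
have m00 : 0 < m0.
  apply: fine_gt0; rewrite -ge0_fin_numE ?measure_ge0// fin1// andbT.
  by rewrite /level0_mass setTI; exact: (nu_base_inf hf hY hnu).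
(* With this threshold the negative part has mass at most [d * C = m0 / 2], so the positive part [P]
   cannot be null for [nu]. *)
pose d := m0 / (2 * C); have d0 : 0 < d by rewrite divr_gt0// mulr_gt0.
have [P [GP hP hN]] := @sub_hahn _ (borel M) R level0_mass mL (range cyl) d gen_borel
  (ltac:(by rewrite -ge0_fin_numE ?measure_ge0// fin1)) mLfin.
have mP := gen_borel GP.
have GC : <<s range cyl >> (~` P).
  have [_ GD _] := smallest_sigma_algebra setT (range cyl).
  by rewrite -setTD; exact: GD.
have mLC A : measurable (A : set (borel M)) -> (mL A <= C%:E)%E.
  move=> mA; apply: (disk_area_sub hY); first exact: measurableI.
  by move=> x [_ /(base_inf_base hY)].
have P0 : (0 < level0_mass P)%E.
  rewrite lt0e measure_ge0 andbT; apply/eqP => h.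
  have hC : (level0_mass (~` P) <= d%:E * mL (~` P))%E := hN _ GC (@subset_refl _ _).
  move: hC; have -> : level0_mass (~` P) = m0%:E.
    rewrite /m0 fineK ?fin1// -(setUv P).
    have -> : level0_mass (P `|` ~` P) = (level0_mass P + level0_mass (~` P))%E.
      by apply: measureU; [|exact: measurableC|rewrite setICr].
    by rewrite h add0e.
  have : (d%:E * mL (~` P) <= (m0 / 2)%:E)%E.
    apply: (@le_trans _ _ (d%:E * C%:E)%E).
      apply: lee_wpmul2l; first by rewrite lee_fin ltW.
      by apply: mLC; exact: measurableC.
    by rewrite -EFinM lee_fin /d le_eqVlt; apply/orP; left; apply/eqP; field; rewrite gt_eqF.
  by move=> h1 h2; have := le_trans h2 h1; rewrite lee_fin; lra.
have mb := base_borel hY.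
(* [P] is saturated on the base: if it were null on [a] it would be null on every unstable disk,
   hence for [nu]. *)
have PL0 : (0 < mL P)%E.
  rewrite lt0e measure_ge0 andbT; apply/eqP => h.
  move: P0; rewrite lt0e => /andP[/eqP + _]; apply.
  apply: (subset_measure0 (mu := nu) (B := lev (P `&` bs) 0)).
  - by apply: level_measurable; exact: measurableI.
  - by apply: level_measurable; exact: measurableI.
  - by move=> [x n] [/= [Px /(base_inf_base hY) bx] ->].
  - apply: (nu_ac hnu); first exact: measurableI.
    move=> w; apply/eqP; rewrite eq_le measure_ge0 andbT.
    apply: (le_trans (sat_compare hY w a (measurableI _ _ mP mb) (@subIsetr _ _ _) (gen_sat GP))).
    have -> : L a (P `&` bs) = 0%E.
      rewrite -(disk_area_base_inf hf hY a (measurableI _ _ mP mb) (@subIsetr _ _ _)).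
      rewrite -setIA [bs `&` BI]setIC (setIidl (base_inf_base hY)); exact: h.
    by rewrite mule0.
pose h := fine (mL P).
have h0 : 0 < h by apply: fine_gt0; rewrite PL0 -ge0_fin_numE ?measure_ge0// fin2.
exists (d * h / Q); first by rewrite divr_gt0// mulr_gt0.
move=> i Ii.
have mi := piece_borel hY Ii.
have fi : L a (piece Y i) \is a fin_num.
  rewrite ge0_fin_numE ?measure_ge0//; apply: le_lt_trans (ltry C).
  by apply: (disk_area_sub hY) => //; exact: (piece_base hY).
have fx : level0_mass (piece Y i) \is a fin_num by exact: fin1.
rewrite -[leRHS]/(level0_mass (piece Y i)) -(fineK fi) -(fineK fx) -EFinM lee_fin.
set l := fine (L a _); set x := fine _.
have l0 : 0 <= l by rewrite fine_ge0 ?measure_ge0.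
have lQ0 : 0 < l / Q + 1 by rewrite ltr_wpDl// divr_ge0// ltW.
apply/ler_addgt0Pr => e e0.
(* The approximation error enters twice, once scaled by [l / Q] and once as it is, and is then
   multiplied by [d]. *)
pose ep := e / (d * (l / Q + 1)).
have ep0 : 0 < ep by rewrite divr_gt0// mulr_gt0.
have [n /(_ n (leqnn _)) [V [mV CV PV]]] := gen_approx GP ep0.
have mW : measurable (next_piece n i : set (borel M)) by apply: gen_borel; exact: next_piece_gen.
have mPW : measurable (P `&` next_piece n i : set (borel M)) by exact: measurableI.
have mVW : measurable (V `&` next_piece n i : set (borel M)) by exact: measurableI.
have msd : measurable (symdiff P V : set (borel M)).
  by apply: measurableU; exact: measurableD.
have step1 : (d%:E * mL (P `&` next_piece n i) <= x%:E)%E.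
  have GPW : <<s range cyl >> (P `&` next_piece n i).
    have mG : @measurable _ (g_sigma_algebraType (range cyl)) (P `&` next_piece n i).
      by apply: measurableI; [exact: GP|exact: next_piece_gen].
    exact: mG.
  apply: le_trans (hP _ GPW (@subIsetl _ _ _)) _.
  rewrite /x fineK//; rewrite /level0_mass.
  have e2 : piece Y i `&` BI = itinerary f Y 0 i by apply/seteqP; split => z [].
  rewrite e2 -(nu_itinerary hf hY hnu n Ii).
  apply: le_measure; rewrite ?inE.
  - by apply: level_measurable; exact: measurableI.
  - by apply: level_measurable; exact: (itinerary_borel hf hY).
  - move=> [z j] [/= [[Pz Wz] bz] ->]; split => //=.
    exact: (next_piece_itinerary Ii).
have cover A B D : measurable (A : set (borel M)) -> measurable (B : set (borel M)) ->
    measurable (D : set (borel M)) -> A `<=` B `|` D -> (mL A <= mL B + mL D)%E.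
  move=> mA mB mD ABD; apply: (le_trans _ (measureU2 mL mB mD)).
  by apply: le_measure; rewrite ?inE//; exact: measurableU.
have step2 : (mL (V `&` next_piece n i) <= mL (P `&` next_piece n i) + mL (symdiff P V))%E.
  apply: cover => // z [Vz Wz]; have [Pz|nP] := pselect (P z); first by left.
  by right; right.
have step3 := ncyl_mult Ii mV CV.
have step4 : (mL P <= mL V + mL (symdiff P V))%E.
  apply: cover => // z Pz; have [Vz|nV] := pselect (V z); first by left.
  by right; left.
have step5 : fine (mL (symdiff P V)) < ep by rewrite -lte_fin (fineK (fin2 _ msd)); exact: PV.
move: step1 step2 step3 step4 step5; clear PV.
rewrite -(fineK (fin2 _ mPW)) -(fineK (fin2 _ mVW)) -(fineK (fin2 _ msd)).
rewrite -(fineK (fin2 _ mV)) -(fineK (fin2 _ mP)) -(fineK fi) -/h -/l.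
rewrite -!EFinD -!EFinM !lee_fin.
set p := fine (mL (P `&` _)); set v := fine (mL (V `&` _)); set u := fine (mL V).
set t := fine (mL (symdiff P V)) => s1 s2 s3 s4 s5.
have hu : h - ep <= u by rewrite lerBlDr (le_trans s4)// lerD2l ltW.
have vp : v - ep <= p by rewrite lerBlDr (le_trans s2)// lerD2l ltW.
have lu : l / Q * (h - ep) <= v.
  rewrite mulrAC ler_pdivrMr// [v * Q]mulrC.
  by apply: le_trans s3; apply: ler_wpM2l.
have epE : d * ((l / Q + 1) * ep) = e.
  by rewrite /ep mulrA mulrC divfK// gt_eqF// mulr_gt0.
have : d * (l / Q * (h - ep) - ep) <= x.
  by apply: le_trans s1; apply: ler_wpM2l; [exact: ltW|exact: le_trans (lerB lu (lexx _)) vp].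
move=> s6.
have -> : d * h / Q * l = d * (l / Q * (h - ep) - ep) + d * ((l / Q + 1) * ep) by ring.
by rewrite epE lerD2r.
Qed.

End Density.

(** * Correlations *)

Section Correlation.
Context {R : realType} {m : nat} (M : manifold R m) (g : riemannian_metric M).
Variables (f finv : M -> M) (eta : R).
Hypothesis hf : C1_holder_diffeo eta f finv.
Variables (Y : young_data M) (C b : R).
Hypothesis hY : young_structure f Y g C b.
Variable nu : probability (borel M * nat)%type R.
Hypothesis hnu : srb_measure f Y g nu.
Local Notation U := (udisks Y).
Local Notation BI := (base_inf f Y).
Local Notation L := (disk_area g).
Local Notation T := (tower_map f Y).
Local Notation lev A l := ((A : set (borel M)) `*` [set (l : nat)]).

Let mBI : measurable (BI : set (borel M)). Proof. exact: (base_inf_borel hf hY). Qed.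

(** Tails are disjoint unions of pieces and are saturated: the bound is summed over pieces on one
    disk and carried to the others by holonomy. *)
Lemma tail_density : exists2 c, 0 < c & forall (w : disk_param U) n,
  (c%:E * L w (tail Y n) <= nu (lev (tail Y n `&` BI) 0))%E.
Proof.
pose a : disk_param U := point.
have [c c0 Hc] := piece_density hf hY hnu a.
have C0 := young_C0 hY.
have K0 : 0 < expR C * C ^+ 2 by rewrite mulr_gt0 ?expR_gt0// exprn_gt0.
exists (c / (expR C * C ^+ 2)); first by rewrite divr_gt0.
move=> w n; have mt := tail_borel hY n.
apply: (@le_trans _ _ (c%:E * L a (tail Y n))%E).
  rewrite EFinM -muleA; apply: lee_wpmul2l; first by rewrite lee_fin ltW.
  rewrite lee_pdivrMl//; apply: (sat_compare hY) => //; first exact: (tail_base hY).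
  exact: (tail_sat hY).
pose A i := if i \in [set i | piece_index Y i /\ (n < ret_time Y i)%N] then piece Y i else set0.
have mA i : measurable (A i : set (borel M)).
  by rewrite /A; case: ifPn => [/set_mem [Ii _]|//]; exact: (piece_borel hY).
have tA : trivIset setT A.
  apply/trivIsetP => i j _ _ ij; rewrite -subset0 => x []; rewrite /A.
  case: ifPn => // /set_mem [Ii _] ix; case: ifPn => // /set_mem [Ij _] jx.
  by move/eqP: ij; apply; exact: (piece_uniq hY Ii Ij ix jx).
have tE : tail Y n = \bigcup_i A i by rewrite (tailE hY) bigcup_mkcond.
have lE : lev (tail Y n `&` BI) 0 = \bigcup_i lev (A i `&` BI) 0.
  rewrite tE; apply/seteqP; split => -[x l].
    by move=> [/= [[i _ ix] bx] ->]; exists i.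
  by move=> [i _ [/= [ix bx] ->]]; split => //=; split => //; exists i.
have ml i : measurable (lev (A i `&` BI) 0) by apply: level_measurable; exact: measurableI.
rewrite lE measure_semi_bigcup//; last 2 first.
- apply/trivIsetP => i j _ _ ij; move/trivIsetP : tA => /(_ i j I I ij) e.
  rewrite -subset0 => -[x l] [[/= [ix _] _] [/= [jx _] _]].
  by have : (A i `&` A j) x by []; rewrite e.
- exact: bigcup_measurable.
rewrite tE (measure_semi_bigcup (disk_area g a) mA tA); last exact: bigcup_measurable.
rewrite -nneseriesZl; last by move=> i _; exact: measure_ge0.
apply: lee_nneseries => i _.
  by move=> _; apply: mule_ge0; [rewrite lee_fin ltW|exact: measure_ge0].
rewrite /A; case: ifPn => [/set_mem [Ii _]|_]; first exact: Hc.
by rewrite !measure0 mule0.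
Qed.

Lemma tower_nonempty : tower f Y !=set0.
Proof.
apply/set0P/eqP => h; have [] := hnu; rewrite h measure0 => /eqP.
by rewrite eq_sym onee_eq0.
Qed.

Section LevelFunctions.
Variable h : M * nat -> R.
Hypothesis h01 : forall z, 0 <= h z <= 1.
Hypothesis hlevel : forall y z, tower f Y y -> tower f Y z -> y.2 = z.2 ->
  recurrence Y y.1 = recurrence Y z.1 -> h y = h z.

(** On the tower [h] depends only on the level and the return time. Points of one level with
    different return times lie in different pieces, so their separation time is 0 and the bound is
    1. *)
Lemma level_sep y z : tower f Y y -> tower f Y z ->
  `|h y - h z| <= sep_pow b (tower_sep f Y y z).
Proof.
move=> ty tz; have b0 := young_b0 hY.
have h1 : `|h y - h z| <= 1.
  by have /andP[y0 y1] := h01 y; have /andP[z0 z1] := h01 z; rewrite ler_norml; lra.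
rewrite /tower_sep; case: eqP => [e2|_]; last by rewrite /= expr0.
have [er|ner] := pselect (recurrence Y y.1 = recurrence Y z.1).
  rewrite (hlevel ty tz e2 er) subrr normr0; case: sep_time => [n|] //=.
  by rewrite exprn_ge0// ltW.
have [by_ _] := ty; have [bz _] := tz.
rewrite /sep_time asboolT//; case: pselect => [ex|nex] /=.
  case: ex_minnP => n _ /(_ 0%N) n0.
  suff : (n <= 0)%N by rewrite leqn0 => /eqP ->; rewrite expr0.
  apply: n0; apply/asboolP.
  have [i Ii iy] := base_inf_piece by_; have [j Ij jz] := base_inf_piece bz.
  exists i, j; split => // ij; apply: ner.
  by rewrite (recurrenceE hY Ii iy) (recurrenceE hY Ij jz) ij.
exfalso; apply: nex; exists 0%N; apply/asboolP.
have [i Ii iy] := base_inf_piece by_; have [j Ij jz] := base_inf_piece bz.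
exists i, j; split => // ij; apply: ner.
by rewrite (recurrenceE hY Ii iy) (recurrenceE hY Ij jz) ij.
Qed.

Lemma level_F_space : F_space f Y b h.
Proof. by exists 1 => // y z ty tz; rewrite mul1r; exact: level_sep. Qed.

Lemma sep_pow_ge0 s : 0 <= sep_pow b s.
Proof. by case: s => [n|] //=; rewrite exprn_ge0// ltW// (young_b0 hY). Qed.

Lemma level_F_norm : 0 <= F_norm f Y b h <= 2.
Proof.
have [z0 tz0] := tower_nonempty.
have u1 : ubound [set r | exists y z, [/\ tower f Y y, tower f Y z &
    r = `|h y - h z| / sep_pow b (tower_sep f Y y z)]] 1.
  move=> _ [y [z [ty tz ->]]]; have := sep_pow_ge0 (tower_sep f Y y z).
  have := level_sep ty tz; set p := sep_pow _ _; move=> h1.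
  (* At infinite separation time the denominator is 0, and so is the quotient by convention. *)
  rewrite [X in is_true X -> _]le_eqVlt => /orP[/eqP <-|p0]; first by rewrite invr0 mulr0.
  by rewrite ler_pdivrMr// mul1r.
have u2 : ubound [set `|h z| | z in tower f Y] 1.
  by move=> _ [z tz <-]; have /andP[z00 z1] := h01 z; rewrite ger0_norm.
have s1 : 0 <= F_seminorm f Y b h <= 1.
  rewrite /F_seminorm; apply/andP; split; last first.
    by apply: ge_sup => //; exists (`|h z0 - h z0| / sep_pow b (tower_sep f Y z0 z0)), z0, z0.
  apply: (@le_trans _ _ (`|h z0 - h z0| / sep_pow b (tower_sep f Y z0 z0))).
    by rewrite divr_ge0// sep_pow_ge0.
  by apply: ub_le_sup; [exists 1|exists z0, z0].
have s2 : 0 <= sup_norm f Y h <= 1.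
  rewrite /sup_norm; apply/andP; split; last by apply: ge_sup => //; exists `|h z0|, z0.
  apply: (@le_trans _ _ `|h z0|) => //.
  by apply: ub_le_sup; [exists 1|exists z0].
rewrite /F_norm; move/andP: s1 => [s10 s11]; move/andP: s2 => [s20 s21].
by apply/andP; split; lra.
Qed.

End LevelFunctions.

Lemma tower_map_iter x l n : (l + n < recurrence Y x)%N -> iter n T (x, l) = (x, (l + n)%N).
Proof.
elim: n => [|n IH] h; first by rewrite addn0.
rewrite addnS in h *; have h' : (l + n < recurrence Y x)%N by exact: ltnW.
by rewrite iterS (IH h') /tower_map /= h.
Qed.

(* The observables [1_{R > l + n}] and [1_{l = 0}] have disjoint supports after
   [n] steps: the correlation is exactly the product of their integrals. *)
Lemma tail_correlation C0 (v : nat -> R) : 0 < C0 -> (forall n, 0 <= v n) ->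
  decay_rate f Y b nu C0 v -> exists2 C1, 0 < C1 &
  forall (w : disk_param U) n, (1 <= n)%N -> (disk_leb g w (tail Y n) <= (C1 * v n)%:E)%E.
Proof.
move=> C00 v0 dec; have [c c0 Hc] := tail_density.
have mt := tower_borel hf hY.
pose p := fine (nu (lev BI 0)).
have pf : nu (lev BI 0) \is a fin_num by apply: fin_num_measure; exact: level_measurable.
have p0 : 0 < p.
  by apply: fine_gt0; rewrite (nu_base_inf hf hY hnu) -ge0_fin_numE ?measure_ge0.
(* Here 4 bounds the product of the two norms, [p] is the integral of the second observable, and [c]
   converts [nu] into Lebesgue measure. *)
exists (4 * C0 / (c * p)); first by rewrite divr_gt0 ?mulr_gt0.
move=> w n n1; rewrite disk_lebE; last exact: (tail_borel hY).
pose A : set (borel M * nat)%type := \bigcup_l lev (tail Y (l + n)) l.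
pose B : set (borel M * nat)%type := lev setT 0.
have mA : measurable A.
  by apply: bigcup_measurable => l _; apply: level_measurable; exact: (tail_borel hY).
have mB : measurable B by exact: level_measurable.
have AE z : A z <-> tail Y (z.2 + n) z.1.
  case: z => x l; split; first by move=> [j _ [/= tx ->]].
  by move=> tx; exists l.
have i01 (E : set (M * nat)) z : 0 <= (\1_E z : R) <= 1.
  by rewrite indicE; case: (_ \in _); rewrite /= ?lexx ler01.
have levA y z : tower f Y y -> tower f Y z -> y.2 = z.2 ->
    recurrence Y y.1 = recurrence Y z.1 -> \1_A y = \1_A z :> R.
  move=> ty tz e2 er; rewrite !indicE; congr (_%:R); congr nat_of_bool.
  have pt u : tower f Y u -> pieces Y u.1.
    by move=> [bu _]; have [] := base_inf_tail0 hY bu.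
  apply/idP/idP => /set_mem/AE [_ h]; apply/mem_set/AE; split; try exact: pt.
    by rewrite -e2 -er.
  by rewrite e2 er.
have levB y z : tower f Y y -> tower f Y z -> y.2 = z.2 ->
    recurrence Y y.1 = recurrence Y z.1 -> \1_B y = \1_B z :> R.
  move=> _ _ e2 _; rewrite !indicE; congr (_%:R); congr nat_of_bool.
  by apply/idP/idP => /set_mem [_ /= h]; apply/mem_set; split => //=; rewrite ?e2// -e2.
have := dec _ _ (level_F_space (i01 A) levA) (level_F_space (i01 B) levB) n n1.
have /andP[NA0 NA] := level_F_norm (i01 A) levA.
have /andP[NB0 NB] := level_F_norm (i01 B) levB.
rewrite /correlation.
have -> : \int[nu]_(z in tower f Y) (\1_A z * \1_B (iter n T z)) = 0.
  transitivity (\int[nu]_(z in tower f Y) (0 : R)); last by rewrite /Rintegral integral0.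
  apply: eq_Rintegral => -[x l] /set_mem tz.
  rewrite !indicE; case: (boolP ((x, l) \in A)) => [/set_mem/AE [_ /= h]|_]; last by rewrite mul0r.
  (* After [n] steps the point is on level [l + n], which is not 0 since [n >= 1]. *)
  rewrite tower_map_iter// memNset ?mulr0//.
  by move=> [_ /= h']; move: n1; rewrite (_ : n = 0%N)//; lia.
have -> : \int[nu]_(z in tower f Y) \1_A z = fine (nu (A `&` tower f Y)).
  by rewrite /Rintegral integral_indic.
have -> : \int[nu]_(z in tower f Y) \1_B z = p.
  rewrite /Rintegral integral_indic// /p; congr (fine (nu _)).
  apply/seteqP; split => -[x l]; first by move=> [[_ /= ->] [/= bx _]].
  move=> [/= bx ->]; split => //; split => //=.
  by have [] := base_inf_tail0 hY bx.
(* Level 0 of [A] alone already contains the tail. *)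
have At : (nu (lev (tail Y n `&` BI) 0) <= nu (A `&` tower f Y))%E.
  apply: le_measure; rewrite ?inE.
  - apply: level_measurable; apply: measurableI => //; exact: (tail_borel hY).
  - exact: measurableI.
  - move=> [x l] [/= [tx bx] ->]; split; first by apply/AE; rewrite add0n.
    by split => //=; have [] := base_inf_tail0 hY bx.
have fA : nu (A `&` tower f Y) \is a fin_num.
  by apply: fin_num_measure; exact: measurableI.
have A0 : 0 <= fine (nu (A `&` tower f Y)) by rewrite fine_ge0// measure_ge0.
rewrite sub0r normrN ger0_norm; last by rewrite mulr_ge0// ltW.
move=> cor.
have {}cor : fine (nu (A `&` tower f Y)) * p <= 4 * C0 * v n.
  apply: (le_trans cor); move: NA0 NA NB0 NB.
  set x := F_norm _ _ _ _; set y := F_norm _ _ _ _ => x0 x2 y0 y2.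
  have -> : C0 * x * y * v n = C0 * v n * (x * y) by ring.
  have -> : 4 * C0 * v n = C0 * v n * (2 * 2) by ring.
  by apply: ler_wpM2l; [rewrite mulr_ge0// ltW|exact: ler_pM].
have := le_trans (Hc w n) At; rewrite -(fineK fA) -lee_pdivlMl// => /le_trans; apply.
rewrite -EFinM lee_fin.
have -> : 4 * C0 / (c * p) * v n = c^-1 * (4 * C0 * v n / p).
  by field; rewrite !gt_eqF.
by rewrite ler_pM2l ?invr_gt0// ler_pdivlMr.
Qed.

End Correlation.

Theorem theorem4 (R : realType) (m : nat) (M : manifold R m)
    (g : riemannian_metric M) (eta : R) (heta : 0 < eta <= 1)
    (f finv : M -> M) (hf : C1_holder_diffeo eta f finv)
    (K : set M) (hK : partially_hyperbolic f finv K)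
    (Y : young_data M) (C beta : R) (hY : young_structure f Y g C beta)
    (hYK : base Y `<=` K)
    (nu : probability (borel M * nat)%type R) (hnu : srb_measure f Y g nu) :
  (forall alpha C0 : R, 1 < alpha -> 0 < C0 ->
     decay_rate f Y beta nu C0 (fun n => n%:R `^ (- alpha)) ->
     exists (Y' : young_data M) (C' beta' : R),
       young_structure f Y' g C' beta' /\
       exists2 C1 : R, 0 < C1 &
         forall (w : disk_param (udisks Y')) (n : nat), (1 <= n)%N ->
           (disk_leb g w (tail Y' n) <= (C1 * n%:R `^ (- alpha))%:E)%E)
  /\
  (forall tau theta C0 : R, 0 < tau -> 0 < theta -> 0 < C0 ->
     decay_rate f Y beta nu C0 (fun n => expR (- (tau * n%:R `^ theta))) ->
     exists (Y' : young_data M) (C' beta' : R),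
       young_structure f Y' g C' beta' /\
       exists tau' C1 : R, [/\ 0 < tau', 0 < C1 &
         forall (w : disk_param (udisks Y')) (n : nat), (1 <= n)%N ->
           (disk_leb g w (tail Y' n)
              <= (C1 * expR (- (tau' * n%:R `^ (theta / (theta + 1)))))%:E)%E]).
Proof.
split => [alpha C0 _ C00 dec|tau theta C0 tau0 theta0 C00 dec].
  have [C1 C10 H] := tail_correlation hf hY hnu C00 (fun n => powR_ge0 _ _) dec.
  by exists Y, C, beta; split; [exact: hY|exists C1].
have [C1 C10 H] := tail_correlation hf hY hnu C00 (fun n => expR_ge0 _) dec.
exists Y, C, beta; split; [exact: hY|exists tau, C1; split => // w n n1].
(* For [n >= 1] the power increases with the exponent, so [tau] itself serves as the new rate. *)
apply: (le_trans (H w n n1)); rewrite lee_fin ler_pM2l// ler_expR lerN2 ler_pM2l//.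
apply: ler_powR; first by rewrite ler1n.
by rewrite ler_pdivrMr ?addr_gt0// mulrDr mulr1 lerDr mulr_ge0// ltW.
Qed.
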